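(* Let $X=(X_t)_{t\in[0,1]}$ be a Lévy process satisfying (CD), let $C$ be its convex minorant on $[0,1]$, and let $U$ be uniform on $(0,1)$ independent of $X$. Almost surely $U\in\mathscr{O}$; let $(g,d)$ be the excursion interval containing $U$ and define $X^U=(X^U_t)_{t\le1}$ by $$X^U_t=\begin{cases}X_{U+t}-X_U,&0\le t<d-U,\\ C_d-C_g+X_{g+t-(d-U)}-X_U,&d-U\le t\le d-g,\\ C_d-C_g+X_{t-(d-g)},&d-g\le t<d,\\ X_t,&d\le t\le1.\end{cases}$$ Then the pairs $(U,X)$ and $(d-g,X^U)$ have the same law.
   Context: Hypothesis (CD): for all $t>0$ and $x\in\mathbb{R}$, $\mathbb{P}(X_t=x)=0$. The convex minorant of $X$ on $[0,1]$ is the greatest convex function $C\le X$ on $[0,1]$. $\mathscr{O}=\{s\in(0,1):C_s<X_s\wedge X_{s-}\}$; its connected components are the excursion intervals. *)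

(* Defs.v *)
From HB Require Import structures.
From mathcomp Require Import all_boot all_order all_algebra.
From mathcomp Require Import all_classical all_reals all_analysis.
Set Implicit Arguments. Unset Strict Implicit. Unset Printing Implicit Defensive.
Import Order.TTheory GRing.Theory Num.Theory.
Import numFieldNormedType.Exports.
Local Open Scope classical_set_scope.
Local Open Scope ring_scope.

Section Defs.
Context {R : realType} {d : measure_display} {Omega : measurableType d}.
Variable P : probability Omega R.

(* X : R -> Omega -> R is a process indexed by t in [0,1] (values at other t are ignored). *)

Definition cadlag01 (f : R -> R) : Prop :=
  (forall s, 0 <= s < 1 -> f x @[x --> s^'+] --> f s) /\
  (forall s, 0 < s <= 1 -> cvg (f x @[x --> s^'-])).

Definition left_lim (f : R -> R) (s : R) : R := lim (f x @[x --> s^'-]).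

Definition indep_increments (X : R -> Omega -> R) : Prop :=
  forall (n : nat) (t : nat -> R) (B : nat -> set R),
    (forall i, (i <= n)%N -> 0 <= t i <= 1) ->
    (forall i, (i < n)%N -> t i <= t i.+1) ->
    (forall i, measurable (B i)) ->
    P (\bigcap_(i in [set k | (k < n)%N]) [set w | B i (X (t i.+1) w - X (t i) w)])
    = (\prod_(i < n) P [set w | B i (X (t i.+1) w - X (t i) w)%R])%E.

Definition stationary_increments (X : R -> Omega -> R) : Prop :=
  forall (t s : R) (B : set R), 0 <= t -> 0 <= s -> t + s <= 1 -> measurable B ->
    P [set w | B (X (t + s) w - X t w)] = P [set w | B (X s w)].

Definition levy_process01 (X : R -> Omega -> R) : Prop :=
  [/\ forall t, 0 <= t <= 1 -> measurable_fun setT (X t),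
      forall w, X 0 w = 0,
      forall w, cadlag01 (X ^~ w),
      indep_increments X & stationary_increments X].

Definition CD (X : R -> Omega -> R) : Prop :=
  forall t x, 0 < t <= 1 -> P [set w | X t w = x] = 0%E.

Definition uniform01 (U : Omega -> R) : Prop :=
  measurable_fun setT U /\
  forall B : set R, measurable B ->
    P (U @^-1` B) = (@lebesgue_measure R) (B `&` `]0, 1[).

Definition indep_of_process (U : Omega -> R) (X : R -> Omega -> R) : Prop :=
  forall (n : nat) (t : nat -> R) (A : set R) (B : nat -> set R),
    (forall i, (i < n)%N -> 0 <= t i <= 1) ->
    measurable A -> (forall i, measurable (B i)) ->
    let E := \bigcap_(i in [set k | (k < n)%N]) [set w | B i (X (t i) w)] in
    P (U @^-1` A `&` E) = (P (U @^-1` A) * P E)%E.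

Definition convex01 (c : R -> R) : Prop :=
  forall x y l, 0 <= x <= 1 -> 0 <= y <= 1 -> 0 <= l <= 1 ->
    c (l * x + (1 - l) * y) <= l * c x + (1 - l) * c y.

Definition convex_minorant01 (f c : R -> R) : Prop :=
  [/\ convex01 c, (forall s, 0 <= s <= 1 -> c s <= f s) &
      (forall c', convex01 c' -> (forall s, 0 <= s <= 1 -> c' s <= f s) ->
         forall s, 0 <= s <= 1 -> c' s <= c s)].

Definition excursion_set (f c : R -> R) : set R :=
  [set s | 0 < s < 1 /\ c s < Num.min (f s) (left_lim f s)].

Definition exc_left (f c : R -> R) (u : R) : R :=
  inf (connected_component (excursion_set f c) u).
Definition exc_right (f c : R -> R) (u : R) : R :=
  sup (connected_component (excursion_set f c) u).

Definition shifted_path (f c : R -> R) (u : R) (t : R) : R :=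
  let g := exc_left f c u in let dd := exc_right f c u in
  if t < dd - u then f (u + t) - f u
  else if t <= dd - g then c dd - c g + f (g + t - (dd - u)) - f u
  else if t < dd then c dd - c g + f (t - (dd - g))
  else f t.

End Defs.

(* sigma-algebra on R * (R -> R) (a real number and a path on [0,1]) generated by
   the first projection and the evaluations at times t in [0,1]: the product
   sigma-algebra on R x R^[0,1] *)
Definition path_generators (R : realType) : set (set (R * (R -> R))) :=
  [set A | (exists B : set R, measurable B /\ A = fst @^-1` B) \/
           (exists (t : R) (B : set R), 0 <= t <= 1 /\ measurable B /\
                A = (fun p => p.2 t) @^-1` B)].

Definition path_measurable (R : realType) : set (set (R * (R -> R))) :=
  <<s (@path_generators R) >>.
Arguments path_measurable : clear implicits.

(* Main.v *)
(**
Sampling X at the dyadic times j / 2^n turns the increments into a continuous i.i.d. sequence, and U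
into a uniform index independent of it. Call [g, g + k] a face of a walk if it lies strictly above its
chord there, and the line through the chord stays strictly below the walk elsewhere: almost surely
each index is straddled by exactly one face. Moving the face of length k that straddles u = g + i to
the front, cyclically shifted so that it starts at u, is a permutation of the steps. For a generic walk
and each k there is exactly one pair (g, i) whose inverse permutation makes [g, g + k] a face: i is
given by the minimum of the first k steps tilted by their mean slope, and g by the minimum of the
remaining steps tilted by the same slope. Summing over (g, i), exchangeability shows that (k, rearranged
walk) has the law of (u + 1, walk) at every level n.

To pass to the limit, note that no line below X touches it three times: the increment of X over a dyadic
interval separating the touching points is atomless and independent of the rest of the path, while a
third touching point would determine it. The discrete law also bounds the probability that u is close to
an endpoint of its face, uniformly in n, so that along a subsequence the faces stay macroscopic around U;
if U were a touching point of the support line at U, the endpoints would accumulate at two more. Hence U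
lies in an excursion interval, whose endpoints are the limits of the endpoints of the faces, and the
rearranged walks converge to the transformed path at each time t <> d - g. Comparing distribution functions
identifies first the law of d - g, which is atomless, and then all finite-dimensional laws.
*)
Require Import Defs.
From HB Require Import structures.
From mathcomp Require Import all_boot all_order all_algebra.
From mathcomp Require Import all_classical all_reals all_analysis.
From mathcomp Require Import measurable_realfun.
From mathcomp Require Import zify ring lra.
Import Order.TTheory GRing.Theory Num.Theory.
Import numFieldNormedType.Exports.
Set Implicit Arguments. Unset Strict Implicit. Unset Printing Implicit Defensive.
Local Open Scope classical_set_scope.
Local Open Scope ring_scope.

(** Two obstacles shape the limit. Nothing is assumed about how [C w] depends on [w], and the ends
    of the excursion interval are an infimum and a supremum over a component, so the law of the
    transformed pair has a meaning only after a measurable version is produced: on an event [G] of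
    full measure, its sublevel sets are expressed by countably many conditions on the sampled walks.
    Moreover paths are only right-continuous, while the vertices of the faces approach g and d from
    sides that cannot be controlled. A time t is therefore replaced by a dyadic time strictly to its
    right, the walks are refined with that time fixed, and only then does it decrease to t; limits
    of laws are iterated in this order. For the same reason contact with a line is understood
    through values of the path near a point, which covers left limits, and path values at the
    vertices are controlled by the line they approach and not by continuity. *)

(** * Probabilities as real numbers *)

Section RealProbability.
Context {R : realType} {d : measure_display} {Omega : measurableType d}.
Variable P : probability Omega R.

Definition pr (A : set Omega) : R := fine (P A).

Lemma prE A : measurable A -> P A = (pr A)%:E.
Proof. by move=> mA; rewrite /pr fineK // fin_num_measure. Qed.

Lemma pr_ge0 A : 0 <= pr A.
Proof. by rewrite /pr fine_ge0. Qed.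

Lemma prT : pr setT = 1.
Proof. by rewrite /pr probability_setT. Qed.

Lemma pr0 : pr set0 = 0.
Proof. by rewrite /pr measure0. Qed.

Lemma pr_le A B : measurable A -> measurable B -> A `<=` B -> pr A <= pr B.
Proof.
move=> mA mB AB; rewrite -lee_fin -!prE //.
by apply: le_measure => //; rewrite inE.
Qed.

Lemma prU A B : measurable A -> measurable B -> A `&` B = set0 ->
  pr (A `|` B) = pr A + pr B.
Proof.
move=> mA mB AB; apply: EFin_inj; rewrite EFinD -!prE //; last exact: measurableU.
by rewrite measureU.
Qed.

Lemma prC A : measurable A -> pr (~` A) = 1 - pr A.
Proof.
move=> mA; apply: EFin_inj; rewrite EFinB -!prE //; last exact: measurableC.
exact: probability_setC.
Qed.

Lemma prIC A B : measurable A -> measurable B ->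
  pr (~` A `&` B) = pr B - pr (A `&` B).
Proof.
move=> mA mB.
have -> : pr B = pr ((A `&` B) `|` (~` A `&` B)).
  by congr pr; rewrite -setIUl setUCr setTI.
rewrite prU.
- by rewrite addrAC subrr add0r.
- exact: measurableI.
- by apply: measurableI => //; exact: measurableC.
- by rewrite setIACA setICr set0I.
Qed.

Lemma prU_le A B : measurable A -> measurable B -> pr (A `|` B) <= pr A + pr B.
Proof.
move=> mA mB; rewrite -lee_fin EFinD -!prE //; last exact: measurableU.
exact: measureU2.
Qed.

Lemma pr_bigcup_cvg (F : nat -> set Omega) : (forall n, measurable (F n)) ->
  trivIset setT F -> series (fun n => pr (F n)) @ \oo --> pr (\bigcup_n F n).
Proof.
move=> mF tF.
have mU : measurable (\bigcup_n F n) by exact: bigcup_measurable.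
have : (\sum_(0 <= i < n) P (F i))%E @[n --> \oo] --> (pr (\bigcup_n F n))%:E.
  by rewrite -(prE mU); exact: measure_semi_sigma_additive.
move=> /fine_cvgP [_]; apply: cvg_trans; apply: near_eq_cvg.
apply: nearW => n /=; rewrite /series /=.
under eq_bigr => i _ do rewrite (prE (mF i)).
by rewrite sumEFin.
Qed.

Lemma pr_negligible A : measurable A -> P.-negligible A -> pr A = 0.
Proof. by move=> mA /(negligibleP P mA); rewrite /pr => ->. Qed.

Lemma pr0_negligible A : measurable A -> pr A = 0 -> P.-negligible A.
Proof. by move=> mA e; apply/negligibleP => //; have := prE mA; rewrite e. Qed.

Lemma pr1_ae A : measurable A -> pr A = 1 -> {ae P, forall w, A w}.
Proof.
move=> mA e; apply: pr0_negligible; first exact: measurableC.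
by rewrite -/(~` A) prC // e subrr.
Qed.

(** Continuity from above along the tail unions [G k], which decrease to the event that infinitely
    many [E k] occur. It turns almost sure eventual statements into bounds on probabilities. *)
Lemma pr_inf_often (E : nat -> set Omega) : (forall n, measurable (E n)) ->
  {ae P, forall w, exists k0, forall k, (k0 <= k)%N -> ~ E k w} ->
  forall e, 0 < e -> exists k0, forall k, (k0 <= k)%N -> pr (E k) < e.
Proof.
move=> mE aeE e e0.
pose G k := \bigcup_(j in [set j | (k <= j)%N]) E j.
have mG k : measurable (G k) by exact: bigcup_measurable.
have mI : measurable (\bigcap_n G n) by exact: bigcapT_measurable.
have P0 : P (\bigcap_n G n) = 0%E.
  apply/(negligibleP P mI); apply: negligibleS aeE => w hw [k0 hk0].
  by have [j /= k0j Ej] := hw k0 I; exact: (hk0 j).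
have ni : nonincreasing_seq G.
  by move=> m n mn; apply/subsetPset => w [j /= nj Ej]; exists j => //=; exact: leq_trans nj.
have cG : (fun k => (pr (G k))%:E) @ \oo --> 0%E.
  rewrite (_ : (fun k => _) = P \o G); last first.
    by apply/funext => k /=; rewrite prE.
  rewrite -P0; apply: nonincreasing_cvg_mu => //.
  by move: (ltry (pr (G 0%N))); rewrite -prE.
move: cG => /fine_cvgP [_] /cvgr_lt /(_ e e0) [k0 _ hk0].
exists k0 => k k0k; apply: le_lt_trans (hk0 k k0k) => /=.
by apply: pr_le => // w Ew; exists k => /=.
Qed.

End RealProbability.

(** * Laws determined on a pi-system *)

Section LawDetermined.
Context {R : realType} {d d1 d2 dT : measure_display}.
Context {O1 : measurableType d1} {O2 : measurableType d2} {T : measurableType dT}.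
Variables (P1 : probability O1 R) (P2 : probability O2 R).

(** Dynkin induction. The weights [c1], [c2] and the fixed events [F1], [F2] make one statement
    serve both equality of laws and independence, where a weight is the probability of the other
    event. *)
Lemma pi_law (G : set (set T)) (f1 : O1 -> T) (f2 : O2 -> T)
    (F1 : set O1) (F2 : set O2) (c1 c2 : R) :
  @measurable _ T = <<s G >> -> setI_closed G ->
  measurable_fun setT f1 -> measurable_fun setT f2 ->
  measurable F1 -> measurable F2 ->
  c1 * pr P1 F1 = c2 * pr P2 F2 ->
  (forall A, G A -> c1 * pr P1 (f1 @^-1` A `&` F1) = c2 * pr P2 (f2 @^-1` A `&` F2)) ->
  forall A, measurable A ->
    c1 * pr P1 (f1 @^-1` A `&` F1) = c2 * pr P2 (f2 @^-1` A `&` F2).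
Proof.
move=> mG GI mf1 mf2 mF1 mF2 e0 eG A.
have m1 B : measurable B -> measurable (f1 @^-1` B).
  by move=> mB; rewrite -[X in measurable X]setTI; exact: mf1.
have m2 B : measurable B -> measurable (f2 @^-1` B).
  by move=> mB; rewrite -[X in measurable X]setTI; exact: mf2.
rewrite {1}mG; move: A; apply: (dynkin_induction mG GI) => //.
- by rewrite !preimage_setT !setTI.
- move=> S mS eS; rewrite -(preimage_setC f1 S) -(preimage_setC f2 S).
  rewrite (prIC P1 (m1 _ mS) mF1) (prIC P2 (m2 _ mS) mF2).
  by rewrite (mulrBr c1) (mulrBr c2) eS e0.
- move=> F mF tF eF.
  have t1 : trivIset setT (fun n => f1 @^-1` F n `&` F1).
    by move=> i j _ _ [w [[a _] [b _]]]; apply: (tF i j I I); eexists; split; [exact: a|exact: b].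
  have t2 : trivIset setT (fun n => f2 @^-1` F n `&` F2).
    by move=> i j _ _ [w [[a _] [b _]]]; apply: (tF i j I I); eexists; split; [exact: a|exact: b].
  rewrite !preimage_bigcup !setI_bigcupl.
  have c1P : (fun n => c1 * series (fun n => pr P1 (f1 @^-1` F n `&` F1)) n) @ \oo -->
      c1 * pr P1 (\bigcup_n (f1 @^-1` F n `&` F1)).
    apply: cvgMr => //; apply: pr_bigcup_cvg => // n; apply: measurableI => //; exact: m1.
  have c2P : (fun n => c2 * series (fun n => pr P2 (f2 @^-1` F n `&` F2)) n) @ \oo -->
      c2 * pr P2 (\bigcup_n (f2 @^-1` F n `&` F2)).
    apply: cvgMr => //; apply: pr_bigcup_cvg => // n; apply: measurableI => //; exact: m2.
  have e : (fun n => c1 * series (fun n => pr P1 (f1 @^-1` F n `&` F1)) n) =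
           (fun n => c2 * series (fun n => pr P2 (f2 @^-1` F n `&` F2)) n).
    by apply/funext => n; rewrite /series /= !mulr_sumr; apply: eq_bigr => i _; exact: eF.
  by rewrite e in c1P; exact: (cvg_unique _ c1P c2P).
Qed.

End LawDetermined.

(** * Real sequences with the product sigma-algebra *)

Section RealSequences.
Context {R : realType}.

Definition rectangles : set (set (nat -> R)) :=
  [set A | exists B : nat -> set R,
     (forall i, measurable (B i)) /\ A = [set y | forall i, B i (y i)]].

Definition rseq := g_sigma_algebraType rectangles.

Lemma rectangles_setI : setI_closed rectangles.
Proof.
move=> _ _ [B [mB ->]] [B' [mB' ->]].
exists (fun i => B i `&` B' i); split; first by move=> i; exact: measurableI.
by apply/seteqP; split=> y /= => [[h h'] i|h]; [split|split => i; case: (h i)].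
Qed.

Lemma measurable_rseqE : @measurable _ rseq = <<s rectangles >>.
Proof. by []. Qed.

Lemma measurable_coord i : measurable_fun setT (fun y : rseq => y i).
Proof.
move=> _ B mB; rewrite setTI; apply: sub_sigma_algebra.
exists (fun j => if j == i then B else setT); split.
  by move=> j; case: ifP.
apply/seteqP; split => y /= => [h j|/(_ i)]; last by rewrite eqxx.
by case: eqP => // ->.
Qed.

Lemma measurable_to_rseq d (T : measurableType d) (f : T -> rseq) :
  (forall i, measurable_fun setT (fun w => f w i)) -> measurable_fun setT f.
Proof.
move=> mf; apply: (measurability _ measurable_rseqE).
move=> _ [A [B [mB ->]] <-]; rewrite setTI.
rewrite (_ : _ @^-1` _ = \bigcap_i ((fun w => f w i) @^-1` B i)); last first.
  by apply/seteqP; split => w /= h i; [move=> _|]; exact: h.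
apply: bigcapT_measurable => i; rewrite -[X in measurable X]setTI; exact: mf.
Qed.

End RealSequences.
Arguments rseq : clear implicits.

(** * Measurability of events given by formulas *)

Section MeasurablePredicates.
Context {R : realType} {d : measure_display} {T : measurableType d}.
Implicit Types Q : T -> Prop.

Lemma mset_cst (p : Prop) : measurable [set _ : T | p].
Proof.
have [hp|hp] := pselect p.
  by rewrite (_ : [set _ | _] = setT) //; apply/seteqP; split.
by rewrite (_ : [set _ | _] = set0) //; apply/seteqP; split.
Qed.

Lemma mset_not Q : measurable [set w | Q w] -> measurable [set w | ~ Q w].
Proof. exact: measurableC. Qed.

Lemma mset_and Q1 Q2 : measurable [set w | Q1 w] -> measurable [set w | Q2 w] ->
  measurable [set w | Q1 w /\ Q2 w].
Proof. exact: measurableI. Qed.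

Lemma mset_or Q1 Q2 : measurable [set w | Q1 w] -> measurable [set w | Q2 w] ->
  measurable [set w | Q1 w \/ Q2 w].
Proof. exact: measurableU. Qed.

Lemma mset_imp Q1 Q2 : measurable [set w | Q1 w] -> measurable [set w | Q2 w] ->
  measurable [set w | Q1 w -> Q2 w].
Proof.
move=> m1 m2; rewrite (_ : [set w | _] = [set w | ~ Q1 w \/ Q2 w]).
  by apply: mset_or => //; exact: mset_not.
apply/seteqP; split => w /= => [h|[|]//].
by have [q|q] := pselect (Q1 w); [right; exact: h|left].
Qed.

Lemma mset_all (I : countType) (Q : I -> T -> Prop) :
  (forall i, measurable [set w | Q i w]) -> measurable [set w | forall i, Q i w].
Proof.
move=> mQ; rewrite (_ : [set w | _] = ~` \bigcup_i ~` [set w | Q i w]).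
  apply: measurableC; apply: countable_bigcupT_measurable => // i.
  exact: measurableC.
apply/seteqP; split => w /= => [h [i _]|h i]; first exact.
by apply: contrapT => nQ; apply: h; exists i.
Qed.

Lemma mset_ex (I : countType) (Q : I -> T -> Prop) :
  (forall i, measurable [set w | Q i w]) -> measurable [set w | exists i, Q i w].
Proof.
move=> mQ; rewrite (_ : [set w | _] = \bigcup_i [set w | Q i w]).
  by apply: countable_bigcupT_measurable.
by apply/seteqP; split => w /= => [[i h]|[i _ h]]; exists i.
Qed.

Variables f g : T -> R.
Hypotheses (mf : measurable_fun setT f) (mg : measurable_fun setT g).

Lemma mset_lt : measurable [set w | f w < g w].
Proof.
have := measurable_fun_ltr mf mg => /(_ measurableT [set true]); rewrite setTI; exact.
Qed.

Lemma mset_le : measurable [set w | f w <= g w].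
Proof.
have := measurable_fun_ler mf mg => /(_ measurableT [set true]); rewrite setTI; exact.
Qed.

Lemma mset_eq : measurable [set w | f w = g w].
Proof.
have := measurable_fun_eqr mf mg => /(_ measurableT [set true]); rewrite setTI => /(_ I).
by congr (measurable _); apply/seteqP; split => w /= /eqP.
Qed.

End MeasurablePredicates.

(** * Independence and atomless variables *)

Section Independence.
Context {R : realType} {d : measure_display} {Omega : measurableType d}.
Variable P : probability Omega R.

Definition indep_fun {d1 d2} {T1 : measurableType d1} {T2 : measurableType d2}
    (f : Omega -> T1) (g : Omega -> T2) :=
  forall A B, measurable A -> measurable B ->
    pr P (f @^-1` A `&` g @^-1` B) = pr P (f @^-1` A) * pr P (g @^-1` B).

Lemma measurable_preimage {d1} {T1 : measurableType d1} (f : Omega -> T1) A :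
  measurable_fun setT f -> measurable A -> measurable (f @^-1` A).
Proof. by move=> mf mA; rewrite -[X in measurable X]setTI; exact: mf. Qed.

(** The pi-system argument is applied twice, releasing first the event of [g] and then that of
    [f]. *)
Lemma indep_fun_pi {d1 d2} {T1 : measurableType d1} {T2 : measurableType d2}
    (f : Omega -> T1) (g : Omega -> T2) (G1 : set (set T1)) (G2 : set (set T2)) :
  measurable_fun setT f -> measurable_fun setT g ->
  @measurable _ T1 = <<s G1 >> -> setI_closed G1 ->
  @measurable _ T2 = <<s G2 >> -> setI_closed G2 ->
  (forall A B, G1 A -> G2 B ->
     pr P (f @^-1` A `&` g @^-1` B) = pr P (f @^-1` A) * pr P (g @^-1` B)) ->
  indep_fun f g.
Proof.
move=> mf mg e1 I1 e2 I2 h.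
have m1 A : G1 A -> measurable A by move=> GA; rewrite e1; exact: sub_sigma_algebra.
have m2 A : G2 A -> measurable A by move=> GA; rewrite e2; exact: sub_sigma_algebra.
have h1 A B : G1 A -> measurable B ->
    pr P (f @^-1` A `&` g @^-1` B) = pr P (f @^-1` A) * pr P (g @^-1` B).
  move=> GA mB; have mA := m1 _ GA.
  have := @pi_law _ _ _ _ _ _ T2 P P G2 g g (f @^-1` A) setT 1 (pr P (f @^-1` A)) e2 I2 mg mg.
  move=> /(_ (measurable_preimage mf mA) measurableT).
  rewrite mul1r prT mulr1 => /(_ erefl) H.
  have {}H := H _ B mB; rewrite mul1r setIT in H; rewrite setIC; apply: H.
  by move=> B' GB'; rewrite mul1r setIT setIC; exact: h.
move=> A B mA mB.
have := @pi_law _ _ _ _ _ _ T1 P P G1 f f (g @^-1` B) setT 1 (pr P (g @^-1` B)) e1 I1 mf mf.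
move=> /(_ (measurable_preimage mg mB) measurableT).
rewrite mul1r prT mulr1 => /(_ erefl) H.
have {}H := H _ A mA; rewrite mul1r setIT mulrC in H; apply: H.
by move=> A' GA'; rewrite mul1r setIT mulrC; exact: h1.
Qed.

Lemma indep_fun_comp {d1 d2 d3 d4} {T1 : measurableType d1} {T2 : measurableType d2}
    {T3 : measurableType d3} {T4 : measurableType d4}
    (f : Omega -> T1) (g : Omega -> T2) (h : T1 -> T3) (k : T2 -> T4) :
  measurable_fun setT h -> measurable_fun setT k ->
  indep_fun f g -> indep_fun (h \o f) (k \o g).
Proof.
move=> mh mk fg A B mA mB; apply: (fg (h @^-1` A) (k @^-1` B)).
  by rewrite -[X in measurable X]setTI; exact: mh.
by rewrite -[X in measurable X]setTI; exact: mk.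
Qed.

Section Atomless.
Context {dT : measure_display} {T : measurableType dT}.
Variables (f : Omega -> T) (D : Omega -> R).
Hypotheses (mf : measurable_fun setT f) (mD : measurable_fun setT D).
Hypotheses (fD : indep_fun f D) (D0 : forall x, pr P (D @^-1` [set x]) = 0).

Let fM : {mfun Omega >-> T} := HB.pack f (isMeasurableFun.Build _ _ _ _ f mf).
Let DM : {mfun Omega >-> R} := HB.pack D (isMeasurableFun.Build _ _ _ _ D mD).

Let fDw := fun w => (f w, D w).
Let mfDw : measurable_fun setT fDw.
Proof. exact: measurable_fun_pair. Qed.
Let fDM : {mfun Omega >-> (T * R)%type} :=
  HB.pack fDw (isMeasurableFun.Build _ _ _ _ fDw mfDw).

(** By independence the joint law is a product measure, and each section of [E] has at most one
    point, which the atomless [D] avoids almost surely. *)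
Lemma indep_atomless_null (E : set (T * R)) : measurable E ->
  (forall t x y, E (t, x) -> E (t, y) -> x = y) ->
  P.-negligible [set w | E (f w, D w)].
Proof.
move=> mE Euniq.
apply/negligibleP; first exact: (measurable_preimage mfDw).
transitivity (distribution P fDM E); first by [].
rewrite -(@product_measure_unique _ _ _ _ _ (distribution P fM) (distribution P DM)) //.
- rewrite /product_measure1 integral0_eq // => x _ /=.
  have [[y Exy]|nE] := pselect (exists y, E (x, y)).
    have -> : xsection E x = [set y].
      apply/seteqP; split => z; rewrite /xsection /= inE => h; first exact: Euniq h Exy.
      by rewrite h.
    rewrite /distribution /pushforward /= prE ?D0 //.
    exact: measurable_preimage.
  have -> : xsection E x = set0.
    by apply/seteqP; split => z //; rewrite /xsection /= inE => h; apply: nE; exists z.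
  by rewrite measure0.
- move=> A B mA mB; rewrite /distribution /pushforward /=.
  have mA' := measurable_preimage mf mA; have mB' := measurable_preimage mD mB.
  transitivity (pr P (f @^-1` A `&` D @^-1` B))%:E.
    by rewrite -prE //; exact: measurableI.
  by rewrite fD // EFinM -!prE.
Qed.

(** If the rational cut of [D] could be read from [f], then [D] would be a function of the
    independent [f]: two values compatible with the same [f] would be separated by a rational, which
    the cut forbids. *)
Lemma indep_rational_cut (G : rat -> set T) : (forall a, measurable (G a)) ->
  P.-negligible [set w | forall a : rat,
    (ratr a < D w -> G a (f w)) /\ (G a (f w) -> ratr a <= D w)].
Proof.
move=> mG.
pose E : set (T * R) := [set p | forall a : rat,
  (ratr a < p.2 -> G a p.1) /\ (G a p.1 -> ratr a <= p.2)].
have mE : measurable E.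
  apply: mset_all => a.
  have mGa : measurable [set p : T * R | G a p.1].
    by rewrite -[X in measurable X]setTI; exact: measurable_fst.
  by apply: mset_and; apply: mset_imp => //; [apply: mset_lt|apply: mset_le];
    first [exact: measurable_snd|exact: measurable_cst].
have lt_absurd t x y : E (t, x) -> E (t, y) -> x < y -> False.
  move=> Ex Ey xy; have [a] := rat_in_itvoo xy; rewrite in_itv /= => /andP[xa ay].
  have [_ h] := Ex a; have [k _] := Ey a.
  by move: (h (k ay)); rewrite leNgt /= xa.
have Eu t x y : E (t, x) -> E (t, y) -> x = y.
  move=> Ex Ey; case: (ltgtP x y) => // xy; exfalso;
    [exact: lt_absurd Ex Ey xy|exact: lt_absurd Ey Ex xy].
exact: indep_atomless_null mE Eu.
Qed.

End Atomless.
End Independence.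

(** * Finite i.i.d. sequences *)

Section IidSequences.
Context {R : realType} {d : measure_display} {Omega : measurableType d}.
Variable P : probability Omega R.

(** Steps from [N] on vanish, so that walks of every length live in the one space [rseq R]. The
    common law enters through the set function [q]; the last clause says that it has no atoms. *)
Definition iid_seq (N : nat) (y : Omega -> nat -> R) (q : set R -> R) :=
  [/\ forall i, measurable_fun setT (fun w => y w i),
      forall w i, (N <= i)%N -> y w i = 0,
      forall B : nat -> set R, (forall i, measurable (B i)) ->
        pr P [set w | forall i, (i < N)%N -> B i (y w i)] = \prod_(i < N) q (B i),
      q setT = 1 & forall x, q [set x] = 0].

Variables (N : nat) (y : Omega -> rseq R) (q : set R -> R).
Hypothesis iid_y : iid_seq N y q.

Lemma iid_measurable : measurable_fun setT y.
Proof. by case: iid_y => my _ _ _ _; exact: measurable_to_rseq. Qed.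

(** The Boolean factor accounts for the padding: a rectangle that excludes 0 at some index from [N]
    on is never met. *)
Lemma iid_rectangle B : (forall i, measurable (B i)) ->
  pr P (y @^-1` [set z | forall i, B i (z i)]) =
  `[< forall i, (N <= i)%N -> B i 0 >]%:R * \prod_(i < N) q (B i).
Proof.
case: iid_y => my y0 hy _ _ mB.
have [h|nh] := pselect (forall i, (N <= i)%N -> B i 0).
  rewrite asboolT // mul1r -hy //; congr pr; apply/seteqP; split => w /= hw i //.
  by have [/hw//|Ni] := ltnP i N; rewrite y0 //; exact: h.
rewrite asboolF // mul0r -(pr0 P); congr pr; apply/seteqP; split => w //= hw.
by apply: nh => i Ni; have := hw i; rewrite y0.
Qed.

Lemma iid_marginal i B : (i < N)%N -> measurable B -> pr P [set w | B (y w i)] = q B.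
Proof.
case: iid_y => my y0 hy qT _ iN mB.
have := hy (fun j => if j == i then B else setT).
rewrite (bigD1 (Ordinal iN)) //= eqxx big1 ?mulr1; last first.
  by move=> j /eqP ji; case: eqP => // e; case: ji; exact/val_inj.
move=> <-; last by move=> j; case: ifP.
congr pr; apply/seteqP; split => w /=; first by move=> Bw j jN; case: eqP => // ->.
by move=> /(_ i iN); rewrite eqxx.
Qed.

Lemma iid_atomless i x : (i < N)%N -> pr P [set w | y w i = x] = 0.
Proof.
by move=> iN; case: (iid_y) => _ _ _ _ q0; rewrite -(q0 x); exact: (iid_marginal iN (measurable_set1 x)).
Qed.

(** Permuting the coordinates of a rectangle permutes the factors of the product and leaves it
    unchanged; rectangles determine the law. *)
Lemma iid_perm (rho sigma : nat -> nat) (A : set (rseq R)) :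
  cancel rho sigma -> cancel sigma rho -> (forall i, (rho i < N)%N = (i < N)%N) ->
  measurable A ->
  pr P ((fun w => y w \o rho) @^-1` A) = pr P (y @^-1` A).
Proof.
move=> rK sK rN mA.
have sN i : (sigma i < N)%N = (i < N)%N by rewrite -rN sK.
have my := iid_measurable.
have my' : measurable_fun setT (fun w => (y w \o rho : rseq R)).
  by apply: measurable_to_rseq => i; case: iid_y => h _ _ _ _; exact: h.
have H := @pi_law _ _ _ _ _ _ (rseq R) P P (@rectangles R) (fun w => y w \o rho) y setT setT 1 1
  measurable_rseqE rectangles_setI my' my measurableT measurableT erefl.
have {}H := H _ A mA; rewrite !mul1r !setIT in H; apply: H => _ [B [mB ->]].
rewrite !mul1r !setIT iid_rectangle //.
rewrite (_ : _ @^-1` _ = y @^-1` [set z | forall i, B (sigma i) (z i)]); last first.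
  apply/seteqP; split => w /= h i; last by have := h (rho i); rewrite rK.
  by have := h (sigma i); rewrite sK.
rewrite (iid_rectangle (B := fun i => B (sigma i))) //; congr (_ * _).
  congr (nat_of_bool _)%:R; apply: asbool_equiv_eq; split => h i Ni.
    by have := h (rho i); rewrite rK; apply; rewrite leqNgt rN -leqNgt.
  by apply: h; rewrite leqNgt sN -leqNgt.
rewrite -(big_mkord xpredT (fun i => q (B (sigma i)))) -(big_mkord xpredT (fun i => q (B i))).
rewrite /index_iota subn0 -[LHS](big_map sigma xpredT (fun i => q (B i))); apply: perm_big.
apply: uniq_perm; [|exact: iota_uniq|].
  by rewrite map_inj_uniq ?iota_uniq //; exact: can_inj sK.
move=> i; rewrite mem_iota /= add0n; apply/mapP/idP => [[j]|iN].
  by rewrite mem_iota /= add0n => jN ->; rewrite sN.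
by exists (rho i); rewrite ?rK // mem_iota /= add0n rN.
Qed.

Definition restrict_seq (J : pred nat) (z : nat -> R) : nat -> R :=
  fun i => if J i then z i else 0.

Lemma measurable_restrict_seq J :
  measurable_fun setT (restrict_seq J : rseq R -> rseq R).
Proof.
apply: measurable_to_rseq => i; rewrite /restrict_seq.
by case: (J i); [exact: measurable_coord|exact: measurable_cst].
Qed.

(** Outside [J] the restricted sequence is 0, so a rectangle that excludes 0 there makes both sides
    vanish. Otherwise the two rectangles merge into one, whose product splits over [J] and its
    complement. *)
Lemma iid_indep (J : pred nat) :
  indep_fun P (fun w => restrict_seq J (y w) : rseq R)
              (fun w => restrict_seq (predC J) (y w) : rseq R).
Proof.
have mr K : measurable_fun setT (fun w => restrict_seq K (y w) : rseq R).
  by apply: measurableT_comp; [exact: measurable_restrict_seq|exact: iid_measurable].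
apply: (indep_fun_pi _ _ measurable_rseqE rectangles_setI measurable_rseqE rectangles_setI) => //.
move=> _ _ [B [mB ->]] [B' [mB' ->]].
case: iid_y => my y0 hy qT _.
have [b|nb] := pselect (forall i, ~~ J i -> B i 0); last first.
  rewrite (_ : _ @^-1` [set z | forall i, B i (z i)] = set0) ?set0I ?pr0 ?mul0r //.
  apply/seteqP; split => w //= h; apply: nb => i Ji.
  by have := h i; rewrite /restrict_seq (negbTE Ji).
have [b'|nb'] := pselect (forall i, J i -> B' i 0); last first.
  rewrite (_ : _ @^-1` [set z | forall i, B' i (z i)] = set0) ?setI0 ?pr0 ?mulr0 //.
  apply/seteqP; split => w //= h; apply: nb' => i Ji.
  by have := h i; rewrite /restrict_seq /= Ji.
rewrite (_ : _ @^-1` [set z | forall i, B i (z i)] =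
  y @^-1` [set z | forall i, (if J i then B i else setT) (z i)]); last first.
  apply/seteqP; split => w /= h i; have := h i; rewrite /restrict_seq; case: ifP => //.
  by move=> Ji _; apply: b; rewrite Ji.
rewrite (_ : _ @^-1` [set z | forall i, B' i (z i)] =
  y @^-1` [set z | forall i, (if J i then setT else B' i) (z i)]); last first.
  apply/seteqP; split => w /= h i; have := h i; rewrite /restrict_seq /=; case Ji : (J i) => //= _.
  exact: b'.
rewrite (_ : _ `&` _ = y @^-1` [set z | forall i, (if J i then B i else B' i) (z i)]); last first.
  apply/seteqP; split => w /= => [[h h'] i|h].
    by have := h i; have := h' i; case: ifP.
  by split=> i; have := h i; case: ifP.
have mC K (C C' : nat -> set R) : (forall i, measurable (C i)) -> (forall i, measurable (C' i)) ->
    forall i, measurable ((fun i => if K i then C i else C' i) i).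
  by move=> mC mC' i /=; case: (K i).
rewrite (iid_rectangle (mC J _ _ mB mB')) (iid_rectangle (mC J _ _ mB (fun=> measurableT))).
rewrite (iid_rectangle (mC J _ _ (fun=> measurableT) mB')).
rewrite mulrACA -natrM mulnb -asbool_and -big_split /=; congr (_ * _).
  congr (nat_of_bool _)%:R; apply: asbool_equiv_eq; split => [h|[h h'] i Ni].
    by split=> i Ni; have := h i Ni; case: ifP.
  by have := h i Ni; have := h' i Ni; case: ifP.
by apply: eq_bigr => i _; case: ifP; rewrite qT ?mulr1 ?mul1r.
Qed.

End IidSequences.

(** * Rearranged walks and faces *)

Section Rearrangement.
Context {R : realType}.
Implicit Types (y z : nat -> R) (g i j k N : nat).

Definition psum y j : R := \sum_(l < j) y l.

Lemma psum0 y : psum y 0 = 0.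
Proof. by rewrite /psum big_ord0. Qed.

Lemma psumS y j : psum y j.+1 = psum y j + y j.
Proof. by rewrite /psum big_ord_recr. Qed.

(* Steps of the walk on [g, g + k] start at the index g + i: this is the order in which
   the rearranged walk reads the steps, together with its inverse. *)
Definition exc_perm g i k j : nat :=
  if (j < k - i)%N then (g + i + j)%N
  else if (j < k)%N then (g + (j - (k - i)))%N
  else if (j < k + g)%N then (j - k)%N else j.

Definition exc_perm_inv g i k j : nat :=
  if (j < g)%N then (j + k)%N
  else if (j < g + i)%N then (j - g + (k - i))%N
  else if (j < g + k)%N then (j - g - i)%N else j.

Lemma exc_permK g i k : (i < k)%N -> cancel (exc_perm g i k) (exc_perm_inv g i k).
Proof. by move=> ik j; rewrite /exc_perm /exc_perm_inv; repeat case: ifP; lia. Qed.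

Lemma exc_perm_invK g i k : (i < k)%N -> cancel (exc_perm_inv g i k) (exc_perm g i k).
Proof. by move=> ik j; rewrite /exc_perm /exc_perm_inv; repeat case: ifP; lia. Qed.

Lemma exc_perm_inv_lt g i k N j : (i < k)%N -> (g + k <= N)%N ->
  (exc_perm_inv g i k j < N)%N = (j < N)%N.
Proof. by move=> ik gN; rewrite /exc_perm_inv; repeat case: ifP; lia. Qed.

(** Partial sums of the rearranged steps in closed form: the discrete counterpart of [shifted_path],
    with [T] in the place of both the path and its minorant at the vertices. *)
Definition walk_transform (T : nat -> R) g i k j : R :=
  if (j < k - i)%N then T (g + i + j)%N - T (g + i)%N
  else if (j < k)%N then T (g + k)%N - T g + T (g + (j - (k - i)))%N - T (g + i)%N
  else if (j < k + g)%N then T (g + k)%N - T g + T (j - k)%N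
  else T j.

(** Induction on [j]; the work is at the last index of each piece, where the closed form changes
    branch, with degenerate cases when [i] or [g] is 0. *)
Lemma psum_exc_perm y g i k j : (i < k)%N ->
  psum (y \o exc_perm g i k) j = walk_transform (psum y) g i k j.
Proof.
move=> ik; elim: j => [|j IH].
  rewrite psum0 /walk_transform subn_gt0 ik addn0 subrr //.
rewrite psumS IH /= /walk_transform /exc_perm.
case: (ltnP j (k - i)%N) => h1.
  case: (ltnP j.+1 (k - i)%N) => h2; first by rewrite addnS psumS; ring.
  have e : (g + i + j).+1 = (g + k)%N by lia.
  case: (ltnP j.+1 k) => h3.
    have -> : (j.+1 - (k - i) = 0)%N by lia.
    rewrite addn0 -e psumS; ring.
  have i0 : i = 0%N by lia.
  subst i.
  case: (ltnP j.+1 (k + g)%N) => h4.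
    have -> : (j.+1 - k = 0)%N by lia.
    by rewrite psum0 -e psumS addn0; ring.
  have g0 : g = 0%N by lia.
  by subst g; rewrite !addn0 !add0n psumS psum0; ring.
have -> : (j.+1 < k - i)%N = false by lia.
case: (ltnP j k) => h3.
  case: (ltnP j.+1 k) => h4.
    rewrite subSn // addnS psumS; ring.
  have e : ((g + (j - (k - i))).+1 = g + i)%N by lia.
  have -> : (j.+1 - k = 0)%N by lia.
  have S1 : psum y (g + i) = psum y (g + (j - (k - i)))%N + y (g + (j - (k - i)))%N.
    by rewrite -e psumS.
  rewrite S1 psum0; case: (ltnP j.+1 (k + g)%N) => h5; first by ring.
  have g0 : g = 0%N by lia.
  have -> : j.+1 = (g + k)%N by lia.
  by rewrite [in psum y g]g0 psum0; ring.
have -> : (j.+1 < k)%N = false by lia.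
case: (ltnP j (k + g)%N) => h4.
  have e : (j.+1 - k = (j - k).+1)%N by lia.
  case: (ltnP j.+1 (k + g)%N) => h5; first by rewrite e psumS; ring.
  have S1 : psum y g = psum y (j - k)%N + y (j - k)%N.
    by rewrite -psumS; congr psum; lia.
  have -> : j.+1 = (g + k)%N by lia.
  by rewrite S1; ring.
have -> : (j.+1 < k + g)%N = false by lia.
by rewrite psumS.
Qed.

(** Slopes are compared after multiplication by [k], which avoids division. The strict inequality at
    every other index, inside and outside the interval, is what makes faces unique. *)
Definition face N (Z : nat -> R) g k := [/\ (0 < k)%N, (g + k <= N)%N &
  forall j, (j <= N)%N -> j != g -> j != (g + k)%N ->
    (Z (g + k)%N - Z g) * (j%:R - g%:R) < (Z j - Z g) * k%:R].

(** The walk at [g'] lies strictly above the chord of the first face. But the line of the second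
    chord is strictly below the walk at [g] and not above it at [g + k], so at [g'], between these
    two, it lies below the first chord, although it meets the walk there. *)
Lemma face_lt N Z g k g' k' u : face N Z g k -> face N Z g' k' ->
  (g < g' <= u)%N -> (u < g + k)%N -> (u < g' + k')%N -> False.
Proof.
move=> [k0 gN h] [k0' gN' h'] /andP[gg' gu] ud ud'.
have k0R : 0 < k%:R :> R by rewrite ltr0n.
have k0R' : 0 < k'%:R :> R by rewrite ltr0n.
have h1 : (Z (g + k)%N - Z g) * (g'%:R - g%:R) < (Z g' - Z g) * k%:R by apply: h; lia.
have h2 : (Z (g' + k')%N - Z g') * (g%:R - g'%:R) < (Z g - Z g') * k'%:R by apply: h'; lia.
have h3 : (Z (g' + k')%N - Z g') * ((g + k)%:R - g'%:R) <= (Z (g + k)%N - Z g') * k'%:R.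
  have [->|n2] := eqVneq (g + k)%N (g' + k')%N; first by rewrite natrD; lra.
  by apply/ltW/h'; lia.
have gg'R : 0 < g'%:R - g%:R :> R by rewrite subr_gt0 ltr_nat.
have dgR : 0 < (g + k)%:R - g'%:R :> R by rewrite subr_gt0 ltr_nat; lia.
rewrite natrD in h3 dgR.
have := ltr_pM2l dgR; move=> /(_ _ _) e2.
(* Weights proportional to the barycentric coordinates of [g'] between [g] and [g + k] make the
   three inequalities add up. *)
have {}h2 : (k%:R + g%:R - g'%:R) * ((Z (g' + k')%N - Z g') * (g%:R - g'%:R)) <
    (k%:R + g%:R - g'%:R) * ((Z g - Z g') * k'%:R) by rewrite ltr_pM2l //; lra.
have {}h3 : (g'%:R - g%:R) * ((Z (g' + k')%N - Z g') * (g%:R + k%:R - g'%:R)) <=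
    (g'%:R - g%:R) * ((Z (g + k)%N - Z g') * k'%:R) by rewrite ler_pM2l.
have {}h1 : k'%:R * ((Z (g + k)%N - Z g) * (g'%:R - g%:R)) < k'%:R * ((Z g' - Z g) * k%:R).
  by rewrite ltr_pM2l.
lra.
Qed.

Lemma face_eq N Z g k k' : face N Z g k -> face N Z g k' -> (k < k')%N -> False.
Proof.
move=> [k0 gN h] [k0' gN' h'] kk'.
have h1 : (Z (g + k)%N - Z g) * ((g + k')%:R - g%:R) < (Z (g + k')%N - Z g) * k%:R by apply: h; lia.
have h2 : (Z (g + k')%N - Z g) * ((g + k)%:R - g%:R) < (Z (g + k)%N - Z g) * k'%:R by apply: h'; lia.
by rewrite !natrD in h1 h2; lra.
Qed.

Lemma face_unique N Z g k g' k' u : face N Z g k -> face N Z g' k' ->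
  (g <= u < g + k)%N -> (g' <= u < g' + k')%N -> g = g' /\ k = k'.
Proof.
move=> f f' /andP[gu ud] /andP[gu' ud'].
have [gg'|gg'|e] := ltngtP g g'.
- by exfalso; apply: (face_lt f f' _ ud ud'); rewrite gg'.
- by exfalso; apply: (face_lt f' f _ ud' ud); rewrite gg'.
- subst g'; split => //.
  by have [kk'|kk'|//] := ltngtP k k'; exfalso; [exact: face_eq f f' kk'|exact: face_eq f' f kk'].
Qed.

(* A cyclic shift of a walk of length k is a strict excursion above its chord exactly when
   it starts at the argmin of [tilt]; a walk from time k on stays above a line of slope
   T k / k exactly at the argmin of [tilt_tail]. *)
Definition tilt_tail (T : nat -> R) k j : R := k%:R * (T (k + j)%N - T k) - j%:R * T k.
Definition tilt (T : nat -> R) k b : R := k%:R * T b - b%:R * T k.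

(** The slope of the chord is [T k / k], so it can be read from [T] alone. Points of [Z] outside the
    face are points of [T] from time [k] on, and those inside are cyclically shifted, both vertices
    being found at [k - i]. As 0 and [k] have the same tilt, [b] starts from 1. *)
Lemma face_walk_transform N Z g i k : Z 0 = 0 -> (i < k)%N -> (g + k <= N)%N ->
  let T := walk_transform Z g i k in
  face N Z g k <->
  (forall j, (j <= N - k)%N -> j != g -> tilt_tail T k g < tilt_tail T k j) /\
  (forall b, (0 < b <= k)%N -> b != (k - i)%N -> tilt T k (k - i) < tilt T k b).
Proof.
move=> Z0 ik gN T.
have Tk : T k = Z (g + k)%N - Z g.
  rewrite /T /walk_transform (_ : (k < k - i)%N = false) ?ltnn; last by lia.
  case: ltnP => h; first by rewrite subnn Z0 addr0.
  have -> : g = 0%N by lia.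
  by rewrite Z0 subr0 add0n.
have W1 j : (j < g)%N -> T (k + j)%N = T k + Z j.
  move=> jg; rewrite {1}/T /walk_transform; do 2 (case: ifP; first by lia).
  move=> _ _; case: ifP; last by lia.
  by move=> _; rewrite Tk; congr (_ + Z _); lia.
have W2 j : (g <= j)%N -> T (k + j)%N = Z (k + j)%N.
  by move=> jg; rewrite /T /walk_transform; repeat (case: ifP; first by lia).
have V1 b : (b < k - i)%N -> T b = Z (g + i + b)%N - Z (g + i)%N.
  by move=> bk; rewrite /T /walk_transform bk.
have V2 b : (k - i <= b <= k)%N -> T b = T k + Z (g + (b - (k - i)))%N - Z (g + i)%N.
  move=> /andP[kb bk]; have [->|nbk] := eqVneq b k.
    have -> : (k - (k - i) = i)%N by lia.
    by rewrite addrK.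
  rewrite {1}/T /walk_transform; case: ifP; first by lia.
  by move=> _; case: ifP; [rewrite Tk|lia].
have eW1 j : (j < g)%N -> tilt_tail T k j - tilt_tail T k g =
    (Z j - Z g) * k%:R - (Z (g + k)%N - Z g) * (j%:R - g%:R).
  by move=> jg; rewrite /tilt_tail W1 // (W2 g) // Tk (addnC k g); ring.
have eW2 j : (g <= j)%N -> tilt_tail T k j - tilt_tail T k g =
    (Z (k + j)%N - Z g) * k%:R - (Z (g + k)%N - Z g) * ((k + j)%:R - g%:R).
  by move=> jg; rewrite /tilt_tail W2 // (W2 g) // Tk (addnC k g) natrD; ring.
have eV1 b : (b < k - i)%N -> tilt T k b - tilt T k (k - i) =
    (Z (g + i + b)%N - Z g) * k%:R - (Z (g + k)%N - Z g) * ((g + i + b)%:R - g%:R).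
  move=> bk; rewrite /tilt V1 // (V2 (k - i)%N); last by lia.
  by rewrite subnn addn0 Tk !natrD natrB 1?ltnW //; ring.
have eV2 b : (k - i <= b <= k)%N -> tilt T k b - tilt T k (k - i) =
    (Z (g + (b - (k - i)))%N - Z g) * k%:R -
    (Z (g + k)%N - Z g) * ((g + (b - (k - i)))%:R - g%:R).
  move=> bk; rewrite /tilt V2 // (V2 (k - i)%N); last by lia.
  have e1 : (k - i)%:R = k%:R - i%:R :> R by rewrite natrB // ltnW.
  have e2 : (b - (k - i))%:R = b%:R - (k%:R - i%:R) :> R by rewrite natrB ?e1 //; case/andP: bk.
  by rewrite subnn addn0 Tk !natrD e1 e2; ring.
split.
  move=> [k0 _ h]; split => [j jN jg|b bk bki]; rewrite -subr_gt0.
    have [jg'|jg'] := ltnP j g.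
      by rewrite eW1 // subr_gt0; apply: h; lia.
    by rewrite eW2 // subr_gt0; apply: h; lia.
  have [b1|b1] := ltnP b (k - i).
    by rewrite eV1 // subr_gt0; apply: h; lia.
  by rewrite eV2 ?subr_gt0; [apply: h; lia|lia].
move=> [h1 h2]; split => //; first by lia.
move=> j jN jg jd; rewrite -subr_gt0.
have [jg'|jg'] := ltnP j g.
  by rewrite -eW1 // subr_gt0; apply: h1; lia.
have [jd'|jd'] := ltnP (g + k) j.
  have e : j = (k + (j - k))%N by lia.
  by rewrite {1 2}e -eW2 ?subr_gt0; [apply: h1; lia|lia].
have [j1|j1] := ltnP (g + i) j.
  have e : j = (g + i + (j - g - i))%N by lia.
  by rewrite {1 2}e -eV1 ?subr_gt0; [apply: h2; lia|lia].
have e : j = (g + ((j - g + (k - i)) - (k - i)))%N by lia.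
by rewrite {1 2}e -eV2 ?subr_gt0; [apply: h2; lia|lia].
Qed.

End Rearrangement.

(** * Finite partitions up to null sets *)

Section FiniteAdditivity.
Context {R : realType} {d : measure_display} {Omega : measurableType d}.
Variable P : probability Omega R.

Lemma pr_ae_eq (A B : set Omega) : measurable A -> measurable B ->
  {ae P, forall w, A w <-> B w} -> pr P A = pr P B.
Proof.
move=> mA mB h.
have aux (C D : set Omega) : measurable C -> measurable D ->
    {ae P, forall w, C w -> D w} -> pr P C <= pr P D.
  move=> mC mD CD.
  have mCD : measurable (C `\` D) by exact: measurableD.
  have n0 : pr P (C `\` D) = 0.
    by apply: pr_negligible => //; apply: negligibleS CD => w [Cw Dw] /= /(_ Cw).
  rewrite -[pr P D]addr0 -n0.
  apply: le_trans (prU_le P mD mCD); apply: pr_le => //; first exact: measurableU.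
  by move=> w Cw; have [|] := pselect (D w); [left|right].
apply/eqP; rewrite eq_le; apply/andP; split; apply: aux => //;
  by apply: filterS h => w [].
Qed.

Lemma pr_seq_additive (I : eqType) (s : seq I) (E : I -> set Omega) : uniq s ->
  (forall i, measurable (E i)) -> (forall i j w, E i w -> E j w -> i = j) ->
  measurable [set w | exists2 i, i \in s & E i w] /\
  pr P [set w | exists2 i, i \in s & E i w] = \sum_(i <- s) pr P (E i).
Proof.
move=> us mE dE; elim: s us => [_|a s IH /= /andP[as_ us]].
  rewrite big_nil (_ : [set w | _] = set0) ?pr0; first by split => //; exact: measurable0.
  by apply/seteqP; split => w //= [].
have [mU eU] := IH us.
have e : [set w | exists2 i, i \in a :: s & E i w] = E a `|` [set w | exists2 i, i \in s & E i w].
  apply/seteqP; split => w /=.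
    by move=> [i]; rewrite inE => /orP[/eqP -> Ea|si Ei]; [left|right; exists i].
  by case=> [Ea|[i si Ei]]; [exists a; rewrite // inE eqxx|exists i; rewrite // inE si orbT].
rewrite e big_cons; split; first exact: measurableU.
rewrite prU // ?eU //; apply/seteqP; split => w //= -[Ea [i si Ei]].
by have ai := dE _ _ _ Ea Ei; rewrite -ai in si; rewrite si in as_.
Qed.

Lemma pr_partition (I : finType) (E : I -> set Omega) (A : set Omega) :
  (forall i, measurable (E i)) -> measurable A ->
  (forall i j w, E i w -> E j w -> i = j) ->
  {ae P, forall w, A w <-> exists i, E i w} ->
  \sum_i pr P (E i) = pr P A.
Proof.
move=> mE mA dE AE.
have [mU eU] := pr_seq_additive (index_enum_uniq I) mE dE.
rewrite -eU; apply: pr_ae_eq => //; apply: filterS AE => w Aw /=; rewrite Aw.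
by split=> [[i _ Ei]|[i Ei]]; exists i => //; exact: mem_index_enum.
Qed.

End FiniteAdditivity.

(** * Absence of ties *)

Section NoTies.
Context {R : realType} {d : measure_display} {Omega : measurableType d}.
Variables (P : probability Omega R) (N : nat) (y : Omega -> rseq R) (q : set R -> R).
Hypothesis iid_y : iid_seq P N y q.

Lemma measurable_psum j : measurable_fun setT (fun z : rseq R => psum z j).
Proof. by apply: measurable_sum => i; exact: measurable_coord. Qed.

(** Given all other steps, the functional vanishes for a single value of step [j], which is
    independent of them and has no atoms. *)
Lemma linear_nonzero_ae (phi : (nat -> R) -> R) j c :
  measurable_fun setT (phi : rseq R -> R) -> c != 0 -> (j < N)%N ->
  (forall z, phi z = c * z j + phi (restrict_seq (predC1 j) z)) ->
  {ae P, forall w, phi (y w) <> 0}.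
Proof.
move=> mphi c0 jN hphi; case: (iid_y) => my _ _ _ _.
pose f w := restrict_seq (predC1 j) (y w) : rseq R.
pose D w := y w j.
have mf : measurable_fun setT f.
  by apply: measurableT_comp; [exact: measurable_restrict_seq|exact: (iid_measurable iid_y)].
have fD : indep_fun P f D.
  have := indep_fun_comp (@measurable_id _ _ setT) (measurable_coord j) (iid_indep iid_y (predC1 j)).
  congr (indep_fun P _ _); apply/funext => w //=.
  by rewrite /restrict_seq /= eqxx.
have D0 x : pr P (D @^-1` [set x]) = 0 by exact: (iid_atomless iid_y x jN).
pose E : set (rseq R * R) := [set p | c * p.2 + phi p.1 = 0].
have mE : measurable E.
  apply: mset_eq; last exact: measurable_cst.
  apply: measurable_funD.
    by apply: measurable_funM; [exact: measurable_cst|exact: measurable_snd].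
  by apply: (measurableT_comp mphi); exact: measurable_fst.
have Eu t x1 x2 : E (t, x1) -> E (t, x2) -> x1 = x2.
  by rewrite /E /= => e1 e2; apply: (mulfI c0); lra.
apply: negligibleS (indep_atomless_null mf (my j) fD D0 mE Eu) => w /= /contrapT e.
by rewrite /E /= -hphi.
Qed.

Lemma psum_restrict (z : nat -> R) j l :
  psum z l = psum (restrict_seq (predC1 j) z) l + (j < l)%N%:R * z j.
Proof.
elim: l => [|l IH]; first by rewrite !psum0 ltn0 mul0r addr0.
rewrite !psumS IH /restrict_seq /= ltnS.
have [->|lj] := eqVneq l j; first by rewrite leqnn ltnn /=; ring.
by rewrite [(j <= l)%N]leq_eqVlt [j == l]eq_sym (negbTE lj) /=; ring.
Qed.

Lemma tilt_tail_inj_ae : {ae P, forall w, forall k a b, (0 < k)%N -> (a < b)%N ->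
  (k + b <= N)%N -> tilt_tail (psum (y w)) k a <> tilt_tail (psum (y w)) k b}.
Proof.
apply: ae_foralln => k; apply: ae_foralln => a; apply: ae_foralln => b.
have [k0|] := ltnP 0 k; last by move=> _; apply: aeW.
have [ab|] := ltnP a b; last by move=> _; apply: aeW.
have [kN|] := leqP (k + b) N; last by move=> _; apply: aeW.
pose phi (z : nat -> R) := tilt_tail (psum z) k b - tilt_tail (psum z) k a.
have k0R : k%:R != 0 :> R by rewrite pnatr_eq0 -lt0n.
(* Step [k + a] enters [psum z (k + b)] but neither [psum z (k + a)] nor [psum z k], so its
   coefficient is [k]. *)
have := @linear_nonzero_ae phi (k + a) k%:R _ k0R.
have -> : (k + a < N)%N by lia.
move=> H; apply: filterS (H _ isT _) => [w h _ _ _ e| |z].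
- by apply: h; rewrite /phi e subrr.
- have mp := measurable_psum.
  have mt l : measurable_fun setT (fun z : rseq R => tilt_tail (psum z) k l).
    apply: measurable_funB; apply: measurable_funM; try exact: measurable_cst; try exact: mp.
    by apply: measurable_funB; exact: mp.
  by apply: measurable_funB; exact: mt.
- rewrite /phi /tilt_tail !(psum_restrict z (k + a)).
  by rewrite ltn_add2l ab ltnn (ltnNge _ k) leq_addr /=; ring.
Qed.

Lemma tilt_inj_ae : {ae P, forall w, forall k a b, (0 < a)%N -> (a < b)%N ->
  (b <= k)%N -> (k <= N)%N -> tilt (psum (y w)) k a <> tilt (psum (y w)) k b}.
Proof.
apply: ae_foralln => k; apply: ae_foralln => a; apply: ae_foralln => b.
have [a0|] := ltnP 0 a; last by move=> _; apply: aeW.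
have [ab|] := ltnP a b; last by move=> _; apply: aeW.
have [bk|] := leqP b k; last by move=> _; apply: aeW.
have [kN|] := leqP k N; last by move=> _; apply: aeW.
pose phi (z : nat -> R) := tilt (psum z) k b - tilt (psum z) k a.
(* Coefficient of step [a], which enters [psum z b] and [psum z k] but not [psum z a]; it is nonzero
   because [a] is positive and [b] is at most [k]. *)
have c0 : k%:R - (b%:R - a%:R) != 0 :> R.
  by rewrite -natrB ?(ltnW ab) // -natrB ?pnatr_eq0; lia.
have := @linear_nonzero_ae phi a _ _ c0.
have -> : (a < N)%N by lia.
move=> H; apply: filterS (H _ isT _) => [w h _ _ _ _ e| |z].
- by apply: h; rewrite /phi e subrr.
- have mp := measurable_psum.
  have mt l : measurable_fun setT (fun z : rseq R => tilt (psum z) k l).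
    by apply: measurable_funB; apply: measurable_funM; try exact: measurable_cst; exact: mp.
  by apply: measurable_funB; exact: mt.
- rewrite /phi /tilt !(psum_restrict z a) ab ltnn.
  have -> : (a < k)%N by lia.
  by rewrite /=; ring.
Qed.


Lemma measurable_face g k : measurable [set z : rseq R | face N (psum z) g k].
Proof.
have mp := measurable_psum.
rewrite (_ : [set z : rseq R | _] = [set z | ((0 < k)%N /\ (g + k <= N)%N) /\
  forall j, (j <= N)%N -> j != g -> j != (g + k)%N ->
    (psum z (g + k) - psum z g) * (j%:R - g%:R) < (psum z j - psum z g) * k%:R]); last first.
  by apply/seteqP; split => z /= [] => [? ? ?|[? ?] ?].
apply: mset_and; first exact: mset_cst.
apply: mset_all => j; do 3 (apply: mset_imp; first exact: mset_cst).
by apply: mset_lt; apply: measurable_funM; try exact: measurable_cst; apply: measurable_funB.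
Qed.

Lemma measurable_comp_seq (s : nat -> nat) (A : set (rseq R)) : measurable A ->
  measurable [set z : rseq R | A (z \o s)].
Proof.
move=> mA; rewrite -[X in measurable X]setTI; apply: (_ : measurable_fun setT (fun z : rseq R => z \o s : rseq R)) => //.
by apply: measurable_to_rseq => i; exact: measurable_coord.
Qed.

End NoTies.

Lemma nat_argmin {R : realDomainType} (f : nat -> R) n :
  exists2 g, (g <= n)%N & forall j, (j <= n)%N -> f g <= f j.
Proof.
elim: n => [|n [g gn hg]].
  by exists 0%N => // j; rewrite leqn0 => /eqP ->.
have [h|h] := leP (f g) (f n.+1).
  exists g; first by lia.
  by move=> j; rewrite leq_eqVlt => /orP[/eqP ->//|]; rewrite ltnS; exact: hg.
exists n.+1 => // j; rewrite leq_eqVlt => /orP[/eqP ->//|]; rewrite ltnS => jn.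
exact: le_trans (ltW h) (hg _ jn).
Qed.

(** * Summing over the positions of a face *)

Section DiscreteLaw.
Context {R : realType} {d : measure_display} {Omega : measurableType d}.
Variables (P : probability Omega R) (N : nat) (y : Omega -> rseq R) (q : set R -> R).
Hypothesis iid_y : iid_seq P N y q.

Let my : measurable_fun setT y := iid_measurable iid_y.

Lemma comp_exc_perm_inv (z : nat -> R) g i k : (i < k)%N ->
  walk_transform (psum (z \o exc_perm_inv g i k)) g i k = psum z.
Proof.
move=> ik; apply/funext => j; rewrite -psum_exc_perm //; congr psum.
by apply/funext => l /=; rewrite exc_permK.
Qed.

Lemma sum_face k (A : set (rseq R)) : (0 < k <= N)%N -> measurable A ->
  \sum_(p : 'I_(N - k).+1 * 'I_k)
     pr P [set w | face N (psum (y w)) p.1 k /\ A (y w \o exc_perm p.1 p.2 k)] =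
  pr P (y @^-1` A).
Proof.
move=> /andP[k0 kN] mA.
pose E (p : 'I_(N - k).+1 * 'I_k) :=
  [set w | face N (psum (y w \o exc_perm_inv p.1 p.2 k)) p.1 k /\ A (y w)].
have hp (p : 'I_(N - k).+1 * 'I_k) : (p.2 < k)%N /\ (p.1 + k <= N)%N.
  by case: p => -[a ha] [b hb] /=; split => //; lia.
have mF g : measurable [set z : rseq R | face N (psum z) g k] by exact: measurable_face.
transitivity (\sum_p pr P (E p)).
  apply: eq_bigr => p _; have [p2 p1] := hp p.
  pose B := [set z : rseq R | face N (psum z) p.1 k /\ A (z \o exc_perm p.1 p.2 k)].
  have mB : measurable B by apply: mset_and => //; exact: measurable_comp_seq.
  (* The inverse rearrangement preserves the law and cancels the rearrangement inside [A], so that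
     this condition no longer depends on [p]. *)
  have h := iid_perm iid_y (exc_perm_invK p.1 p2) (exc_permK p.1 p2) 
    (fun j => exc_perm_inv_lt j p2 p1) mB.
  rewrite -[LHS]/(pr P (y @^-1` B)) -h; congr pr; apply/seteqP; split => w;
  rewrite /E /B /= (_ : (_ \o _) \o _ = y w) //; by apply/funext => l /=; rewrite exc_permK.
apply: pr_partition.
- move=> p; pose B : set (rseq R) :=
    [set z : rseq R | face N (psum (z \o exc_perm_inv p.1 p.2 k)) p.1 k /\ A z].
  suff mB : measurable B by exact: (measurable_preimage my mB).
  by apply: mset_and => //; exact: (measurable_comp_seq (exc_perm_inv p.1 p.2 k) (mF p.1)).
- exact: measurable_preimage.
(* Disjointness: a strict minimiser is unique, of [tilt_tail] for [g] and of [tilt] for [k - i]. *)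
- move=> p p' w [f _] [f' _]; have [p2 p1] := hp p; have [p2' p1'] := hp p'.
  move: f f' => /(face_walk_transform (psum0 _) p2 p1); rewrite comp_exc_perm_inv // => -[h1 h2].
  move=> /(face_walk_transform (psum0 _) p2' p1'); rewrite comp_exc_perm_inv // => -[h1' h2'].
  have e1 : p.1 = p'.1 :> nat.
    apply/eqP; apply: contraT => ne.
    have := h1 p'.1 _ _; have := h1' p.1 _ _ => /(_ _ ne).
    rewrite eq_sym in ne => a /(_ _ ne) b.
    have l1 : (p.1 <= N - k)%N by rewrite leq_subRL // addnC.
    have l1' : (p'.1 <= N - k)%N by rewrite leq_subRL // addnC.
    by have := lt_trans (a l1) (b l1'); rewrite ltxx.
  have e2 : (k - p.2 = k - p'.2)%N.
    apply/eqP; apply: contraT => ne.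
    have := h2 (k - p'.2)%N _ _; have := h2' (k - p.2)%N _ _ => /(_ _ ne).
    rewrite eq_sym in ne => a /(_ _ ne) b.
    have l2 : (0 < k - p.2 <= k)%N by rewrite subn_gt0 p2 leq_subr.
    have l2' : (0 < k - p'.2 <= k)%N by rewrite subn_gt0 p2' leq_subr.
    by have := lt_trans (a l2) (b l2'); rewrite ltxx.
  case: p p' p2 p2' e1 e2 {p1 p1' h1 h2 h1' h2'} => [a b] [a' b'] /= p2 p2' e1 e2.
  by congr pair; apply/val_inj => //=; lia.
- apply: filterS2 (tilt_tail_inj_ae iid_y) (tilt_inj_ae iid_y) => w hW hV.
  split => [Aw|[p [] //]].
  have [g gN hg] := nat_argmin (tilt_tail (psum (y w)) k) (N - k).
  (* The minimum of [tilt] is sought over 1, ..., [k], hence the shift by one; absence of ties makes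
     it strict, as for [tilt_tail]. *)
  have [c ck hc] := nat_argmin (fun b => tilt (psum (y w)) k b.+1) k.-1.
  have ik : (k - c.+1 < k)%N by lia.
  have gk : (g < (N - k).+1)%N by lia.
  exists (Ordinal gk, Ordinal ik); split => //=.
  apply/(face_walk_transform (psum0 _) ik _); first by lia.
  rewrite comp_exc_perm_inv //; split => [j jN jg|b bk bc].
    rewrite lt_neqAle hg // andbT; apply/eqP.
    have [jg'|jg'|//] := ltngtP j g; last by move=> e; rewrite e eqxx in jg.
      by move=> /esym; apply: hW => //; lia.
    by apply: hW => //; lia.
  have ec : (k - (k - c.+1) = c.+1)%N by lia.
  rewrite ec in bc *.
  have e : b = b.-1.+1 by lia.
  rewrite lt_neqAle [in X in _ && X]e hc ?andbT; last by lia.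
  apply/eqP; have [jg'|jg'|e'] := ltngtP b c.+1; last by rewrite e' eqxx in bc.
    by move=> /esym; apply: hV => //; lia.
  by apply: hV => //; lia.
Qed.

End DiscreteLaw.

(** * The face straddling a uniform index *)

Section UniformIndex.
Context {R : realType} {d : measure_display} {Omega : measurableType d}.
Variables (P : probability Omega R) (N : nat) (y : Omega -> rseq R) (q : set R -> R).
Hypothesis iid_y : iid_seq P N y q.
Variable u : Omega -> nat.

Definition face_at (z : nat -> R) (v g i k : nat) : Prop :=
  [/\ v = (g + i)%N, (i < k)%N & face N (psum z) g k].

Lemma face_at_unique z v g i k g' i' k' :
  face_at z v g i k -> face_at z v g' i' k' -> [/\ g = g', i = i' & k = k'].
Proof.
move=> [e ik f] [e' ik' f'].
have [||eg ek] := face_unique (u := v) f f'; [lia|lia|].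
by split => //; lia.
Qed.

Hypothesis N0 : (0 < N)%N.
Hypothesis mu : forall j, measurable [set w | u w = j].
Hypothesis uN : forall w, (u w < N)%N.
Hypothesis hu : forall j A, (j < N)%N -> measurable A ->
  pr P ([set w | u w = j] `&` y @^-1` A) = pr P (y @^-1` A) / N%:R.

Let my : measurable_fun setT y := iid_measurable iid_y.

Let mface g k : measurable [set z : rseq R | face N (psum z) g k].
Proof. exact: measurable_face. Qed.

Let mE (Q : nat -> nat -> nat -> set (rseq R)) g i k :
  (forall g i k, measurable (Q g i k)) ->
  measurable [set w | face_at (y w) (u w) g i k /\ Q g i k (y w \o exc_perm g i k)].
Proof.
move=> mQ; apply: mset_and; last first.
  by apply: (measurable_preimage my (A := [set z : rseq R | Q g i k (z \o exc_perm g i k)])); exact: measurable_comp_seq.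
rewrite (_ : [set w | _] = [set w | u w = (g + i)%N /\ ((i < k)%N /\ face N (psum (y w)) g k)]).
  apply: mset_and => //; apply: mset_and; first exact: mset_cst.
  exact: (measurable_preimage my (mface g k)).
by apply/seteqP; split => w /= [] => [? ? ?|? [? ?]].
Qed.

(** Given the steps, the index equals [g + i] with probability [1 / N], and for fixed [k] distinct
    pairs of [g] and [i] give disjoint events. *)
Lemma pr_face_at k (Q : nat -> set (rseq R)) : (0 < k <= N)%N ->
  (forall i, measurable (Q i)) ->
  pr P [set w | exists g i, face_at (y w) (u w) g i k /\ Q i (y w \o exc_perm g i k)] =
  (\sum_(p : 'I_(N - k).+1 * 'I_k)
     pr P [set w | face N (psum (y w)) p.1 k /\ Q p.2 (y w \o exc_perm p.1 p.2 k)]) / N%:R.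
Proof.
move=> /andP[k0 kN] mQ; rewrite mulr_suml.
pose E (p : 'I_(N - k).+1 * 'I_k) :=
  [set w | face_at (y w) (u w) p.1 p.2 k /\ Q p.2 (y w \o exc_perm p.1 p.2 k)].
transitivity (\sum_p pr P (E p)).
  symmetry; apply: pr_partition.
  - by move=> p; exact: (mE p.1 p.2 k (fun _ i _ => mQ i)).
  - by apply: mset_ex => g; apply: mset_ex => i; exact: (mE g i k (fun _ i _ => mQ i)).
  - move=> [[a ha] [b hb]] [[a' ha'] [b' hb']] w /= [f _] [f' _].
    have /= [e1 e2 _] := face_at_unique f f'.
    by congr pair; exact/val_inj.
  - apply: aeW => w; split => [[g [i [f Qw]]]|[p [f Qw]]]; last by exists p.1, p.2.
    have [_ ik [_ gN _]] := f.
    have gk : (g < (N - k).+1)%N by lia.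
    by exists (Ordinal gk, Ordinal ik).
apply: eq_bigr => -[[a ha] [b hb]] _; rewrite /E /=.
pose B : set (rseq R) := [set z : rseq R | face N (psum z) a k /\ Q b (z \o exc_perm a b k)].
have mB : measurable B by apply: mset_and => //; exact: measurable_comp_seq.
have ab : (a + b < N)%N by lia.
rewrite -[X in _ = X / _]/(pr P (y @^-1` B)) -(hu ab mB); congr pr.
by apply/seteqP; split => w /= => [[[e bk f] h]|[e [f h]]].
Qed.

Lemma pr_face_at_law k (A : set (rseq R)) : (0 < k <= N)%N -> measurable A ->
  pr P [set w | exists g i, face_at (y w) (u w) g i k /\ A (y w \o exc_perm g i k)] =
  pr P (y @^-1` A) / N%:R.
Proof. by move=> kN mA; rewrite (pr_face_at kN (fun=> mA)) (sum_face iid_y). Qed.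

Lemma measurable_face_event (Q : nat -> nat -> nat -> set (rseq R)) :
  (forall g i k, measurable (Q g i k)) ->
  measurable [set w | exists g i k, face_at (y w) (u w) g i k /\ Q g i k (y w \o exc_perm g i k)].
Proof. by move=> mQ; do 3 apply: mset_ex => ?; exact: mE. Qed.

Lemma pr_face_sum (Q : nat -> nat -> set (rseq R)) : (forall i k, measurable (Q i k)) ->
  pr P [set w | exists g i k, face_at (y w) (u w) g i k /\ Q i k (y w \o exc_perm g i k)] =
  \sum_(k < N) pr P [set w | exists g i, face_at (y w) (u w) g i k.+1 /\
                        Q i k.+1 (y w \o exc_perm g i k.+1)].
Proof.
move=> mQ; symmetry; apply: pr_partition.
- by move=> k; do 2 apply: mset_ex => ?; exact: (mE _ _ _ (fun _ => mQ)).
- exact: (measurable_face_event (fun _ => mQ)).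
- move=> a b w [g [i [f _]]] [g' [i' [f' _]]].
  by have [_ _ [e]] := face_at_unique f f'; exact/val_inj.
- apply: aeW => w; split => [[g [i [k [f h]]]]|[k [g [i h]]]]; last by exists g, i, k.+1.
  have [_ ik [k0 gN _]] := f.
  have kN : (k.-1 < N)%N by lia.
  by exists (Ordinal kN), g, i; rewrite /= prednK.
Qed.

(** Both sides are sums over the length: each [k] contributes the probability of [Q k] divided by
    [N], on the right because [u + 1] is uniform and independent of the steps. *)
Lemma discrete_law (Q : nat -> set (rseq R)) : (forall k, measurable (Q k)) ->
  pr P [set w | exists g i k, face_at (y w) (u w) g i k /\ Q k (y w \o exc_perm g i k)] =
  pr P [set w | Q (u w).+1 (y w)].
Proof.
move=> mQ; rewrite (pr_face_sum (fun _ => mQ)).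
have mQy k : measurable [set w | u w = k /\ Q k.+1 (y w)].
  by apply: mset_and => //; exact: (measurable_preimage my (mQ k.+1)).
transitivity (\sum_(k < N) pr P [set w | u w = k /\ Q k.+1 (y w)]).
  apply: eq_bigr => k _; rewrite pr_face_at_law //; last by rewrite ltn_ord.
  by symmetry; exact: (hu (ltn_ord k) (mQ k.+1)).
apply: pr_partition => //.
- rewrite (_ : [set w | _] = [set w | exists k, u w = k /\ Q k.+1 (y w)]).
    exact: mset_ex.
  by apply/seteqP; split => w /= => [h|[k [<-]]//]; exists (u w).
- by move=> a b w [ea _] [eb _]; apply/val_inj; rewrite /= -ea -eb.
- apply: aeW => w; split => [h|[k [<-]]//].
  by exists (Ordinal (uN w)).
Qed.

(** Existence is read off the law: with a trivial condition the right side of [discrete_law] is 1,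
    so no lower convex hull has to be built. *)
Lemma face_at_ae : {ae P, forall w, exists g i k, face_at (y w) (u w) g i k}.
Proof.
have mF : measurable [set w | exists g i k, face_at (y w) (u w) g i k].
  have := measurable_face_event (fun _ _ _ => @measurableT _ (rseq R)).
  by congr measurable; apply/seteqP; split => w /= [g [i [k h]]]; exists g, i, k; case: h.
apply: (pr1_ae mF).
have := discrete_law (fun _ => @measurableT _ (rseq R)).
rewrite (_ : [set w | setT _] = setT) ?prT; last by apply/seteqP; split.
move=> <-; congr pr.
by apply/seteqP; split => w /= [g [i [k h]]]; exists g, i, k; case: h.
Qed.

Lemma sum_ltn_ord (k j : nat) : (\sum_(i < k) (i < j) <= j)%N.
Proof.
suff -> : (\sum_(i < k) (i < j) = minn k j)%N by rewrite geq_minr.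
by elim: k => [|k IH]; rewrite ?big_ord0 ?min0n // big_ord_recr /= IH; case: ltnP; lia.
Qed.

Lemma sum_leq_rev_ord (k j : nat) : (\sum_(i < k) (k - i <= j) <= j)%N.
Proof.
rewrite (reindex_inj rev_ord_inj) /=; apply: leq_trans (sum_ltn_ord k j).
by apply: leq_sum => i _; have := ltn_ord i; do 2 case: leqP; lia.
Qed.

(** The length of the straddling face is uniform on 1, ..., [N], which gives [K / N] for the lengths
    up to [K]. Given a longer length, the position [i] is uniform, and at most [2 j] of its more
    than [K] values are counted as close to an end. *)
Lemma pr_near_vertex (K j : nat) : (0 < K)%N ->
  pr P [set w | exists g i k, face_at (y w) (u w) g i k /\ ((i < j)%N || (k - i <= j)%N)] <=
  K%:R / N%:R + (j%:R *+ 2) / K%:R.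
Proof.
move=> K0.
pose Q i k : set (rseq R) := [set z | (i < j)%N || (k - i <= j)%N].
have mQ i k : measurable (Q i k) by exact: mset_cst.
have := pr_face_sum mQ; rewrite /Q /= => ->.
have N0R : 0 < N%:R :> R by rewrite ltr0n.
have K0R : 0 < K%:R :> R by rewrite ltr0n.
pose c k : R := (k < K)%N%:R / N%:R + (j%:R *+ 2) / K%:R / N%:R.
apply: (@le_trans _ _ (\sum_(k < N) c k)); last first.
  rewrite big_split /= -mulr_suml -natr_sum sumr_const card_ord.
  apply: lerD; first by rewrite ler_pM2r ?invr_gt0 // ler_nat sum_ltn_ord.
  by rewrite -[leLHS]mulr_natr divfK // gt_eqF.
apply: ler_sum => k _; rewrite /c.
have kN : (0 < k.+1 <= N)%N by rewrite ltn_ord.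
have [kK|Kk] := ltnP k K.
  apply: (@le_trans _ _ N%:R^-1).
    have := pr_face_at_law kN (@measurableT _ (rseq R)).
    rewrite preimage_setT prT mul1r => <-; apply: pr_le.
    - by do 2 apply: mset_ex => ?; exact: (mE _ _ _ (fun _ => mQ)).
    - by do 2 apply: mset_ex => ?; exact: (mE _ _ _ (fun _ _ _ => @measurableT _ (rseq R))).
    - by move=> w [g [i [f _]]]; exists g, i.
  by rewrite mul1r lerDl; do 2 (apply: mulr_ge0; last by rewrite invr_ge0 ltW); exact: mulrn_wge0.
rewrite mul0r add0r (pr_face_at kN (fun i => mQ i k.+1)) ler_pM2r ?invr_gt0 //.
pose p g := pr P [set w | face N (psum (y w)) g k.+1].
have p0 g : 0 <= p g by exact: pr_ge0.
(* This is [sum_face] with the trivial event: the summand does not depend on [i], so each [g] is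
   counted [k.+1] times. *)
have psum1 : (\sum_(g < (N - k.+1).+1) p g) * k.+1%:R = 1.
  transitivity (\sum_(g < (N - k.+1).+1) \sum_(i < k.+1) p g).
    by rewrite mulr_suml; apply: eq_bigr => g _; rewrite sumr_const card_ord mulr_natr.
  rewrite pair_bigA /=; have := sum_face iid_y kN (@measurableT _ (rseq R)).
  rewrite preimage_setT prT => <-; apply: eq_bigr => i _.
  by congr pr; apply/seteqP; split => w //= [].
apply: (@le_trans _ _ (\sum_(g < (N - k.+1).+1) \sum_(i < k.+1)
    p g * ((i < j)%N + (k.+1 - i <= j)%N)%:R)).
  rewrite [leRHS]pair_bigA /=; apply: ler_sum => -[[g hg] [i hi]] _ /=.
  have [bad|good] := boolP ((i < j)%N || (k.+1 - i <= j)%N); last first.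
    rewrite (_ : [set w | _] = set0) ?pr0; first by rewrite mulr_ge0.
    by apply/seteqP; split => w //= [_]; rewrite /Q /= (negbTE good).
  apply: (@le_trans _ _ (p g)).
    by rewrite /p le_eqVlt; apply/orP; left; apply/eqP; congr pr; apply/seteqP; split => w //= [].
  rewrite ler_peMr // ler1n addn_gt0.
  by case/orP: bad => ->; rewrite ?orbT.
under eq_bigr => g _ do rewrite -mulr_sumr.
rewrite -mulr_suml -natr_sum big_split /=.
have -> : \sum_(g < (N - k.+1).+1) p g = k.+1%:R^-1.
  by rewrite -[LHS](@mulfK _ k.+1%:R) ?pnatr_eq0 // psum1 mul1r.
rewrite mulrC; apply: ler_pM => //; rewrite ?invr_ge0 //.
  by rewrite mulr2n -natrD ler_nat leq_add ?sum_ltn_ord ?sum_leq_rev_ord.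
by rewrite lef_pV2 ?posrE // ler_nat; lia.
Qed.

End UniformIndex.

(** * Dyadic grids *)

Section DyadicGrid.
Context {R : realType}.

(** Capped at 1, so that every index gives a time in [0,1] and the increments from [2 ^ n] on
    vanish, as [iid_seq] asks. *)
Definition grid n i : R := (minn i (2 ^ n))%:R / (2 ^ n)%:R.

Lemma pow2_gt0 n : 0 < (2 ^ n)%:R :> R.
Proof. by rewrite ltr0n expn_gt0. Qed.

Lemma gridE n i : (i <= 2 ^ n)%N -> grid n i = i%:R / (2 ^ n)%:R.
Proof. by move=> iN; rewrite /grid (minn_idPl iN). Qed.

Lemma grid_top n i : (2 ^ n <= i)%N -> grid n i = 1.
Proof. by move=> iN; rewrite /grid (minn_idPr iN) divff // gt_eqF ?pow2_gt0. Qed.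

Lemma grid0 n : grid n 0 = 0.
Proof. by rewrite gridE // mul0r. Qed.

Lemma grid_itv n i : 0 <= grid n i <= 1.
Proof.
by rewrite /grid divr_ge0 ?ler0n //= ler_pdivrMr ?pow2_gt0 // mul1r ler_nat geq_minr.
Qed.

Lemma grid_le n i j : (i <= j)%N -> grid n i <= grid n j.
Proof.
move=> ij; rewrite /grid ler_pM2r ?invr_gt0 ?pow2_gt0 // ler_nat.
by rewrite leq_min geq_minr (leq_trans (geq_minl _ _) ij).
Qed.

Lemma gridS n i : (i < 2 ^ n)%N -> grid n i.+1 = grid n i + ((2 ^ n)%:R)^-1.
Proof. by move=> iN; rewrite (gridE iN) (gridE (ltnW iN)) -[i.+1]addn1 natrD mulrDl mul1r. Qed.

End DyadicGrid.

(** * Increments of the process and the uniform index *)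

Section LevyGrid.
Context {R : realType} {d : measure_display} {Omega : measurableType d}.
Variables (P : probability Omega R) (X : R -> Omega -> R).
Hypothesis levy : levy_process01 P X.
Hypothesis cd : CD P X.

Let mX t : 0 <= t <= 1 -> measurable_fun setT (X t).
Proof. by case: levy => h _ _ _ _; exact: h. Qed.

Definition increments n w : rseq R := fun i => X (grid n i.+1) w - X (grid n i) w.

Lemma psum_increments n w j : psum (increments n w) j = X (grid n j) w.
Proof.
case: levy => _ X0 _ _ _; elim: j => [|j IH]; first by rewrite psum0 grid0 X0.
by rewrite psumS IH /increments addrC subrK.
Qed.

Lemma iid_increments n : iid_seq P (2 ^ n) (increments n)
  (fun B => pr P [set w | B (X ((2 ^ n)%:R)^-1 w)]).
Proof.
have [_ X0 _ ind sta] := levy.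
have p0 : 0 < ((2 ^ n)%:R)^-1 :> R by rewrite invr_gt0 pow2_gt0.
have p1 : ((2 ^ n)%:R)^-1 <= 1 :> R.
  by rewrite invf_le1 ?pow2_gt0 // ler1n expn_gt0.
have mI i : measurable_fun setT (fun w => increments n w i).
  by apply: measurable_funB; apply: mX; exact: grid_itv.
split => //.
- move=> w i iN; rewrite /increments (grid_top iN) grid_top ?subrr //.
  exact: leq_trans iN (leqnSn _).
- move=> B mB.
  have e1 : [set w | forall i, (i < 2 ^ n)%N -> B i (increments n w i)] =
    \bigcap_(i in [set k | (k < 2 ^ n)%N]) [set w | B i (X (grid n i.+1) w - X (grid n i) w)].
    by apply/seteqP; split => w h i; exact: h.
  have mEi i : measurable [set w | B i (X (grid n i.+1) w - X (grid n i) w)].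
    exact: (measurable_preimage (mI i) (mB i)).
  apply: EFin_inj; rewrite -prE; last first.
    by rewrite e1; apply: bigcap_measurableType => i _; exact: mEi.
  rewrite e1 ind //; last 2 first.
    by move=> i _; exact: grid_itv.
    by move=> i _; exact: grid_le.
  rewrite -prodEFin; apply: eq_bigr => i _; rewrite prE //; congr (_%:E).
  rewrite /pr; congr fine; have := sta (grid n i) ((2 ^ n)%:R)^-1 (B i).
  rewrite gridS //; apply => //; first by case/andP: (@grid_itv R n i).
  by rewrite -gridS //; case/andP: (@grid_itv R n i.+1).
- by rewrite -(prT P); congr pr; apply/seteqP; split.
- by move=> x; rewrite /pr cd // p0.
Qed.

Variable U : Omega -> R.
Hypothesis unif : uniform01 P U.
Hypothesis indU : indep_of_process P U X.

Let mU : measurable_fun setT U.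
Proof. by case: unif. Qed.

Definition grid_path n w : rseq R := fun i => X (grid n i) w.

Lemma measurable_grid_path n : measurable_fun setT (grid_path n).
Proof. by apply: measurable_to_rseq => i; apply: mX; exact: grid_itv. Qed.

Lemma indep_grid_path n : indep_fun P U (grid_path n).
Proof.
have mR : @measurable _ R = <<s @measurable _ R >>.
  by rewrite sigma_algebra_id //; exact: sigma_algebra_measurable.
apply: (indep_fun_pi mU (@measurable_grid_path n) mR _ measurable_rseqE rectangles_setI).
  by move=> A B; exact: measurableI.
move=> A _ mA [B [mB ->]].
(* All coordinates from [2 ^ n] on are the value at time 1, so the infinitely many constraints on
   them are gathered at the index [2 ^ n]. *)
pose B' i := if (i < 2 ^ n)%N then B i else \bigcap_(j in [set j | (2 ^ n <= j)%N]) B j.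
have mB' i : measurable (B' i).
  by rewrite /B'; case: ifP => // _; exact: bigcap_measurableType.
have := indU (n := (2 ^ n).+1) (t := grid n) (fun i _ => @grid_itv R n i) mA mB'.
set E := \bigcap_(i in _) _.
have -> : E = grid_path n @^-1` [set z | forall i, B i (z i)].
  apply/seteqP; split => w /= h i.
    have [iN|iN] := ltnP i (2 ^ n).
      by have := h i; rewrite /B' iN; apply => /=; lia.
    have := h (2 ^ n)%N (ltnSn _); rewrite /B' /= ltnn => /(_ i iN).
    by rewrite /grid_path !grid_top.
  rewrite /= ltnS leq_eqVlt /B' => /orP[/eqP ->|iN]; last by rewrite iN; exact: h.
  by rewrite ltnn => j /= jN; have := h j; rewrite /grid_path !grid_top.
have mpre : measurable (grid_path n @^-1` [set z | forall i, B i (z i)]).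
  apply: (measurable_preimage (@measurable_grid_path n)).
  by apply: sub_sigma_algebra; exists B.
have mUA := measurable_preimage mU mA.
move=> /= H; apply: EFin_inj; rewrite EFinM -!prE //; last exact: measurableI.
Qed.

Lemma indep_increments_fun n : indep_fun P U (increments n).
Proof.
have mdiff : measurable_fun setT (fun z : rseq R => (fun i => z i.+1 - z i) : rseq R).
  by apply: measurable_to_rseq => i; apply: measurable_funB; exact: measurable_coord.
exact: (indep_fun_comp (@measurable_id _ _ setT) mdiff (@indep_grid_path n)).
Qed.

(** Index of the first grid point strictly to the right of [U], where right continuity makes path
    values approach the value at [U]. The reduction modulo [2 ^ n] sends the last cell to index 0,
    which keeps the index uniform on all steps. *)
Definition uindex n w : nat := ((Num.truncn ((2 ^ n)%:R * U w)).+1 %% 2 ^ n)%N.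

Lemma uindex_lt n w : (uindex n w < 2 ^ n)%N.
Proof. by rewrite ltn_mod expn_gt0. Qed.

Let truncnP n m (x : R) : 0 <= x ->
  Num.truncn ((2 ^ n)%:R * x) = m <-> m%:R / (2 ^ n)%:R <= x < m.+1%:R / (2 ^ n)%:R.
Proof.
move=> x0; rewrite ler_pdivrMr ?pow2_gt0 // ltr_pdivlMr ?pow2_gt0 // mulrC.
have y0 : 0 <= x * (2 ^ n)%:R by rewrite mulr_ge0.
split => [<-|h]; first exact: truncn_itv.
exact: truncn_def.
Qed.

Let uset n j := [set x : R | ((Num.truncn ((2 ^ n)%:R * x)).+1 %% 2 ^ n)%N = j].

Let muset n j : measurable (uset n j).
Proof.
have mt m : measurable [set x : R | Num.truncn ((2 ^ n)%:R * x) = m].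
  (* Negative reals have truncation 0. *)
  rewrite (_ : [set x | _] = [set x | (0 <= x /\ (m%:R / (2 ^ n)%:R <= x /\ x < m.+1%:R / (2 ^ n)%:R))
     \/ (x < 0 /\ m = 0%N)]); last first.
    apply/seteqP; split => x /=; have [x0|x0] := leP 0 x.
    - by move=> /(truncnP _ _ x0) /andP[]; left.
    - have -> : Num.truncn ((2 ^ n)%:R * x) = 0%N.
        by apply/truncn0Pn; rewrite -ltNge; have := pow2_gt0 (R:=R) n; nra.
      by right.
    - by case=> [[_ [h1 h2]]|[]//]; apply/truncnP => //; rewrite h1.
    - case=> [[]//|[_ ->]]; by apply/truncn0Pn; rewrite -ltNge; have := pow2_gt0 (R:=R) n; nra.
  apply: mset_or.
    by apply: mset_and; [|apply: mset_and]; first [apply: mset_le|apply: mset_lt].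
  by apply: mset_and; [apply: mset_lt|exact: mset_cst].
rewrite /uset (_ : [set x | _] = [set x | exists m, Num.truncn ((2 ^ n)%:R * x) = m /\ (m.+1 %% 2 ^ n)%N = j]).
  by apply: mset_ex => m; apply: mset_and => //; exact: mset_cst.
by apply/seteqP; split => x /= => [h|[m [<-]]//]; eexists.
Qed.

Lemma measurable_uindex n j : measurable [set w | uindex n w = j].
Proof. exact: (measurable_preimage mU (@muset n j)). Qed.

Lemma pr_uindex n j : (j < 2 ^ n)%N -> pr P [set w | uindex n w = j] = ((2 ^ n)%:R)^-1.
Proof.
move=> jN; have [_ hU] := unif.
have N0 := pow2_gt0 (R := R) n.
have [m [mN mj]] : exists m, (m < 2 ^ n)%N /\ forall m', (m' < 2 ^ n)%N -> ((m'.+1 %% 2 ^ n)%N = j <-> m' = m).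
  have N0' : (0 < 2 ^ n)%N by rewrite expn_gt0.
  have aux m' : (m' < 2 ^ n)%N -> (m'.+1 %% 2 ^ n)%N = if m' == (2 ^ n).-1 then 0%N else m'.+1.
    by move=> h; case: eqP => [->|ne]; [rewrite prednK // modnn|rewrite modn_small; lia].
  exists (if j == 0%N then (2 ^ n).-1 else j.-1); split; first by case: ifP; lia.
  by move=> m' h; rewrite aux //; do 2 case: eqP; lia.
rewrite -[X in pr P X]/(U @^-1` uset n j) /pr (hU _ (@muset n j)).
have mN1 : m.+1%:R / (2 ^ n)%:R <= 1 :> R by rewrite ler_pdivrMr // mul1r ler_nat.
have m1 : m%:R / (2 ^ n)%:R < m.+1%:R / (2 ^ n)%:R :> R.
  by rewrite ltr_pM2r ?invr_gt0 // ltr_nat.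
have eI x : 0 < x < 1 -> uset n j x <-> m%:R / (2 ^ n)%:R <= x < m.+1%:R / (2 ^ n)%:R.
  move=> /andP[x0 x1]; rewrite /uset /= mj.
    by apply: truncnP; exact: ltW.
  rewrite -(ltr_nat R); apply: (@le_lt_trans _ _ ((2 ^ n)%:R * x)).
    by have /andP[] := truncn_itv (mulr_ge0 (ltW N0) (ltW x0)).
  by rewrite gtr_pMr.
have [m0|m0] := posnP m.
  have -> : uset n j `&` `]0, 1[ = `]0, (m.+1%:R / (2 ^ n)%:R)[%classic.
    apply/seteqP; split => x /=; rewrite !in_itv /=.
      by move=> [h x01]; move: h => /(eI _ x01) /andP[_ ->]; case/andP: x01 => ->.
    move=> /andP[x0 xm]; have x01 : 0 < x < 1 by rewrite x0 (lt_le_trans xm).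
    by split => //; apply/eI => //; rewrite xm m0 mul0r ltW.
  rewrite lebesgue_measure_itv /= lte_fin; rewrite m0 mul0r in m1.
  by rewrite m0 m1 -EFinB /= subr0 mul1r.
have -> : uset n j `&` `]0, 1[ = `[(m%:R / (2 ^ n)%:R), (m.+1%:R / (2 ^ n)%:R)[%classic.
  apply/seteqP; split => x /=; rewrite !in_itv /=.
    by move=> [h x01]; move: h => /(eI _ x01).
  move=> /andP[xm xm1]; have x01 : 0 < x < 1.
    by rewrite (lt_le_trans xm1) // (lt_le_trans _ xm) // divr_gt0 // ltr0n.
  by split => //; apply/eI => //; rewrite xm.
rewrite lebesgue_measure_itv /= lte_fin m1 -EFinB /= -mulrBl -natrB // subSnn mul1r //.
Qed.

Lemma uindex_indep n j A : (j < 2 ^ n)%N -> measurable A ->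
  pr P ([set w | uindex n w = j] `&` increments n @^-1` A) =
  pr P (increments n @^-1` A) / (2 ^ n)%:R.
Proof.
move=> jN mA; rewrite mulrC -(pr_uindex jN).
exact: (@indep_increments_fun n _ _ (@muset n j) mA).
Qed.

End LevyGrid.

(** * Cadlag paths above a line *)

Section CadlagPaths.
Context {R : realType}.
Implicit Types (f h : R -> R) (p s x : R).

Lemma cadlag_right f s e : cadlag01 f -> 0 <= s < 1 -> 0 < e ->
  exists2 del, 0 < del & forall x, s <= x < s + del -> `|f x - f s| < e.
Proof.
move=> [hr _] s01 e0; have := hr s s01 => /cvgrPdist_lt /(_ e e0) [del /= del0 hdel].
exists del => // x /andP[sx xs].
have [->|ne] := eqVneq x s; first by rewrite subrr normr0.
rewrite distrC; apply: hdel => /=; last by rewrite lt_neqAle eq_sym ne.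
by rewrite ltr_norml; lra.
Qed.

Lemma cadlag_left f s e : cadlag01 f -> 0 < s <= 1 -> 0 < e ->
  exists2 del, 0 < del & forall x, s - del < x < s -> `|f x - left_lim f s| < e.
Proof.
move=> [_ hl] s01 e0; have := hl s s01 => /cvgrPdist_lt /(_ e e0) [del /= del0 hdel].
exists del => // x /andP[sx xs].
by rewrite distrC; apply: hdel => //=; rewrite ltr_norml; lra.
Qed.

(** The lower semicontinuous envelope of [h] on [0,1] is at most 0 at [p]. A cadlag path may
    approach a supporting line through its left limit alone, so equality at [p] would be too much to
    ask. *)
Definition touch h p := forall e del, 0 < e -> 0 < del ->
  exists s, [/\ 0 <= s <= 1, `|s - p| < del & h s <= e].

Lemma not_touch h p : ~ touch h p ->
  exists e del, [/\ 0 < e, 0 < del & forall s, 0 <= s <= 1 -> `|s - p| < del -> e < h s].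
Proof.
move=> nt; apply: contrapT => H; apply: nt => e del e0 del0.
apply: contrapT => ns; apply: H; exists e, del; split => // s s01 sp.
by rewrite ltNge; apply/negP => hs; apply: ns; exists s.
Qed.

(** Compactness in the form of a supremum argument: local bounds carry the estimate past the
    supremum of the points up to which some positive bound holds. *)
Lemma no_touch_lower_bound h a b :
  (forall p, a <= p <= b -> 0 <= p <= 1 -> ~ touch h p) ->
  exists2 e, 0 < e & forall s, a <= s <= b -> 0 <= s <= 1 -> e < h s.
Proof.
wlog ab01 : a b / 0 <= a /\ b <= 1.
  move=> H hab; have [||e e0 he] := H (Num.max 0 a) (Num.min b 1).
  - by rewrite le_max ge_min !lexx orbT.
  - by move=> p; rewrite ge_max le_min => /andP[/andP[h1 h2] /andP[h3 h4]]; apply: hab; apply/andP.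
  - exists e => // s /andP[h1 h2] /andP[h3 h4]; apply: he; last by rewrite h3.
    by rewrite ge_max le_min h1 h2 h3.
move: ab01 => [a0 b1] nt.
have [ba|ab] := ltP b a.
  by exists 1 => // s /andP[h1 h2]; have := lt_le_trans ba (le_trans h1 h2); rewrite ltxx.
pose S := [set x | a <= x <= b /\ exists2 e, 0 < e & forall s, a <= s <= x -> e < h s].
have nt' p : a <= p <= b -> exists e del, [/\ 0 < e, 0 < del & forall s, 0 <= s <= 1 -> `|s - p| < del -> e < h s].
  by move=> pab; apply: not_touch; apply: nt => //; lra.
have Sa : S a.
  split; first by rewrite lexx.
  have [|e [del [e0 del0 he]]] := nt' a; first by rewrite lexx.
  exists e => // s sa; apply: he; first by lra.
  by rewrite ltr_norml; lra.
have Sub : ubound S b by move=> x [/andP[]].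
have hS : has_sup S by split; [exists a|exists b].
have aS : a <= sup S by exact: (ub_le_sup (proj2 hS) Sa).
have Sb : sup S <= b by exact: ge_sup (proj1 hS) Sub.
have [|e [del [e0 del0 he]]] := nt' (sup S); first by rewrite aS.
have [x [xab [e' e'0 he']] xS] := sup_adherent del0 hS.
have hle s : a <= s <= b -> s < sup S + del -> Num.min e e' < h s.
  move=> sab sS; rewrite gt_min; have [sx|xs] := leP s x.
    by rewrite (he' s) ?orbT //; lra.
  by rewrite he //; [lra|rewrite ltr_norml; lra].
have m0 : 0 < Num.min e e' by rewrite lt_min e0.
have [lt|ge] := ltP b (sup S + del).
  by exists (Num.min e e') => // s sab _; apply: hle => //; lra.
have Sn : S (sup S + del / 2).
  split; first by lra.
  by exists (Num.min e e') => // s sab; apply: hle; lra.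
by have := ub_le_sup (proj2 hS) Sn; lra.
Qed.

(** The slope is the supremum of the chord slopes to the left of [u], which every chord slope to the
    right bounds from above. *)
Lemma support_line (c : R -> R) u : convex01 c -> 0 < u < 1 ->
  exists m, forall x, 0 <= x <= 1 -> c u + m * (x - u) <= c x.
Proof.
move=> cvx u01.
pose S := [set z | exists2 x, 0 <= x < u & z = (c u - c x) / (u - x)].
have slopes x y : 0 <= x < u -> u < y <= 1 -> (c u - c x) / (u - x) <= (c y - c u) / (y - u).
  move=> xu uy; rewrite ler_pdivrMr ?subr_gt0; last by lra.
  rewrite mulrAC ler_pdivlMr ?subr_gt0; last by lra.
  have yx : 0 < y - x by lra.
  have := cvx x y ((y - u) / (y - x)).
  have -> : (y - u) / (y - x) * x + (1 - (y - u) / (y - x)) * y = u by field; lra.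
  have l01 : 0 <= (y - u) / (y - x) <= 1.
    by rewrite divr_ge0 ?ler_pdivrMr //=; lra.
  move=> /(_ ltac:(lra) ltac:(lra) l01).
  have -> : (y - u) / (y - x) * c x + (1 - (y - u) / (y - x)) * c y =
    ((y - u) * c x + (u - x) * c y) / (y - x) by field; lra.
  by rewrite ler_pdivlMr //; lra.
have S0 : S !=set0 by exists ((c u - c 0) / (u - 0)); exists 0 => //; lra.
have Sub y : u < y <= 1 -> ubound S ((c y - c u) / (y - u)).
  by move=> uy _ [x xu ->]; exact: slopes.
have hS : has_sup S by split => //; exists ((c 1 - c u) / (1 - u)); apply: Sub; lra.
exists (sup S) => x x01.
have [xu|ux|->] := ltgtP x u; last by rewrite subrr mulr0 addr0.
  have Sx : S ((c u - c x) / (u - x)) by exists x => //; lra.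
  have := ub_le_sup (proj2 hS) Sx; rewrite ler_pdivrMr ?subr_gt0 //; lra.
have := ge_sup (proj1 hS) (Sub x _); rewrite ler_pdivlMr ?subr_gt0 //.
by move=> /(_ ltac:(lra)); lra.
Qed.

Lemma affine_convex01 (l m : R) : convex01 (fun x => l + m * x).
Proof. by move=> x y r _ _ _; lra. Qed.

(* If f stayed above the line by e on one side of u, a slightly tilted line would beat
   the minorant at u. *)
Lemma minorant_tilt f c l m u (sg e del : R) : convex_minorant01 f c ->
  0 <= u <= 1 -> (sg = 1 \/ sg = -1) -> 0 < e -> 0 < del ->
  (forall x, 0 <= x <= 1 -> l + m * x <= f x) -> c u <= l + m * u ->
  (forall x, 0 <= x <= 1 -> sg * (x - u) <= del -> e < f x - (l + m * x)) -> False.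
Proof.
move=> [_ _ cmax] u01 sg1 e0 del0 Lf cu he.
pose z := e / (1 + del^-1).
have d0 : 0 < del^-1 by rewrite invr_gt0.
have z0 : 0 < z by rewrite divr_gt0 //; lra.
have ze : z * (1 + del^-1) = e by rewrite /z divfK //; lra.
have := cmax (fun x => (l + z + z * sg * u / del) + (m - z * sg / del) * x).
have E x : (l + z + z * sg * u / del) + (m - z * sg / del) * x =
  (l + m * x) + z * (1 - sg * (x - u) / del) by ring.
move=> /(_ (@affine_convex01 _ _)) H.
have /H /(_ u u01) : forall s, 0 <= s <= 1 ->
    (l + z + z * sg * u / del) + (m - z * sg / del) * s <= f s.
  move=> x x01; rewrite E; have [xd|dx] := leP (sg * (x - u)) del.
    apply: (@le_trans _ _ (l + m * x + e)); last by have := he x x01 xd; lra.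
    have hx : - (sg * (x - u)) <= 1 by case: sg1 => ->; lra.
    by rewrite lerD2l -ze ler_pM2l // lerD2l -mulNr ler_piMl // ltW.
  have := Lf x x01; have : 1 < sg * (x - u) / del by rewrite ltr_pdivlMr // mul1r.
  move=> h1 h2; have : 0 < z * (sg * (x - u) / del - 1) by rewrite mulr_gt0 //; lra.
  by lra.
by rewrite E subrr mulr0 mul0r; lra.
Qed.

(** If one side of [u] carried no touching point, compactness would keep the path at a positive
    distance above the line there and slightly beyond [u], which [minorant_tilt] excludes. *)
Lemma minorant_touches f c l m u : convex_minorant01 f c -> 0 < u < 1 ->
  (forall x, 0 <= x <= 1 -> l + m * x <= f x) -> c u = l + m * u ->
  let h := fun x => f x - (l + m * x) in
  (exists2 a, 0 <= a <= u & touch h a) /\ (exists2 b, u <= b <= 1 & touch h b).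
Proof.
move=> cm u01 Lf cu h.
have u01' : 0 <= u <= 1 by lra.
have cu' : c u <= l + m * u by rewrite cu.
split; apply: contrapT => nt.
  have ntp p : 0 <= p <= u -> ~ touch h p by move=> pu tp; apply: nt; exists p.
  have [|e1 e10 he1] := @no_touch_lower_bound h 0 u; first by move=> p pu _; exact: ntp.
  have [|e2 [del [e20 del0 he2]]] := not_touch (ntp u _); first by lra.
  have e0 : 0 < Num.min e1 e2 by rewrite lt_min e10.
  have del2 : 0 < del / 2 by rewrite divr_gt0.
apply: (minorant_tilt cm u01' (or_introl erefl) e0 del2 Lf cu').
  move=> x x01 xu; rewrite gt_min; have [xu'|ux] := leP x u.
    by rewrite (he1 x) //; lra.
  by rewrite (he2 x) ?orbT // ltr_norml; lra.
have ntp p : u <= p <= 1 -> ~ touch h p by move=> pu tp; apply: nt; exists p.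
have [|e1 e10 he1] := @no_touch_lower_bound h u 1; first by move=> p pu _; exact: ntp.
have [|e2 [del [e20 del0 he2]]] := not_touch (ntp u _); first by lra.
have e0 : 0 < Num.min e1 e2 by rewrite lt_min e10.
have del2 : 0 < del / 2 by rewrite divr_gt0.
apply: (minorant_tilt cm u01' (or_intror erefl) e0 del2 Lf cu').
move=> x x01 xu; rewrite gt_min; have [xu'|ux] := leP u x.
  by rewrite (he1 x) //; lra.
by rewrite (he2 x) ?orbT // ltr_norml; lra.
Qed.

End CadlagPaths.

(** * Limits of faces and the excursion interval *)

Section ExcursionGeometry.
Context {R : realType}.

Lemma pow2_small (e : R) : 0 < e -> exists n0, forall n, (n0 <= n)%N -> ((2 ^ n)%:R)^-1 < e.
Proof.
move=> e0; exists (Num.truncn e^-1).+1 => n n0n.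
have e'0 : 0 < e^-1 by rewrite invr_gt0.
rewrite -[ltRHS]invrK ltf_pV2 ?posrE ?pow2_gt0 //.
have /andP[_ /lt_trans] := truncn_itv (ltW e'0); apply.
by rewrite ltr_nat; apply: leq_ltn_trans n0n _; exact: ltn_expl.
Qed.

Definition dyadic_from n0 (x : R) := forall n, (n0 <= n)%N -> exists2 j, (j <= 2 ^ n)%N & x = grid n j.

Lemma grid_dyadic n j : (j <= 2 ^ n)%N -> dyadic_from n (grid n j).
Proof.
move=> jN n' nn'; exists (j * 2 ^ (n' - n))%N.
  by rewrite -[X in (_ <= 2 ^ X)%N](subnKC nn') expnD leq_mul2r jN orbT.
have e : (2 ^ n' = 2 ^ n * 2 ^ (n' - n))%N by rewrite -expnD subnKC.
rewrite !gridE //; last by rewrite e leq_mul2r jN orbT.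
by rewrite e !natrM -mulf_div divff ?mulr1 // pnatr_eq0 expn_eq0.
Qed.

Lemma dyadic_between (x y : R) : 0 <= x -> x < y -> y <= 1 ->
  exists n0 q, x < q < y /\ dyadic_from n0 q.
Proof.
move=> x0 xy y1; have [|n hn] := @pow2_small (y - x); first by lra.
have {}hn := hn n (leqnn _); have N0 := pow2_gt0 (R := R) n.
have y0 : 0 <= (2 ^ n)%:R * x by rewrite mulr_ge0 // ltW.
have /andP[t1 t2] := truncn_itv y0; set j := Num.truncn _ in t1 t2.
have q1 : x < j.+1%:R / (2 ^ n)%:R by rewrite ltr_pdivlMr // mulrC.
have q2 : j.+1%:R / (2 ^ n)%:R < y.
  rewrite -[j.+1]addn1 natrD mulrDl mul1r.
  have : j%:R / (2 ^ n)%:R <= x by rewrite ler_pdivrMr // mulrC.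
  by lra.
have jN : (j.+1 <= 2 ^ n)%N.
  by rewrite -(ler_nat R) -[leRHS]mul1r -ler_pdivrMr //; lra.
exists n, (j.+1%:R / (2 ^ n)%:R); split; first by rewrite q1.
by rewrite -gridE //; exact: grid_dyadic.
Qed.

(** Right continuity moves a near contact at [s] to a dyadic point just to the right of [s]; the
    time 1, which has no right neighbours, is dyadic itself. *)
Lemma touch_dyadic f (l m p e del : R) : cadlag01 f ->
  touch (fun x => f x - (l + m * x)) p -> 0 < e -> 0 < del ->
  exists n0 q, [/\ 0 <= q <= 1, `|q - p| < del, f q - (l + m * q) <= e & dyadic_from n0 q].
Proof.
move=> cf tp e0 del0; have e20 : 0 < e / 2 by rewrite divr_gt0.
have [s [s01 sp hs]] := tp _ _ e20 del0.
have [s1|s1] := eqVneq s 1.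
  exists 0%N, s; split => //; first by lra.
  by rewrite s1 -(@grid_top R 0 1) //; exact: grid_dyadic.
have s01' : 0 <= s < 1 by rewrite lt_neqAle s1; lra.
have e40 : 0 < e / 4 by rewrite divr_gt0.
have [d1 d10 hd1] := cadlag_right cf s01' e40.
have m10 : 0 < `|m| + 1 by rewrite ltr_wpDl.
pose y := Num.min (Num.min (s + d1) 1) (Num.min (s + e / 4 / (`|m| + 1)) (s + (del - `|s - p|))).
have e4m : 0 < e / 4 / (`|m| + 1) by rewrite divr_gt0.
have sy : s < y by rewrite /y !lt_min; lra.
have y1 : y <= 1 by rewrite /y !ge_min lexx orbT.
have [n0 [q [sqy dq]]] := dyadic_between (proj1 (andP s01)) sy y1.
have : q < y by lra.
rewrite /y !lt_min => /andP[/andP[q1 q2] /andP[q3 q4]].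
exists n0, q; split => //; first by lra.
  have -> : q - p = (q - s) + (s - p) by ring.
  by apply: le_lt_trans (ler_normD _ _) _; rewrite gtr0_norm; lra.
have := hd1 q ltac:(lra); rewrite ltr_norml => /andP[_ f1].
have : - (m * (q - s)) <= e / 4.
  apply: le_trans (ler_norm _) _; rewrite normrN normrM.
  apply: (@le_trans _ _ ((`|m| + 1) * `|q - s|)); first by rewrite ler_wpM2r // lerDl.
  by rewrite mulrC -ler_pdivlMr // gtr0_norm; lra.
by lra.
Qed.

Definition three_touch_line (f : R -> R) := exists l m p1 p2 p3, [/\
  (0 <= p1 /\ p1 < p2 /\ p2 < p3 /\ p3 <= 1),
  forall x, 0 <= x <= 1 -> l + m * x <= f x,
  touch (fun x => f x - (l + m * x)) p1,
  touch (fun x => f x - (l + m * x)) p2 &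
  touch (fun x => f x - (l + m * x)) p3].

(** The value at [q] is an average of those at [a] and [b], in which [a] has weight at least [del],
    as the interval has length at most 1. *)
Lemma affine_left_end (al be a b q eta del : R) : 0 <= al + be * b ->
  a <= q -> q + del <= b -> b - a <= 1 -> 0 < del -> 0 <= eta -> al + be * q <= eta ->
  al + be * a <= eta / del.
Proof.
move=> Db aq qb ba del0 eta0 Dq; rewrite ler_pdivlMr //.
have [Da|Da] := leP (al + be * a) 0; first by nra.
apply: (@le_trans _ _ ((al + be * a) * (b - q))); first by rewrite ler_pM2l //; lra.
have : 0 <= (al + be * b) * (q - a) by rewrite mulr_ge0 //; lra.
have : (al + be * q) * (b - a) <= eta * (b - a) by rewrite ler_wpM2r //; lra.
have : eta * (b - a) <= eta by rewrite ler_piMr.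
by lra.
Qed.

Lemma affine_right_end (al be a b q eta del : R) : 0 <= al + be * a ->
  q <= b -> a + del <= q -> b - a <= 1 -> 0 < del -> 0 <= eta -> al + be * q <= eta ->
  al + be * b <= eta / del.
Proof.
move=> Da qb aq ba del0 eta0 Dq.
have := @affine_left_end al (- be) (- b) (- a) (- q) eta del.
rewrite !mulrNN; apply; lra.
Qed.

Lemma small_near_touch (h : R -> R) A B r : (forall x, 0 <= x <= 1 -> 0 <= h x) ->
  (forall p, 0 <= p <= 1 -> touch h p -> p = A \/ p = B) -> 0 < r ->
  exists2 z, 0 < z & forall x, 0 <= x <= 1 -> h x <= z -> `|x - A| < r \/ `|x - B| < r.
Proof.
move=> h0 uniq r0.
pose near x := (`|x - A| < r) || (`|x - B| < r).
(* Adding 1 near [A] and [B] removes the only touching points, so compactness bounds the sum below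
   by a positive constant. *)
pose h' x := h x + (near x)%:R.
have hh' x : 0 <= x <= 1 -> h x <= h' x by rewrite lerDl.
have [p _ p01 tp|z z0 hz] := @no_touch_lower_bound R h' 0 1.
  have tph : touch h p.
    by move=> e del e0 del0; have [s [s01 sp hs]] := tp e del e0 del0; exists s;
      split => //; apply: le_trans (hh' s s01) hs.
  have h20 : 0 < 2^-1 :> R by rewrite invr_gt0.
  have [s [s01 sp]] := tp 2^-1 r h20 r0.
  have ns : near s by case: (uniq p p01 tph) => e; rewrite /near -e sp ?orbT.
  by rewrite /h' ns (_ : true%:R = 1) //; have := h0 s s01; lra.
exists z => // x x01 hx.
have := hz x x01 x01; rewrite /h'; have [/orP//|_] := boolP (near x).
by rewrite addr0 ltNge hx.
Qed.

Variables (f c : R -> R) (u : R).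
Hypotheses (cf : cadlag01 f) (cm : convex_minorant01 f c) (u01 : 0 < u < 1).
Hypotheses (no3 : ~ three_touch_line f) (f1 : f 1 = left_lim f 1).

Variables (a b v : nat -> R).
Hypothesis abv : forall n, [/\ 0 <= a n, a n <= v n, v n < b n & b n <= 1].
Hypothesis vu : forall e, 0 < e -> exists n0, forall n, (n0 <= n)%N -> u <= v n < u + e.
Hypothesis chord : forall n, exists al be, [/\
  forall j, (j <= 2 ^ n)%N -> al + be * grid n j <= f (grid n j),
  al + be * a n = f (a n) & al + be * b n = f (b n)].
Hypothesis wide : exists2 del, 0 < del &
  forall n0, exists n, [/\ (n0 <= n)%N, a n + del <= v n & v n + del <= b n].

Let chord_below l m : (forall x, 0 <= x <= 1 -> l + m * x <= f x) ->
  forall n, exists al be, [/\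
  forall j, (j <= 2 ^ n)%N -> al + be * grid n j <= f (grid n j) - (l + m * grid n j),
  0 <= al + be * a n, 0 <= al + be * b n,
  al + be * a n = f (a n) - (l + m * a n) & al + be * b n = f (b n) - (l + m * b n)].
Proof.
move=> Lf n; have [al [be [h1 h2 h3]]] := chord n; have [a0 av vb b1] := abv n.
exists (al - l), (be - m); split; try lra.
- by move=> j jN; have := h1 j jN; lra.
- have := Lf (a n) ltac:(lra); lra.
- have := Lf (b n) ltac:(lra); lra.
Qed.

(* lra fails once section hypotheses are cleared, so they are kept. *)
Ltac goal_lra := clear - cf cm u01 no3 f1 abv vu chord wide chord_below; intros; lra.

Lemma touch_of_small (h : R -> R) (x y : R) :
  (forall e, 0 < e -> exists s, [/\ x <= s <= y, 0 <= s <= 1 & h s <= e]) ->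
  exists p, [/\ x <= p <= y, 0 <= p <= 1 & touch h p].
Proof.
move=> H; apply: contrapT => nt.
have [|e e0 he] := @no_touch_lower_bound R h x y.
  by move=> p px p01 tp; apply: nt; exists p.
have [s [sx s01 hs]] := H e e0.
by have := he s sx s01; rewrite ltNge hs.
Qed.

(** On a level where the face is wide, chord minus line is nonnegative at both vertices and tiny at
    a dyadic point near [u]. Being affine, it is tiny at both vertices, which stay at distance
    [del / 2] from [u] on either side. *)
Lemma point_not_touch l m : (forall x, 0 <= x <= 1 -> l + m * x <= f x) ->
  ~ touch (fun x => f x - (l + m * x)) u.
Proof.
move=> Lf tu; have [del del0 hw] := wide.
have d20 : 0 < del / 4 by rewrite divr_gt0.
have small e : 0 < e -> exists n, [/\ a n <= u - del / 2, u + del / 2 <= b n,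
    f (a n) - (l + m * a n) <= e & f (b n) - (l + m * b n) <= e].
  move=> e0; have ed0 : 0 < e * (del / 4) by rewrite mulr_gt0.
  have [n1 [q [q01 qu hq dq]]] := touch_dyadic cf tu ed0 d20.
  have [n2 hn2] := vu d20.
  have [n [nn an bn]] := hw (maxn n1 n2).
  have := hn2 n (leq_trans (leq_maxr _ _) nn) => un.
  have [j jN qj] := dq n (leq_trans (leq_maxl _ _) nn).
  have [al [be [h1 h2 h3 h4 h5]]] := chord_below Lf n.
  have [a0 av vb b1] := abv n.
  have Dq : al + be * q <= e * (del / 4) by rewrite qj; apply: le_trans (h1 j jN) _; rewrite -qj.
  move: qu; rewrite ltr_norml => qu.
  have ee : e = e * (del / 4) / (del / 4) by rewrite mulfK // gt_eqF.
  exists n; split.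
  - by move: an un del0; goal_lra.
  - by move: bn un del0; goal_lra.
  - rewrite -h4 ee.
    by apply: (affine_left_end h3 _ _ _ d20 (ltW ed0) Dq); move: an bn un qu a0 b1; goal_lra.
  - rewrite -h5 ee.
    by apply: (affine_right_end h2 _ _ _ d20 (ltW ed0) Dq); move: an bn un qu a0 b1; goal_lra.
have [|p1 [p1u p101 tp1]] := @touch_of_small (fun x => f x - (l + m * x)) 0 (u - del / 2).
  move=> e e0; have [n [an bn ha _]] := small e e0; exists (a n); have [a0 av vb b1] := abv n.
  by split => //; lra.
have [|p3 [p3u p301 tp3]] := @touch_of_small (fun x => f x - (l + m * x)) (u + del / 2) 1.
  move=> e e0; have [n [an bn _ hb]] := small e e0; exists (b n); have [a0 av vb b1] := abv n.
  by split => //; lra.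
by apply: no3; exists l, m, p1, u, p3; split => //; lra.
Qed.

(** If both the value and the left limit were above the line, right continuity and convergence from
    the left would keep the path away from it around [p]. *)
Lemma touch_cases (l m p : R) : 0 <= p <= 1 -> touch (fun x => f x - (l + m * x)) p ->
  f p <= l + m * p \/ (0 < p /\ left_lim f p <= l + m * p).
Proof.
move=> p01 tp; apply: contrapT => /not_orP[/negP fp ll].
rewrite -ltNge in fp.
have m10 : 0 < `|m| + 1 by rewrite ltr_wpDl.
have mx x d : `|x - p| < d / (`|m| + 1) -> m * (x - p) <= d.
  move=> h; apply: le_trans (ler_norm _) _; rewrite normrM.
  apply: (@le_trans _ _ ((`|m| + 1) * `|x - p|)); first by rewrite ler_wpM2r // lerDl.
  by rewrite mulrC -ler_pdivlMr // ltW.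
have [e1 [d1 [e10 d10 h1]]] : exists e del, [/\ 0 < e, 0 < del &
    forall x, 0 <= x <= 1 -> p <= x < p + del -> e < f x - (l + m * x)].
  pose e := (f p - (l + m * p)) / 3; have e0 : 0 < e by rewrite divr_gt0 // subr_gt0.
  have [p1|p1] := eqVneq p 1.
    exists e, 1; split => // x x01 xp.
    have -> : x = p by apply/eqP; rewrite eq_le; lra.
    by rewrite /e; lra.
  have p01' : 0 <= p < 1 by rewrite lt_neqAle p1; lra.
  have [d1 d10 hd1] := cadlag_right cf p01' e0.
  exists e, (Num.min d1 (e / (`|m| + 1))); split => //.
    by rewrite lt_min d10 divr_gt0.
  move=> x x01 /andP[px]; rewrite -ltrBlDl lt_min => /andP[xd1 xm].
  have := hd1 x ltac:(lra); rewrite ltr_norml => /andP[fx _].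
  have := @mx x e; rewrite ger0_norm ?subr_ge0 // => /(_ xm).
  by rewrite /e in fx *; lra.
have [e2 [d2 [e20 d20 h2]]] : exists e del, [/\ 0 < e, 0 < del &
    forall x, 0 <= x <= 1 -> p - del < x < p -> e < f x - (l + m * x)].
  have [p0|p0] := eqVneq p 0.
    by exists 1, 1; split => // x x01 xp; exfalso; lra.
  have pp : 0 < p by rewrite lt_neqAle eq_sym p0; lra.
  have {}ll : l + m * p < left_lim f p.
    by rewrite ltNge; apply/negP => h; apply: ll.
  pose e := (left_lim f p - (l + m * p)) / 3; have e0 : 0 < e by rewrite divr_gt0 // subr_gt0.
  have p01' : 0 < p <= 1 by lra.
  have [d1' d10' hd1] := cadlag_left cf p01' e0.
  exists e, (Num.min d1' (e / (`|m| + 1))); split => //.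
    by rewrite lt_min d10' divr_gt0.
  move=> x x01 /andP[px xp]; move: px; rewrite ltrBlDr -ltrBlDl lt_min => /andP[xd1 xm].
  have := hd1 x ltac:(lra); rewrite ltr_norml => /andP[fx _].
  have := @mx x e; rewrite ltr0_norm ?subr_lt0 // opprB => /(_ xm).
  by rewrite /e in fx *; lra.
have e0 : 0 < Num.min e1 e2 by rewrite lt_min e10.
have d0 : 0 < Num.min d1 d2 by rewrite lt_min d10.
have [s [s01 sp hs]] := tp _ _ e0 d0.
move: sp; rewrite ltr_norml lt_min ltrNl lt_min => /andP[/andP[s1 s2] /andP[s3 s4]].
move: hs; rewrite le_min => /andP[hs1 hs2].
have [ps|sp] := leP p s.
  by have := h1 s s01 ltac:(lra); lra.
by have := h2 s s01 ltac:(lra); lra.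
Qed.

(** When it is the left limit that touches, convexity of [c] between 1 and a point [s] slightly
    before [p] bounds [c p] by path values near [p]. At [p = 1] the left limit is the value itself,
    by [f1]. *)
Lemma minorant_at_touch (l m p : R) : 0 <= p <= 1 ->
  touch (fun x => f x - (l + m * x)) p -> c p <= l + m * p.
Proof.
move=> p01 tp; have [cvx cle _] := cm.
have [fp|[p0 ll]] := touch_cases p01 tp; first by apply: le_trans (cle p p01) fp.
have [p1|p1] := eqVneq p 1; first by have := cle p p01; rewrite p1 f1 -p1; lra.
have p01' : 0 < p <= 1 by lra.
have p1' : p < 1 by rewrite lt_neqAle p1; lra.
rewrite leNgt; apply/negP => z0.
pose z := c p - (l + m * p); have z0' : 0 < z by rewrite subr_gt0.
pose A := `|c 1 - (l + m * p)| + 1.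
have A0 : 0 < A by rewrite ltr_wpDl.
have z30 : 0 < z / 3 by rewrite divr_gt0.
have [d1 d10 hd1] := cadlag_left cf p01' z30.
(* The bound with [A] keeps the contribution of [c 1] within [(1 - p) * z / 3], and [c s] exceeds
   the line at [p] by at most [z / 3]; together they cannot account for the supposed excess [z]. *)
pose y := Num.min (Num.min (d1 / 2) p) ((1 - p) * (z / 3) / A).
have y0 : 0 < y by rewrite !lt_min p0 !divr_gt0 //= !mulr_gt0 //; lra.
have [y1 y2 y3] : [/\ y <= d1 / 2, y <= p & y <= (1 - p) * (z / 3) / A].
  by split; rewrite /y !ge_min lexx ?orbT.
pose s := p - y.
have := hd1 s; rewrite /s ltr_norml => /(_ ltac:(lra)) /andP[_ fs].
have := cle s ltac:(rewrite /s; lra); rewrite -/s => cs.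
have s1 : 0 < 1 - s by rewrite /s; lra.
have := cvx s 1 ((1 - p) / (1 - s)).
have l01 : 0 <= (1 - p) / (1 - s) <= 1.
  apply/andP; split; first by apply: divr_ge0; [rewrite subr_ge0 ltW|exact: ltW].
  by rewrite ler_pdivrMr // mul1r lerD2l lerN2 gerBl ltW.
have s01 : 0 <= s <= 1 by move: y2 y0 p01; rewrite /s; goal_lra.
move=> /(_ s01 ltac:(by rewrite ler01 lexx) l01).
have -> : (1 - p) / (1 - s) * s + (1 - (1 - p) / (1 - s)) * 1 = p by field; lra.
have -> : (1 - p) / (1 - s) * c s + (1 - (1 - p) / (1 - s)) * c 1 =
  ((1 - p) * c s + (p - s) * c 1) / (1 - s) by field; lra.
rewrite ler_pdivlMr // => H.
have ps : p - s = y by rewrite /s; ring.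
have Y : y * A <= (1 - p) * (z / 3) by rewrite -ler_pdivlMr.
have C1 : y * (c 1 - (l + m * p)) <= y * A.
  by rewrite ler_pM2l // (le_trans (ler_norm _)) // lerDl.
have B1 : (1 - p) * c s <= (1 - p) * (l + m * p + z / 3).
  by rewrite ler_pM2l ?subr_gt0 //; move: cs fs ll; rewrite -/s; goal_lra.
have Z1 : (1 - p) * z <= (1 - s) * z by rewrite ler_pM2r // lerD2l lerN2 gerBl ltW.
have Z2 : 0 < (1 - p) * z by rewrite mulr_gt0 // subr_gt0.
rewrite ps in H.
have E : (1 - s) * z = c p * (1 - s) - (1 - s) * (l + m * p) by rewrite /z; ring.
have s2 : 1 - s = (1 - p) + y by rewrite /s; ring.
rewrite E s2 in Z1; rewrite s2 in H.
by move: H Y C1 B1 Z1 Z2 E; rewrite s2; goal_lra.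
Qed.

Lemma affine_between (al be x q1 q2 eta : R) : q1 <= x <= q2 -> q1 < q2 ->
  al + be * q1 <= eta -> al + be * q2 <= eta -> al + be * x <= eta.
Proof.
move=> /andP[h1 h2] q12 D1 D2; have q0 : 0 < q2 - q1 by lra.
rewrite -(ler_pM2r q0).
have : (al + be * q1) * (q2 - x) <= eta * (q2 - x) by rewrite ler_wpM2r // subr_ge0.
have : (al + be * q2) * (x - q1) <= eta * (x - q1) by rewrite ler_wpM2r // subr_ge0.
by lra.
Qed.

(** The chord is below the path at dyadic points near [A] and near [B], so chord minus line is small
    at both. A vertex between these points is handled by interpolation, a vertex outside by
    extrapolation from the nearer one. *)
Lemma chord_ends_small l m A B : (forall x, 0 <= x <= 1 -> l + m * x <= f x) ->
  A < u < B -> B - A <= 1 ->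
  touch (fun x => f x - (l + m * x)) A -> touch (fun x => f x - (l + m * x)) B ->
  forall e, 0 < e -> exists n0, forall n, (n0 <= n)%N ->
    f (a n) - (l + m * a n) <= e /\ f (b n) - (l + m * b n) <= e.
Proof.
move=> Lf AuB BA tA tB e e0.
pose r := Num.min ((u - A) / 3) ((B - u) / 3).
have [r1 r2] : r <= (u - A) / 3 /\ r <= (B - u) / 3 by rewrite /r !ge_min !lexx orbT.
have r0 : 0 < r by rewrite /r lt_min !divr_gt0 //; lra.
have er0 : 0 < e * r by rewrite mulr_gt0.
have ee : e = e * r / r by rewrite mulfK // gt_eqF.
have ere : e * r <= e by rewrite ler_piMr ?(ltW e0) //; lra.
have [n1 [q1 [q101 q1A hq1 dq1]]] := touch_dyadic cf tA er0 r0.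
have [n2 [q2 [q201 q2B hq2 dq2]]] := touch_dyadic cf tB er0 r0.
have [n3 hn3] := vu r0.
move: q1A q2B; rewrite !ltr_norml => q1A q2B.
exists (maxn n1 (maxn n2 n3)) => n; rewrite !geq_max => /andP[nn1 /andP[nn2 nn3]].
have vn := hn3 n nn3.
have [j1 j1N qj1] := dq1 n nn1; have [j2 j2N qj2] := dq2 n nn2.
have [al [be [h1 h2 h3 h4 h5]]] := chord_below Lf n.
have [a0 av vb b1] := abv n.
have D1 : al + be * q1 <= e * r by rewrite qj1; apply: le_trans (h1 _ j1N) _; rewrite -qj1.
have D2 : al + be * q2 <= e * r by rewrite qj2; apply: le_trans (h1 _ j2N) _; rewrite -qj2.
clear h1 hq1 hq2 hn3 dq1 dq2 qj1 qj2.
have ba1 : b n - a n <= 1 by move: a0 b1; goal_lra.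
rewrite -h4 -h5; split.
  have [aq|qa] := leP (a n) q1.
    by rewrite ee; apply: (affine_left_end h3 aq _ ba1 r0 (ltW er0) D1); move: vn vb q1A r1 r0; goal_lra.
  by apply: le_trans _ ere; apply: (affine_between _ _ D1 D2); move: qa av vn q1A q2B r1 r2 r0; goal_lra.
have [qb|bq] := leP q2 (b n).
  by rewrite ee; apply: (affine_right_end h2 qb _ ba1 r0 (ltW er0) D2); move: vn av q2B r2 r0; goal_lra.
by apply: le_trans _ ere; apply: (affine_between _ _ D1 D2); move: bq vb vn q1A q2B r1 r2 r0; goal_lra.
Qed.

(** Inside, the absence of touching points keeps both the value and the left limit strictly above
    [c], which is the line there. At [A] and [B] one of them falls to [c], so an interval around [u]
    in the excursion set cannot reach them. *)
Lemma excursion_component A B l m : 0 <= A -> A < u < B -> B <= 1 ->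
  (forall x, 0 <= x <= 1 -> l + m * x <= c x) ->
  (forall x, A <= x <= B -> c x = l + m * x) ->
  (forall x, A < x < B -> ~ touch (fun x => f x - (l + m * x)) x) ->
  touch (fun x => f x - (l + m * x)) A -> touch (fun x => f x - (l + m * x)) B ->
  connected_component (excursion_set f c) u = `]A, B[%classic.
Proof.
move=> A0 AuB B1 Lc cL nt tA tB; have [cvx cle _] := cm.
have nO p : 0 <= p <= 1 -> touch (fun x => f x - (l + m * x)) p -> c p = l + m * p ->
    ~ excursion_set f c p.
  move=> p01 tp cp [_]; rewrite cp lt_min => /andP[h1 h2].
  by have [h|[_ h]] := touch_cases p01 tp; [move: h1|move: h2]; rewrite ltNge h.
have m10 : 0 < `|m| + 1 by rewrite ltr_wpDl.
have inO : `]A, B[%classic `<=` excursion_set f c.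
  move=> x /=; rewrite in_itv /= => xAB; have x01 : 0 < x < 1 by lra.
  have x01' : 0 <= x <= 1 by lra.
  split => //; rewrite cL; last by lra.
  have [e [del [e0 del0 he]]] := not_touch (nt x xAB).
  rewrite lt_min; apply/andP; split.
    by have := he x x01'; rewrite subrr normr0 => /(_ del0); lra.
  have e20 : 0 < e / 2 by rewrite divr_gt0.
  have x01l : 0 < x <= 1 by lra.
  have [d1 d10 hd1] := cadlag_left cf x01l e20.
  pose y := Num.min (Num.min (d1 / 2) (del / 2)) (Num.min x (e / 4 / (`|m| + 1))).
  have y0 : 0 < y by rewrite !lt_min !divr_gt0 //=; lra.
  have [y1 y2 y3 y4] : [/\ y <= d1 / 2, y <= del / 2, y <= x & y <= e / 4 / (`|m| + 1)].
    by split; rewrite /y !ge_min lexx ?orbT.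
  have := hd1 (x - y) ltac:(move: y0 y1 d10; goal_lra); rewrite ltr_norml => /andP[_ fs].
  have xy : `|x - y - x| < del by rewrite ltr_norml; move: y0 y2 del0; goal_lra.
  have hs := he (x - y) ltac:(move: y0 y3 x01; goal_lra) xy.
  have : m * y <= e / 4.
    apply: le_trans (ler_norm _) _; rewrite normrM (gtr0_norm y0).
    apply: (@le_trans _ _ ((`|m| + 1) * y)); first by rewrite ler_wpM2r ?(ltW y0) // lerDl.
    by rewrite mulrC -ler_pdivlMr.
  by move: fs hs e0; goal_lra.
have Ou : excursion_set f c u by apply: inO; rewrite /= in_itv /=.
apply/seteqP; split; last first.
  have uAB : [set` `]A, B[] u by rewrite /= in_itv /=.
  apply: (connected_component_max uAB inO).
  by apply/connected_intervalP; exact: interval_is_interval.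
move=> x [K [Ku KO /connected_intervalP iK] Kx] /=; rewrite in_itv /=.
have nK p : 0 <= p <= 1 -> touch (fun x => f x - (l + m * x)) p -> c p = l + m * p -> ~ K p.
  by move=> p01 tp cp /KO; exact: nO.
rewrite !ltNge; apply/andP; split; apply/negP => xA.
  apply: (nK A _ tA); [lra|by apply: cL; lra|].
  by apply: (iK x u Kx Ku); lra.
apply: (nK B _ tB); [lra|by apply: cL; lra|].
by apply: (iK u x Ku Kx); lra.
Qed.

Lemma excursion_limit : exists A B, [/\ [/\ 0 <= A, A < u, u < B & B <= 1],
  excursion_set f c u, exc_left f c u = A, exc_right f c u = B &
  forall e, 0 < e -> exists n0, forall n, (n0 <= n)%N ->
    [/\ `|a n - A| < e, `|b n - B| < e, `|f (a n) - c A| < e & `|f (b n) - c B| < e]].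
Proof.
have [cvx cle _] := cm; have u01' : 0 <= u <= 1 by move: u01; lra.
have [m hm] := support_line cvx u01; pose l := c u - m * u.
have Lc x : 0 <= x <= 1 -> l + m * x <= c x by move=> /hm; rewrite /l; lra.
have Lf x : 0 <= x <= 1 -> l + m * x <= f x.
  by move=> x01; apply: le_trans (Lc x x01) (cle x x01).
have cu : c u = l + m * u by rewrite /l; ring.
have [[A Au tA] [B uB tB]] := minorant_touches cm u01 Lf cu.
have nu := point_not_touch Lf.
have /andP[A0 Aleu] := Au; have /andP[uleB B1] := uB.
have Au' : A < u.
  by rewrite lt_neqAle Aleu andbT; apply/eqP => e; apply: nu; rewrite -e.
have uB' : u < B.
  by rewrite lt_neqAle uleB andbT; apply/eqP => e; apply: nu; rewrite e.
have A01 : 0 <= A <= 1 by lra.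
have B01 : 0 <= B <= 1 by lra.
have uniq p : 0 <= p <= 1 -> touch (fun x => f x - (l + m * x)) p -> p = A \/ p = B.
  move=> p01 tp; have [pA|pA] := eqVneq p A; first by left.
  have [pB|pB] := eqVneq p B; first by right.
  exfalso; have [lA|gA|/eqP] := ltgtP p A; last by rewrite (negbTE pA).
    by apply: no3; exists l, m, p, A, B; split => //; lra.
  have [lB|gB|/eqP] := ltgtP p B; last by rewrite (negbTE pB).
    by apply: no3; exists l, m, A, p, B; split => //; lra.
  by apply: no3; exists l, m, A, B, p; split => //; lra.
have cA : c A = l + m * A by apply: le_anti; rewrite (minorant_at_touch A01 tA) Lc.
have cB : c B = l + m * B by apply: le_anti; rewrite (minorant_at_touch B01 tB) Lc.
have BA : 0 < B - A by lra.
have cL x : A <= x <= B -> c x = l + m * x.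
  move=> xAB; apply: le_anti; rewrite Lc ?andbT; last by lra.
  have l01 : 0 <= (B - x) / (B - A) <= 1.
    have /andP[Ax xB] := xAB; rewrite ler_pdivrMr // mul1r lerD2l lerN2 Ax andbT.
    by apply: divr_ge0; [rewrite subr_ge0|exact: ltW].
  have := cvx A B ((B - x) / (B - A)) A01 B01 l01.
  have -> : (B - x) / (B - A) * A + (1 - (B - x) / (B - A)) * B = x by field; lra.
  rewrite cA cB; have -> : (B - x) / (B - A) * (l + m * A) + (1 - (B - x) / (B - A)) * (l + m * B)
    = l + m * x by field; lra.
  by [].
have ntx x : A < x < B -> ~ touch (fun x => f x - (l + m * x)) x.
  move=> /andP[Ax xB] tx.
  have x01 : 0 <= x <= 1 by rewrite (le_trans A0 (ltW Ax)) (le_trans (ltW xB) B1).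
  by case: (uniq x x01 tx) => e; [move: Ax|move: xB]; rewrite e ltxx.
have AuB : A < u < B by lra.
have comp := excursion_component A0 AuB B1 Lc cL ntx tA tB.
have BA1 : B - A <= 1 by lra.
have small := chord_ends_small Lf AuB BA1 tA tB.
have m10 : 0 < `|m| + 1 by rewrite ltr_wpDl.
exists A, B; split => //.
- have : connected_component (excursion_set f c) u u by rewrite comp /= in_itv /=.
  exact: connected_component_sub.
- by rewrite /exc_left comp inf_itv // bnd_simp -subr_gt0.
- by rewrite /exc_right comp sup_itv // bnd_simp -subr_gt0.
move=> e e0.
pose r := Num.min (Num.min ((u - A) / 3) ((B - u) / 3)) (e / 4 / (`|m| + 1)).
have [r1 r2 r3] : [/\ r <= (u - A) / 3, r <= (B - u) / 3 & r <= e / 4 / (`|m| + 1)].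
  by split; rewrite /r !ge_min lexx ?orbT.
have r0 : 0 < r by rewrite /r !lt_min !divr_gt0 ?subr_gt0.
have rm : r * (`|m| + 1) <= e / 4 by rewrite -ler_pdivlMr.
have re : r < e.
  apply: (@le_lt_trans _ _ (e / 4)); last by move: e0; goal_lra.
  by apply: le_trans rm; rewrite ler_peMr ?(ltW r0) // lerDr.
have hge0 x : 0 <= x <= 1 -> 0 <= f x - (l + m * x) by move=> /Lf; rewrite subr_ge0.
(* A path value close to the line forces the vertex near [A] or [B]; its position relative to [u]
   decides which. *)
have [z' z'0 near] := small_near_touch hge0 uniq r0.
pose z := Num.min z' (e / 2).
have z0 : 0 < z by rewrite /z !lt_min z'0 divr_gt0.
have [z1 z2] : z <= z' /\ z <= e / 2 by split; rewrite /z !ge_min lexx ?orbT.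
have [n1 hn1] := small z z0; have [n2 hn2] := vu r0.
exists (maxn n1 n2) => n; rewrite geq_max => /andP[nn1 nn2].
have [ha hb] := hn1 n nn1; have vn := hn2 n nn2.
have [a0 av vb b1] := abv n.
have a01 : 0 <= a n <= 1 by move: a0 av vb b1; goal_lra.
have b01 : 0 <= b n <= 1 by move: a0 av vb b1; goal_lra.
have aA : `|a n - A| < r.
  case: (near _ a01 (le_trans ha z1)) => //.
  by rewrite ltr_norml; move: av vn r2 r0; goal_lra.
have bB : `|b n - B| < r.
  case: (near _ b01 (le_trans hb z1)) => //.
  by rewrite ltr_norml; move: vb vn r1 r0; goal_lra.
have mr x y : `|x - y| < r -> `|m * (x - y)| <= e / 4.
  move=> xy; rewrite normrM; apply: le_trans rm; rewrite mulrC.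
  by apply: ler_pM => //; [exact: ltW|rewrite lerDl].
(* The path may jump at [A] and [B]; its values at the vertices converge because they are squeezed
   between the line and the line plus [z]. *)
have := mr _ _ aA; have := mr _ _ bB; rewrite !ler_norml => mb ma.
have := Lf _ a01; have := Lf _ b01 => Lb La.
split; first exact: lt_trans aA re.
- exact: lt_trans bB re.
- by rewrite cA ltr_norml; move: ha La ma z2 e0; goal_lra.
- by rewrite cB ltr_norml; move: hb Lb mb z2 e0; goal_lra.
Qed.

End ExcursionGeometry.

(** * Removing a stretch of the path *)

Section GapIndependence.
Context {R : realType} {d : measure_display} {Omega : measurableType d}.
Variables (P : probability Omega R) (X : R -> Omega -> R).
Hypothesis levy : levy_process01 P X.
Hypothesis cd : CD P X.

Let mX t : 0 <= t <= 1 -> measurable_fun setT (X t).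
Proof. by case: levy => h _ _ _ _; exact: h. Qed.

(** Finitely many coordinates at a time, so that the dyadic times involved lie on a common grid. *)
Definition cylinders : set (set (nat -> R)) :=
  [set A | exists n (B : nat -> set R), (forall i, measurable (B i)) /\
     A = [set z | forall i, (i < n)%N -> B i (z i)]].

Lemma cylinders_setI : setI_closed cylinders.
Proof.
move=> _ _ [n [B [mB ->]]] [n' [B' [mB' ->]]].
exists (maxn n n'), (fun i => (if (i < n)%N then B i else setT) `&` (if (i < n')%N then B' i else setT)).
split; first by move=> i; apply: measurableI; case: ifP.
apply/seteqP; split => z /= => [[h h'] i _|h].
  by split; case: ifP => // lt; [exact: h|exact: h'].
split=> i ilt; have := h i; rewrite leq_max ilt ?orbT => /(_ isT) [h1 h2]; first exact: h1.
exact: h2.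
Qed.

Lemma measurable_cylindersE : @measurable _ (rseq R) = <<s cylinders >>.
Proof.
rewrite measurable_rseqE; apply/seteqP; split.
  apply: smallest_sub; first exact: smallest_sigma_algebra.
  move=> _ [B [mB ->]].
  rewrite (_ : [set y | _] = \bigcap_i [set z : nat -> R | forall j, (j < i.+1)%N -> B j (z j)]).
    apply: (@bigcapT_measurable _ (g_sigma_algebraType cylinders)) => i.
    by apply: sub_sigma_algebra; exists i.+1, B.
  apply/seteqP; split => z /= h; first by move=> i _ j _; exact: h.
  by move=> i; exact: (h i I i (ltnSn i)).
apply: smallest_sub; first exact: smallest_sigma_algebra.
move=> _ [n [B [mB ->]]]; apply: sub_sigma_algebra.
exists (fun i => if (i < n)%N then B i else setT); split; first by move=> i; case: ifP.
by apply/seteqP; split => z /= h i; have := h i; case: ifP => // _; exact.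
Qed.

Lemma psum_restrict_seq (J : pred nat) (z : nat -> R) (a b : nat) : (a <= b)%N ->
  (forall i, (a <= i < b)%N -> J i) ->
  psum (restrict_seq J z) b - psum (restrict_seq J z) a = psum z b - psum z a.
Proof.
elim: b => [|b IH]; first by rewrite leqn0 => /eqP ->; rewrite !psum0.
rewrite leq_eqVlt => /orP[/eqP -> //|]; first by rewrite !subrr.
rewrite ltnS => ab hJ; rewrite !psumS.
have := IH ab (fun i h => hJ i ltac:(lia)); rewrite /restrict_seq hJ; last by lia.
by move=> e; rewrite addrAC e addrAC.
Qed.

Lemma psum_restrict_seq0 (J : pred nat) (z : nat -> R) (a b : nat) : (a <= b)%N ->
  (forall i, (a <= i < b)%N -> ~~ J i) ->
  psum (restrict_seq J z) b = psum (restrict_seq J z) a.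
Proof.
elim: b => [|b IH]; first by rewrite leqn0 => /eqP ->.
rewrite leq_eqVlt => /orP[/eqP -> //|]; rewrite ltnS => ab hJ; rewrite psumS.
rewrite IH //; last by move=> i h; apply: hJ; lia.
by rewrite /restrict_seq (negbTE (hJ b _)) ?addr0 //; lia.
Qed.

Lemma grid_inj_le n i j : (i <= 2 ^ n)%N -> (j <= 2 ^ n)%N ->
  (grid n i <= grid n j :> R) = (i <= j)%N.
Proof.
by move=> iN jN; rewrite !gridE // ler_pM2r ?invr_gt0 ?pow2_gt0 // ler_nat.
Qed.

Lemma grid_scale n n' j : (n <= n')%N -> (j <= 2 ^ n)%N ->
  (j * 2 ^ (n' - n) <= 2 ^ n')%N /\ grid n' (j * 2 ^ (n' - n)) = grid n j :> R.
Proof.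
move=> nn' jN; have e : (2 ^ n' = 2 ^ n * 2 ^ (n' - n))%N by rewrite -expnD subnKC.
have le : (j * 2 ^ (n' - n) <= 2 ^ n')%N by rewrite e leq_mul2r jN orbT.
by split => //; rewrite !gridE // e !natrM -mulf_div divff ?mulr1 // pnatr_eq0 expn_eq0.
Qed.

(** An enumeration of the pairs of a level and an index, by which the values of a path at all dyadic
    times form one point of [rseq R]. *)
Definition dyadic_code (r : nat) : nat * nat := odflt (0, 0)%N (unpickle r).
Definition dyadic r : R := grid (dyadic_code r).1 (dyadic_code r).2.

Lemma dyadic_itv r : 0 <= dyadic r <= 1.
Proof. exact: grid_itv. Qed.

Lemma dyadicP n0 (q : R) : dyadic_from n0 q -> exists r, dyadic r = q.
Proof.
move=> /(_ n0 (leqnn _)) [j _ ->]; exists (pickle (n0, j)).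
by rewrite /dyadic /dyadic_code pickleK.
Qed.

Lemma dyadic_level r n : ((dyadic_code r).1 <= n)%N -> exists2 j, (j <= 2 ^ n)%N & dyadic r = grid n j.
Proof.
rewrite /dyadic; case: (dyadic_code r) => n0 i /= n0n.
have -> : grid n0 i = grid n0 (minn i (2 ^ n0)) :> R by rewrite /grid -minnA minnn.
by apply: (grid_dyadic _ n0n); exact: geq_minr.
Qed.

Variables n0 j0 : nat.
Hypothesis j0N : (j0 < 2 ^ n0)%N.

Let c : R := grid n0 j0.
Let c' : R := grid n0 j0.+1.

Let cc' : c < c'.
Proof. by rewrite ltNge grid_inj_le ?ltnn //; lia. Qed.

(** The path at dyadic times with the increment from [c] to [c'] forgotten: earlier values are
    relative to [c], later ones to [c']. *)
Definition gap_path w : rseq R := fun r =>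
  if dyadic r <= c then X (dyadic r) w - X c w
  else if c' <= dyadic r then X (dyadic r) w - X c' w else 0.

Let gap_incr w := X c' w - X c w.

Lemma measurable_gap_path : measurable_fun setT gap_path.
Proof.
apply: measurable_to_rseq => r; rewrite /gap_path.
have mr := mX (dyadic_itv r).
have mc : measurable_fun setT (X c) by apply: mX; exact: grid_itv.
have mc' : measurable_fun setT (X c') by apply: mX; exact: grid_itv.
case: (dyadic r <= c); first exact: measurable_funB.
by case: (c' <= dyadic r); [exact: measurable_funB|exact: measurable_cst].
Qed.

(** On a level fine enough for the times of a cylinder, [gap_path] is a function of the steps
    outside the gap and the increment is the sum of the steps inside. *)
Lemma indep_gap : indep_fun P gap_path gap_incr.
Proof.
have mgi : measurable_fun setT gap_incr.
  by apply: measurable_funB; apply: mX; exact: grid_itv.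
have mR : @measurable _ R = <<s @measurable _ R >>.
  by rewrite sigma_algebra_id //; exact: sigma_algebra_measurable.
apply: (indep_fun_pi measurable_gap_path mgi measurable_cylindersE cylinders_setI mR).
  by move=> A B; exact: measurableI.
move=> _ E [m [B [mB ->]]] mE.
pose n := maxn n0 (\max_(r < m) (dyadic_code r).1).
have n0n : (n0 <= n)%N by exact: leq_maxl.
have [icN ec] := grid_scale n0n (ltnW j0N).
have [icN' ec'] := grid_scale n0n j0N.
set ic := (j0 * 2 ^ (n - n0))%N in icN ec; set ic' := (j0.+1 * 2 ^ (n - n0))%N in icN' ec'.
have icc' : (ic <= ic')%N by rewrite leq_mul2r leqnSn orbT.
have /choice[i hi] : forall r, exists i, (r < m)%N -> (i <= 2 ^ n)%N /\ dyadic r = grid n i.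
  move=> r; have [rm|mr] := ltnP r m; last by exists 0%N.
  have [|i iN e] := @dyadic_level r n; last by exists i.
  apply: leq_trans (leq_maxr _ _).
  exact: (leq_bigmax (F := fun r : 'I_m => (dyadic_code r).1) (Ordinal rm)).
pose J := [pred i : nat | ~~ (ic <= i < ic')%N].
pose phi (t : rseq R) : rseq R := fun r => if (r < m)%N then
    (if dyadic r <= c then psum t (i r) - psum t ic
     else if c' <= dyadic r then psum t (i r) - psum t ic' else 0) else 0.
pose psi (t : rseq R) := psum t (2 ^ n).
have mphi : measurable_fun setT phi.
  apply: measurable_to_rseq => r; rewrite /phi.
  case: (r < m)%N; last exact: measurable_cst.
  case: (dyadic r <= c); first by apply: measurable_funB; exact: measurable_psum.
  case: (c' <= dyadic r); last exact: measurable_cst.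
  by apply: measurable_funB; exact: measurable_psum.
have ind := indep_fun_comp mphi (@measurable_psum R (2 ^ n)) (iid_indep (iid_increments levy cd n) J).
have e1 w r : (r < m)%N -> phi (restrict_seq J (increments X n w)) r = gap_path w r.
  move=> rm; rewrite /phi rm /gap_path; have [irN er] := hi r rm.
  rewrite er /c /c' -ec -ec' !grid_inj_le // -!(psum_increments levy n).
  case: ifP => [iric|_].
    apply: oppr_inj; rewrite !opprB psum_restrict_seq // => l hl; rewrite /J /=; lia.
  by case: ifP => // ic'r; rewrite psum_restrict_seq // => l hl; rewrite /J /=; lia.
have e2 w : psum (restrict_seq (predC J) (increments X n w)) (2 ^ n) = gap_incr w.
  have := @psum_restrict_seq (predC J) (increments X n w) ic ic' icc'.
  rewrite !(psum_increments levy) ec ec' -/c -/c' -/(gap_incr w) => <-; last by move=> l hl; rewrite /J /= negbK.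
  rewrite (@psum_restrict_seq0 (predC J) _ ic' (2 ^ n)) //; last first.
    by move=> l hl; rewrite /J /= negbK; lia.
  rewrite (@psum_restrict_seq0 (predC J) _ 0 ic) //; last first.
    by move=> l hl; rewrite /J /= negbK; lia.
  by rewrite psum0 subr0.
have mcyl : measurable ([set z | forall i, (i < m)%N -> B i (z i)] : set (rseq R)).
  by rewrite measurable_cylindersE; apply: sub_sigma_algebra; exists m, B.
have := ind _ _ mcyl mE.
have -> : (phi \o (fun w => restrict_seq J (increments X n w))) @^-1`
    [set z | forall i, (i < m)%N -> B i (z i)] =
   gap_path @^-1` [set z | forall i, (i < m)%N -> B i (z i)].
  by apply/seteqP; split => w /= h r rm; have := h r rm; rewrite e1.
by have -> : (fun z : rseq R => psum z (2 ^ n)) \o (fun w => restrict_seq (predC J) (increments X n w))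
  = gap_incr by apply/funext => w /=; exact: e2.
Qed.

End GapIndependence.

(** * No line below the path touches it three times *)

Section ThreeTouch.
Context {R : realType} {d : measure_display} {Omega : measurableType d}.
Variables (P : probability Omega R) (X : R -> Omega -> R).
Hypothesis levy : levy_process01 P X.
Hypothesis cd : CD P X.

Definition line_below (f : R -> R) (l m : R) := forall x, 0 <= x <= 1 -> l + m * x <= f x.

Lemma dense_touch f l m p x y e : cadlag01 f -> x < p < y -> 0 < e ->
  touch (fun x => f x - (l + m * x)) p ->
  exists r, x < dyadic r < y /\ f (dyadic r : R) <= l + m * dyadic r + e.
Proof.
move=> cf /andP[xp py] e0 tp.
have del0 : 0 < Num.min (p - x) (y - p) by rewrite lt_min !subr_gt0 xp.
have [n0 [q [q01 qp hq /dyadicP [r rq]]]] := touch_dyadic cf tp e0 del0.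
exists r; rewrite rq; move: qp; rewrite ltr_norml lt_min ltrNl lt_min.
by move=> /andP[/andP[h1 h2] /andP[h3 h4]]; split; lra.
Qed.

(* On the event that a line below the path touches it before c, between c' and x and after
   y, the increment X c' - X c is the cut defined by this condition on the path with the
   stretch from c to c' removed. *)
Definition gap_cut (c c' x y : R) (a : R) (z : nat -> R) := exists (m : rat) (r1 : nat),
  (c' <= dyadic r1 <= x) /\
  (forall r2, y <= dyadic r2 -> z r1 - ratr m * dyadic r1 < z r2 - ratr m * dyadic r2) /\
  (forall r, dyadic r <= c -> z r1 - ratr m * dyadic r1 + a < z r - ratr m * dyadic r).

Lemma measurable_gap_cut c c' x y a : measurable (gap_cut c c' x y a : set (rseq R)).
Proof.
apply: mset_ex => m; apply: mset_ex => r1; apply: mset_and; first exact: mset_cst.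
have mz r (b : R) : measurable_fun setT (fun z : rseq R => z r - b).
  by apply: measurable_funB; [exact: measurable_coord|exact: measurable_cst].
apply: mset_and; apply: mset_all => r; apply: mset_imp; try exact: mset_cst.
  by apply: mset_lt; exact: mz.
by apply: mset_lt; [apply: measurable_funD; [exact: mz|exact: measurable_cst]|exact: mz].
Qed.

(** A rational slope [k] slightly below [m] brings the tilted contact near [p2] strictly below the
    tilted path after [y]. As [m - k] is less than half of the slack between [a] and the increment,
    the condition before [c] survives the tilt. *)
Lemma cut_imp (f : R -> R) l m p2 c c' x y a : cadlag01 f -> line_below f l m ->
  c < c' -> c' < p2 < x -> x < y -> a < f c' - f c ->
  touch (fun x => f x - (l + m * x)) p2 ->
  exists (k : rat) (r1 : nat), (c' <= dyadic r1 <= x) /\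
  (forall r2, y <= dyadic r2 -> f (dyadic r1) - ratr k * dyadic r1 < f (dyadic r2) - ratr k * dyadic r2) /\
  (forall r, dyadic r <= c ->
     f (dyadic r1) - ratr k * dyadic r1 + (a - (f c' - f c)) < f (dyadic r) - ratr k * dyadic r).
Proof.
move=> cf Lf cc' p2x xy aD t2; set D := f c' - f c in aD *.
have Da : 0 < D - a by rewrite subr_gt0.
have [k] := rat_in_itvoo (ltac:(lra) : m - (D - a) / 2 < m); rewrite in_itv /= => /andP[k1 k2].
have mk0 : 0 < m - ratr k by rewrite subr_gt0.
have yx0 : 0 < y - x by rewrite subr_gt0.
pose e := Num.min ((D - a) / 4) ((m - ratr k) * (y - x) / 2).
have e0 : 0 < e by rewrite lt_min !divr_gt0 // mulr_gt0.
have [e1 e2] : e <= (D - a) / 4 /\ e <= (m - ratr k) * (y - x) / 2.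
  by split; rewrite /e ge_min lexx ?orbT.
have [r1 [/andP[r1c r1x] hr1]] := dense_touch cf p2x e0 t2.
exists k, r1; split; [by rewrite !ltW|split => r hr].
  have := Lf _ (dyadic_itv r).
  have : (m - ratr k) * (y - x) <= (m - ratr k) * (dyadic r - dyadic r1).
    by rewrite ler_pM2l //; lra.
  have : 0 < (m - ratr k) * (y - x) by rewrite mulr_gt0.
  by lra.
have := Lf _ (dyadic_itv r).
have /andP[s0 _] := @dyadic_itv R r; have /andP[_ s1] := @dyadic_itv R r1.
have : (m - ratr k) * (dyadic r1 - dyadic r) <= (m - ratr k) * 1.
  by rewrite ler_pM2l //; lra.
by lra.
Qed.

(** The contact at [p3] excludes slopes above [m]; with a slope at most [m], the contact at [p1]
    leaves no room for an [a] above the increment. *)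
Lemma imp_cut (f : R -> R) l m p1 p3 c c' x y a k r1 : cadlag01 f -> line_below f l m ->
  p1 < c -> c < c' -> x < y -> y < p3 -> 
  touch (fun x => f x - (l + m * x)) p1 -> touch (fun x => f x - (l + m * x)) p3 ->
  (c' <= dyadic r1 <= x) ->
  (forall r2, y <= dyadic r2 -> f (dyadic r1) - k * dyadic r1 < f (dyadic r2) - k * dyadic r2) ->
  (forall r, dyadic r <= c ->
     f (dyadic r1) - k * dyadic r1 + (a - (f c' - f c)) < f (dyadic r) - k * dyadic r) ->
  a <= f c' - f c.
Proof.
move=> cf Lf p1c cc' xy yp3 t1 t3 r1x h2 h1; set D := f c' - f c in h1 *.
have L1 := Lf _ (dyadic_itv r1).
have yx0 : 0 < y - x by rewrite subr_gt0.
have mk : 0 <= m - k.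
  rewrite leNgt; apply/negP => mk0.
  have e0 : 0 < (k - m) * (y - x) by rewrite mulr_gt0 //; lra.
  have p3y : y < p3 < p3 + 1 by lra.
  have [r2 [/andP[yr2 _] hr2]] := dense_touch cf p3y e0 t3.
  have := h2 r2 (ltW yr2).
  have : (k - m) * (y - x) <= (k - m) * (dyadic r2 - dyadic r1).
    by rewrite ler_pM2l; lra.
  by lra.
rewrite leNgt; apply/negP => Da.
have e0 : 0 < a - D by rewrite subr_gt0.
have p1y : p1 - 1 < p1 < c by lra.
have [r [/andP[_ rc] hr]] := dense_touch cf p1y e0 t1.
have := h1 r (ltW rc).
have : 0 <= (m - k) * (dyadic r1 - dyadic r) by rewrite mulr_ge0 //; lra.
by lra.
Qed.

Lemma gap_pathE n j r w (c := grid n j : R) (c' := grid n j.+1) : (j < 2 ^ n)%N ->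
  (dyadic r <= c -> gap_path X n j w r = X (dyadic r) w - X c w) /\
  (c' <= dyadic r -> gap_path X n j w r = X (dyadic r) w - X c' w).
Proof.
move=> jN; have cc' : c < c' by rewrite ltNge grid_inj_le ?ltnn //; lia.
rewrite /gap_path -/c -/c'; split => [->//|c'r].
by rewrite c'r leNgt (lt_le_trans cc' c'r).
Qed.

Lemma no_three_touch_ae : {ae P, forall w, ~ three_touch_line (X ^~ w)}.
Proof.
have [_ _ Xc _ _] := levy.
pose good n j q q' w := forall l m p1 p2 p3 : R, p1 < grid n j -> grid n j.+1 < p2 < grid n q ->
  (grid n q : R) < grid n q' -> grid n q' < p3 -> line_below (X ^~ w) l m ->
  touch (fun x => X x w - (l + m * x)) p1 -> touch (fun x => X x w - (l + m * x)) p2 ->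
  touch (fun x => X x w - (l + m * x)) p3 -> (j < 2 ^ n)%N -> False.
have all_good : {ae P, forall w, forall n j q q', good n j q q' w}.
  apply: ae_foralln => n; apply: ae_foralln => j; apply: ae_foralln => q; apply: ae_foralln => q'.
  have [jN|jN] := ltnP j (2 ^ n); last by apply: aeW => w l m p1 p2 p3 _ _ _ _ _ _ _ _ h; move: jN; rewrite leqNgt h.
  pose c := grid n j : R; pose c' := grid n j.+1 : R.
  have cc' : c < c' by rewrite ltNge grid_inj_le ?ltnn //; lia.
  have D0 x : pr P ((fun w => X c' w - X c w) @^-1` [set x]) = 0.
    exact: (iid_atomless (iid_increments levy cd n) x jN).
  have mgap := measurable_gap_path levy n j.
  have mD : measurable_fun setT (fun w => X c' w - X c w).
    by case: levy => h _ _ _ _; apply: measurable_funB; apply: h; exact: grid_itv.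
  have := indep_rational_cut mgap mD (indep_gap levy cd jN) D0
    (fun a => measurable_gap_cut c c' (grid n q) (grid n q') (ratr a)).
  apply: negligibleS => w /= /existsNP [l /existsNP [m /existsNP [p1 /existsNP [p2 /existsNP [p3]]]]].
  move=> /not_implyP [p1c /not_implyP [p2x /not_implyP [xy /not_implyP [yp3 /not_implyP [Lf]]]]].
  move=> /not_implyP [t1 /not_implyP [t2 /not_implyP [t3 _]]] a.
  have gE r := gap_pathE r w jN.
  split=> [aD|].
    have [k [r1 [r1x [h2 h1]]]] := cut_imp (Xc w) Lf cc' p2x xy aD t2.
    exists k, r1; split => //; split => [r2 yr2|r rc].
      have := h2 r2 yr2; rewrite (proj2 (gE r1)); last by case/andP: r1x.
      rewrite (proj2 (gE r2)); [by rewrite -/c'; lra|].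
      by move: r1x p2x; rewrite -/c'; lra.
    have := h1 r rc; rewrite (proj2 (gE r1)); last by case/andP: r1x.
    by rewrite (proj1 (gE r)) // -/c -/c'; lra.
  move=> [k [r1 [r1x [h2 h1]]]].
  apply: (imp_cut (k := ratr k) (r1 := r1) (Xc w) Lf p1c cc' xy yp3 t1 t3 r1x) => [r2 yr2|r rc].
    have := h2 r2 yr2; rewrite (proj2 (gE r1)); last by case/andP: r1x.
    rewrite (proj2 (gE r2)); [by rewrite -/c'; lra|].
    by move: r1x p2x; rewrite -/c'; lra.
  have := h1 r rc; rewrite (proj2 (gE r1)); last by case/andP: r1x.
  by rewrite (proj1 (gE r)) // -/c -/c'; lra.
apply: filterS all_good => w hw [l [m [p1 [p2 [p3 [[p10 [p12 [p23 p31]]] Lf t1 t2 t3]]]]]].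
have p11 : p1 < 1 by lra.
(* Two dyadic points between [p1] and [p2] leave room for a grid cell of the common level; the two
   between [p2] and [p3] become the bounds [x] and [y] of [gap_cut]. *)
have [n1 [x1 [hx1 dx1]]] := dyadic_between p10 p12 ltac:(lra).
have [n2 [x2 [hx2 dx2]]] := @dyadic_between R x1 p2 ltac:(lra) ltac:(lra) ltac:(lra).
have [n3 [x3 [hx3 dx3]]] := @dyadic_between R p2 p3 ltac:(lra) p23 p31.
have [n4 [x4 [hx4 dx4]]] := @dyadic_between R x3 p3 ltac:(lra) ltac:(lra) p31.
pose n := maxn (maxn n1 n2) (maxn n3 n4).
have [nn1 nn2 nn3 nn4] : [/\ n1 <= n, n2 <= n, n3 <= n & n4 <= n]%N.
  by rewrite /n !leq_max !leqnn ?orbT.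
have [j1 j1N e1] := dx1 n nn1; have [j2 j2N e2] := dx2 n nn2.
have [j3 j3N e3] := dx3 n nn3; have [j4 j4N e4] := dx4 n nn4.
have j12 : (j1 < j2)%N.
  by rewrite ltnNge -(grid_inj_le (R := R) j2N j1N) -e1 -e2 -ltNge; case/andP: hx2.
have j1S : (grid n j1.+1 : R) <= x2 by rewrite e2; exact: grid_le.
apply: (hw n j1 j3 j4 l m p1 p2 p3) => //; rewrite -?e1 -?e3 -?e4; try lra.
exact: leq_trans j12 j2N.
Qed.

End ThreeTouch.

(** * Almost sure properties of the sampled path *)

Section AlmostSureFacts.
Context {R : realType} {d : measure_display} {Omega : measurableType d}.
Variable P : probability Omega R.

(** The tail intersections increase to the event, and each lies in some [E k] of probability at most
    [e]. *)
Lemma pr_liminf_le (E : nat -> set Omega) e : (forall k, measurable (E k)) ->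
  (forall k0, exists2 k, (k0 <= k)%N & pr P (E k) <= e) ->
  pr P [set w | exists k0, forall k, (k0 <= k)%N -> E k w] <= e.
Proof.
move=> mE hE; pose H k0 := [set w | forall k, (k0 <= k)%N -> E k w].
have mH k0 : measurable (H k0).
  by apply: mset_all => k; apply: mset_imp; [exact: mset_cst|exact: mE].
have mU : measurable (\bigcup_n H n) by exact: bigcup_measurable.
have -> : [set w | exists k0, forall k, (k0 <= k)%N -> E k w] = \bigcup_n H n.
  by apply/seteqP; split => w [k0]; [exists k0|move=> _; exists k0].
have nd : nondecreasing_seq H.
  by move=> m n mn; apply/subsetPset => w h k nk; apply: h; exact: leq_trans nk.
have cH : (fun k => (pr P (H k))%:E) @ \oo --> (pr P (\bigcup_n H n))%:E.
  rewrite -prE // (_ : (fun k => _) = P \o H); last by apply/funext => k /=; rewrite prE.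
  exact: nondecreasing_cvg_mu.
rewrite leNgt; apply/negP => lt.
move: cH => /fine_cvgP [_] /cvgr_gt /(_ e lt) [k0 _ hk0].
have := hk0 k0 (leqnn _) => /=; have [k k0k hk] := hE k0.
rewrite ltNge => /negP; apply; apply: le_trans hk.
by apply: pr_le => // w h; exact: h.
Qed.

Variables (X : R -> Omega -> R) (U : Omega -> R).
Hypothesis levy : levy_process01 P X.
Hypothesis cd : CD P X.

Let mX t : 0 <= t <= 1 -> measurable_fun setT (X t).
Proof. by case: levy => h _ _ _ _; exact: h. Qed.

(** By stationarity the increment from [1 - s] to 1 has the law of the process at [s], which tends
    to 0 in probability by right continuity at 0; the left limit, which exists, must agree with the
    value. *)
Lemma left_continuous_at1_ae : {ae P, forall w, X 1 w = left_lim (X ^~ w) 1}.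
Proof.
have [_ X0 Xc _ sta] := levy.
have i2 k : 0 < ((2 ^ k)%:R : R)^-1 <= 1.
  by rewrite invr_gt0 pow2_gt0 invf_le1 ?pow2_gt0 // ler1n expn_gt0.
pose s k : R := ((2 ^ k)%:R)^-1.
have s01 k : 0 <= s k <= 1 by have := i2 k; rewrite /s; lra.
have t01 k : 0 <= 1 - s k <= 1 by have := i2 k; rewrite /s; lra.
pose B m := [set x : R | m.+1%:R^-1 <= `|x|].
have mB m : measurable (B m).
  by apply: mset_le; [exact: measurable_cst|exact: normr_measurable].
pose E m k := [set w | B m (X 1 w - X (1 - s k) w)].
have m1 : measurable_fun setT (X 1) by apply: mX; rewrite ler01 lexx.
have mE m k : measurable (E m k).
  by apply: (@measurable_preimage _ _ _ _ (fun w => X 1 w - X (1 - s k) w)) => //; apply: measurable_funB => //; exact: mX.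
have E0 m e : 0 < e -> forall k0, exists2 k, (k0 <= k)%N & pr P (E m k) <= e.
  move=> e0; have eE k : pr P (E m k) = pr P [set w | B m (X (s k) w)].
    rewrite /pr /E; congr fine; have := sta (1 - s k) (s k) (B m).
    rewrite subrK; apply => //; first by have := t01 k; lra.
    by have := s01 k; lra.
  have [|||k1 hk1] := @pr_inf_often _ _ _ P (fun k => [set w | B m (X (s k) w)]) _ _ e.
  - by move=> k; apply: (measurable_preimage (mX (s01 k))).
  - apply: aeW => w; have m0 : 0 < m.+1%:R^-1 :> R by rewrite invr_gt0.
    have [del del0 hdel] := @cadlag_right _ _ 0 _ (Xc w) ltac:(lra) m0.
    have [k2 hk2] := pow2_small del0; exists k2 => k kk2; rewrite /B /= => h.
    have := hdel (s k); rewrite X0 subr0 add0r => H.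
    have {}H := H ltac:(rewrite /s; have := i2 k; have := hk2 k kk2; lra).
    by move: H; rewrite ltNge h.
  - exact: e0.
  move=> k0; exists (maxn k0 k1); first exact: leq_maxl.
  by rewrite eE ltW // hk1 // leq_maxr.
have null m : {ae P, forall w, ~ exists k0, forall k, (k0 <= k)%N -> E m k w}.
  have mm : measurable [set w | exists k0, forall k, (k0 <= k)%N -> E m k w].
    by apply: mset_ex => k0; apply: mset_all => k; apply: mset_imp; [exact: mset_cst|exact: mE].
  apply: negligibleS (pr0_negligible mm _) => [w /= /contrapT //|].
  apply/eqP; rewrite eq_le pr_ge0 andbT; apply/ler_addgt0Pl => e e0; rewrite addr0.
  by apply: pr_liminf_le => //; exact: E0.
apply: filterS (ae_foralln null) => w hw; apply: contrapT => ne.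
have D0 : 0 < `|X 1 w - left_lim (X ^~ w) 1| by rewrite normr_gt0 subr_eq0; apply/eqP.
set D := `|_| in D0; have D20 : 0 < D / 2 by rewrite divr_gt0.
have [del del0 hdel] := @cadlag_left _ _ 1 _ (Xc w) ltac:(lra) D20.
have [m hm] : exists m, (m.+1%:R)^-1 <= D / 2.
  exists (2 ^ 0 + Num.truncn (D / 2)^-1)%N; have i0 : 0 < (D / 2)^-1 by rewrite invr_gt0.
  rewrite -[leRHS]invrK lef_pV2 ?posrE // ltW //.
  have /andP[_ /lt_le_trans] := truncn_itv (ltW i0); apply; rewrite ler_nat; lia.
apply: (hw m); have [k0 hk0] := pow2_small del0; exists k0 => k kk0.
rewrite /E /B /=; have sk := hk0 k kk0; have ik := i2 k.
have := hdel (1 - s k) ltac:(rewrite /s; lra) => h.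
apply: le_trans hm _; rewrite -subr_ge0.
have -> : X 1 w - X (1 - s k) w = (X 1 w - left_lim (X ^~ w) 1) - (X (1 - s k) w - left_lim (X ^~ w) 1) by ring.
have := lerB_dist (X 1 w - left_lim (X ^~ w) 1) (X (1 - s k) w - left_lim (X ^~ w) 1).
by rewrite -/D; lra.
Qed.

Hypothesis unif : uniform01 P U.
Hypothesis indU : indep_of_process P U X.

Let face_n n w g i k := face_at (2 ^ n) (increments X n w) (uindex U n w) g i k.

Lemma straddling_face_ae : {ae P, forall w, forall n, exists g i k, face_n n w g i k}.
Proof.
apply: ae_foralln => n.
apply: (face_at_ae (iid_increments levy cd n)) => [|j|w|j A].
- by rewrite expn_gt0.
- exact: (measurable_uindex unif).
- exact: uindex_lt.
- exact: (uindex_indep levy unif indU).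
Qed.

Lemma face_n_law n (Q : nat -> set (rseq R)) : (forall k, measurable (Q k)) ->
  pr P [set w | exists g i k, face_n n w g i k /\ Q k (increments X n w \o exc_perm g i k)] =
  pr P [set w | Q (uindex U n w).+1 (increments X n w)].
Proof.
apply: (discrete_law (iid_increments levy cd n)) => [|j|w|j A].
- by rewrite expn_gt0.
- exact: (measurable_uindex unif).
- exact: uindex_lt.
- exact: (uindex_indep levy unif indU).
Qed.

Lemma measurable_face_n n (Q : nat -> nat -> nat -> set (rseq R)) :
  (forall g i k, measurable (Q g i k)) ->
  measurable [set w | exists g i k, face_n n w g i k /\ Q g i k (increments X n w \o exc_perm g i k)].
Proof.
move=> mQ; apply: (measurable_face_event (iid_increments levy cd n)) => // j.
exact: (measurable_uindex unif).
Qed.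

(** In [pr_near_vertex] the cut-off length [2 ^ (n - M)] and the margin [2 ^ (n - (M + M))] give the
    bound [3 / 2 ^ M], uniformly in [n]. Failure at all large levels, for every [M], is therefore
    null. *)
Lemma wide_face_ae : {ae P, forall w, exists M, forall n0, exists n,
  [/\ (n0 <= n)%N, (M + M <= n)%N & forall g i k, face_n n w g i k ->
      (2 ^ (n - (M + M)) <= i)%N /\ (2 ^ (n - (M + M)) <= k - i)%N]}.
Proof.
pose bad M n := [set w | exists g i k, face_n n w g i k /\
  ((i < 2 ^ (n - (M + M)))%N || (k - i <= 2 ^ (n - (M + M)))%N)].
have mbad M n : measurable (bad M n).
  by apply: (@measurable_face_n n (fun g i k => [set _ |
    (i < 2 ^ (n - (M + M)))%N || (k - i <= 2 ^ (n - (M + M)))%N])) => g i k; exact: mset_cst.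
have pbad M n : (M + M <= n)%N -> pr P (bad M n) <= 3%:R / (2 ^ M)%:R.
  move=> MMn.
  have N0 : (0 < 2 ^ n)%N by rewrite expn_gt0.
  have K0 : (0 < 2 ^ (n - M))%N by rewrite expn_gt0.
  apply: le_trans (pr_near_vertex (iid_increments levy cd n) N0 (measurable_uindex unif n)
    (@uindex_indep _ _ _ P X levy U unif indU n) (2 ^ (n - (M + M))) K0) _.
  have e1 : (2 ^ n = 2 ^ M * 2 ^ (n - M))%N by rewrite -expnD; congr (2 ^ _)%N; lia.
  have e2 : (2 ^ (n - M) = 2 ^ M * 2 ^ (n - (M + M)))%N by rewrite -expnD; congr (2 ^ _)%N; lia.
  have p1 := pow2_gt0 (R := R) M; have p2 := pow2_gt0 (R := R) (n - M).
  have p3 := pow2_gt0 (R := R) (n - (M + M)).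
  rewrite [in X in _ / X + _]e1 [in X in _ + _ / X]e2 !natrM.
  by rewrite le_eqVlt; apply/orP; left; apply/eqP; field; rewrite !gt_eqF.
pose B M := [set w | exists n0, forall n, (n0 <= n)%N -> ((M + M <= n)%N -> bad M n w)].
have mB M : measurable (B M).
  apply: mset_ex => n0; apply: mset_all => n; apply: mset_imp; first exact: mset_cst.
  by apply: mset_imp; [exact: mset_cst|exact: mbad].
have pB M : pr P (B M) <= 3%:R / (2 ^ M)%:R.
  apply: (@pr_liminf_le (fun n => [set w | (M + M <= n)%N -> bad M n w])) => [n|n0].
    by apply: mset_imp; [exact: mset_cst|exact: mbad].
  exists (maxn n0 (M + M)); first exact: leq_maxl.
  rewrite (_ : [set w | _] = bad M (maxn n0 (M + M))); first by apply: pbad; exact: leq_maxr.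
  by apply/seteqP; split => w /= => [|h _ //]; apply; exact: leq_maxr.
have mI : measurable [set w | forall M, B M w] by exact: mset_all.
apply: negligibleS (pr0_negligible mI _) => [w /= /forallNP nw M|].
  have /existsNP [n0 /forallNP hn0] := nw M; exists n0 => n n0n MMn.
  apply: contrapT => nb; apply: (hn0 n); split => // g i k f; apply: contrapT => h; apply: nb.
  exists g, i, k; split => //; apply: contrapT => /negP; rewrite negb_or -leqNgt -ltnNge => /andP[h1 h2].
  by apply: h; split => //; exact: ltnW.
apply/eqP; rewrite eq_le pr_ge0 andbT; apply/ler_addgt0Pl => e e0; rewrite addr0.
have e30 : 0 < e / 3 by rewrite divr_gt0.
have [M hM] := pow2_small e30; have := hM M (leqnn _) => {}hM.
apply: (@le_trans _ _ (pr P (B M))); first by apply: pr_le => // w; exact.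
by apply: le_trans (pB M) _; move: hM; set z := (_^-1); lra.
Qed.

End AlmostSureFacts.

(** * Passing to the limit in the transform *)

Section TransformLimit.
Context {R : realType}.

Definition real_transform (f : R -> R) (a b v x : R) : R :=
  if x < b - v then f (v + x) - f v
  else if x < b - a then f b - f a + f (a + (x - (b - v))) - f v
  else if x < b then f b - f a + f (x - (b - a))
  else f x.

Lemma walk_transform_grid (f : R -> R) n g i k j : (i < k)%N -> (g + k <= 2 ^ n)%N ->
  (j <= 2 ^ n)%N ->
  walk_transform (fun l => f (grid n l)) g i k j =
  real_transform f (grid n g) (grid n (g + k)) (grid n (g + i)) (grid n j).
Proof.
move=> ik gN jN; rewrite /walk_transform /real_transform.
have N0 := pow2_gt0 (R := R) n.
have giN : (g + i <= 2 ^ n)%N by lia.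
have gN' : (g <= 2 ^ n)%N by lia.
have e1 : grid n (g + k) - grid n (g + i) = (k - i)%:R / (2 ^ n)%:R :> R.
  by rewrite !gridE // -mulrBl !natrD natrB ?(ltnW ik) //; congr (_ / _); ring.
have e2 : grid n (g + k) - grid n g = k%:R / (2 ^ n)%:R :> R.
  by rewrite !gridE // -mulrBl natrD; congr (_ / _); ring.
have c1 : (grid n j < grid n (g + k) - grid n (g + i) :> R) = (j < k - i)%N.
  by rewrite e1 gridE // ltr_pM2r ?invr_gt0 // ltr_nat.
have c2 : (grid n j < grid n (g + k) - grid n g :> R) = (j < k)%N.
  by rewrite e2 gridE // ltr_pM2r ?invr_gt0 // ltr_nat.
have c3 : (grid n j < grid n (g + k) :> R) = (j < k + g)%N.
  by rewrite !gridE // ltr_pM2r ?invr_gt0 // ltr_nat addnC.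
rewrite c1 c2 c3; case: ltnP => h1.
  have -> // : grid n (g + i + j) = grid n (g + i) + grid n j :> R.
  by rewrite !gridE //; [rewrite natrD mulrDl|lia].
case: ltnP => h2.
  have -> // : grid n (g + (j - (k - i))) = grid n g + (grid n j - (grid n (g + k) - grid n (g + i))) :> R.
  by rewrite e1 !gridE //; [rewrite -mulrBl -mulrDl natrD natrB|lia].
case: ltnP => h3 //.
have -> // : grid n (j - k) = grid n j - (grid n (g + k) - grid n g) :> R.
by rewrite e2 !gridE //; [rewrite -mulrBl natrB|lia].
Qed.

Definition eventually_seq (Q : nat -> Prop) := exists n0, forall n, (n0 <= n)%N -> Q n.

Lemma eventually_and Q1 Q2 : eventually_seq Q1 -> eventually_seq Q2 ->
  eventually_seq (fun n => Q1 n /\ Q2 n).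
Proof.
move=> [n1 h1] [n2 h2]; exists (maxn n1 n2) => n.
by rewrite geq_max => /andP[nn1 nn2]; split; [exact: h1|exact: h2].
Qed.

Lemma eventually_imp (Q1 Q2 : nat -> Prop) : (forall n, Q1 n -> Q2 n) ->
  eventually_seq Q1 -> eventually_seq Q2.
Proof. by move=> h [n0 hn]; exists n0 => n /hn; exact: h. Qed.

Lemma four_lt (r y : R) : 0 < y -> r <= y / 5 -> 4 * r < y.
Proof. by lra. Qed.

Section TransformArithmetic.
Variables (A B u t x a b v r : R).
Hypotheses (aA : `|a - A| < r) (bB : `|b - B| < r) (vu : u <= v < u + r).

Lemma first_piece_arith : 4 * r < B - u - t - (x - t) ->
  (x < b - v) = true /\ `|v + x - (u + t + (x - t))| < 4 * r.
Proof. by move: bB vu; rewrite !ltr_norml => h1 h2 h3; split; lra. Qed.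

Lemma second_piece_arith : B - u <= t -> 4 * r < x - t -> 4 * r < B - A - t - (x - t) ->
  [/\ (x < b - v) = false, (x < b - a) = true &
    `|a + (x - (b - v)) - (A + t - (B - u) + (x - t))| < 4 * r].
Proof.
move: aA bB vu; rewrite !ltr_norml => h1 h2 h3 h4 h5 h6.
by split; try (apply/negbTE; rewrite -leNgt); lra.
Qed.

Lemma third_piece_arith : A < u -> B - A < t -> 4 * r < x - t -> 4 * r < B - t - (x - t) ->
  [/\ (x < b - v) = false, (x < b - a) = false, (x < b) = true &
    `|x - (b - a) - (t - (B - A) + (x - t))| < 4 * r].
Proof.
move: aA bB vu; rewrite !ltr_norml => h1 h2 h3 h4 h5 h6 h7.
by split; try (apply/negbTE; rewrite -leNgt); lra.
Qed.

Lemma last_piece_arith : 0 <= A -> A < u -> B <= t -> 4 * r < x - t ->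
  [/\ (x < b - v) = false, (x < b - a) = false, (x < b) = false &
    `|x - (t + (x - t))| < 4 * r].
Proof.
move: aA bB vu; rewrite !ltr_norml => h1 h2 h3 h4 h5 h6 h7.
by split; try (apply/negbTE; rewrite -leNgt); lra.
Qed.

End TransformArithmetic.

Lemma close_sub2 (x y x' y' e : R) : `|x - x'| < e / 4 -> `|y - y'| < e / 4 ->
  `|x - y - (x' - y')| < e.
Proof. by rewrite !ltr_norml; lra. Qed.

Lemma close_sub3 (x y z x' y' z' e : R) : `|x - x'| < e / 4 -> `|y - y'| < e / 4 ->
  `|z - z'| < e / 4 -> `|x - y + z - (x' - y' + z')| < e.
Proof. by rewrite !ltr_norml; lra. Qed.

Lemma close_sub4 (x y z v x' y' z' v' e : R) : `|x - x'| < e / 4 -> `|y - y'| < e / 4 ->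
  `|z - z'| < e / 4 -> `|v - v'| < e / 4 -> `|x - y + z - v - (x' - y' + z' - v')| < e.
Proof. by rewrite !ltr_norml; lra. Qed.

Variables (f : R -> R) (a b v : nat -> R) (A B u cA cB : R).
Hypotheses (cf : cadlag01 f) (A0 : 0 <= A) (Au : A < u) (uB : u < B) (B1 : B <= 1).
Hypothesis abc : forall e, 0 < e -> eventually_seq (fun n =>
  [/\ `|a n - A| < e, `|b n - B| < e, `|f (a n) - cA| < e & `|f (b n) - cB| < e]).
Hypothesis vu : forall e, 0 < e -> eventually_seq (fun n => u <= v n < u + e).

Definition limit_transform (t : R) : R :=
  if t < B - u then f (u + t) - f u
  else if t <= B - A then cB - cA + f (A + t - (B - u)) - f u
  else if t < B then cB - cA + f (t - (B - A))
  else f t.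

Let ev_all e : 0 < e -> eventually_seq (fun n =>
  [/\ `|a n - A| < e, `|b n - B| < e & u <= v n < u + e] /\
  [/\ `|f (a n) - cA| < e, `|f (b n) - cB| < e & `|f (v n) - f u| < e]).
Proof.
move=> e0; have u01 : 0 <= u < 1 by move: A0 Au uB B1; lra.
have [del del0 hdel] := cadlag_right cf u01 e0.
apply: eventually_imp (eventually_and (abc e0) (eventually_and (vu e0) (vu del0))).
by move=> n [[h1 h2 h3 h4] [h5 h6]]; split; split => //; exact: hdel.
Qed.

(* The times x tend to t strictly from the right, so that only right continuity matters
   although the vertices a n, b n approach A, B from either side. *)
Let near_right p e : 0 <= p < 1 -> 0 < e -> exists2 del, 0 < del &
  forall y, 0 < y < del -> exists2 r, 0 < r & forall x, `|x - (p + y)| < r -> `|f x - f p| < e.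
Proof.
move=> p01 e0; have [del del0 hdel] := cadlag_right cf p01 e0.
exists del => // y /andP[y0 yd]; exists (Num.min y (del - y)).
  by rewrite lt_min y0 subr_gt0.
move=> x; rewrite ltr_norml lt_min ltrNl lt_min => /andP[/andP[h1 h2] /andP[h3 h4]].
by apply: hdel; lra.
Qed.

Ltac goal_lra := clear - cf A0 Au uB B1 abc vu ev_all near_right; intros; lra.

Lemma real_transform_limit t e : 0 <= t < 1 -> t != B - A -> 0 < e ->
  exists2 del, 0 < del & forall x, t < x < t + del ->
    eventually_seq (fun n => `|real_transform f (a n) (b n) (v n) x - limit_transform t| < e).
Proof.
move=> t01 tBA e0; have e40 : 0 < e / 4 by rewrite divr_gt0.
(* [p] is the time at which [f] is read in the branch that contains [t], and [m] is the room before
   the next breakpoint, or 1 in the last branch. For [x = t + y] the vertices need an accuracy [r]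
   small against both [y] and [m - y]. *)
have key p (m : R) : 0 <= p < 1 -> 0 < m ->
   (exists2 del, 0 < del & forall y, 0 < y < del ->
     y < m /\ exists2 r, 0 < r & eventually_seq (fun n =>
     ([/\ `|a n - A| < r, `|b n - B| < r & u <= v n < u + r] /\
     [/\ `|f (a n) - cA| < e / 4, `|f (b n) - cB| < e / 4 & `|f (v n) - f u| < e / 4]) /\
     4 * r < y /\ 4 * r < m - y /\
     forall x, `|x - (p + y)| < 4 * r -> `|f x - f p| < e / 4)).
  move=> p01 m0; have [del del0 hdel] := near_right p01 e40.
  exists (Num.min del m); first by rewrite lt_min del0.
  move=> y; rewrite lt_min => /andP[y0 /andP[yd ym]]; split => //.
  have ydel : 0 < y < del by rewrite y0.
  have [r r0 hr] := hdel y ydel.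
  pose r' := Num.min (Num.min (r / 4) (e / 4)) (Num.min (y / 5) ((m - y) / 5)).
  have [r1 r2 r3 r4] : [/\ r' <= r / 4, r' <= e / 4, r' <= y / 5 & r' <= (m - y) / 5].
    by split; rewrite /r' !ge_min lexx ?orbT.
  have r'0 : 0 < r' by rewrite /r' !lt_min !divr_gt0 // subr_gt0.
  exists r' => //; apply: eventually_imp (ev_all r'0) => n [h [h1 h2 h3]].
  split; first by split => //; split; [exact: lt_le_trans h1 r2|exact: lt_le_trans h2 r2|exact: lt_le_trans h3 r2].
  split; first exact: four_lt r3.
  split; first by apply: four_lt r4; rewrite subr_gt0.
  move=> x hx; apply: hr; apply: lt_le_trans hx _.
  by rewrite mulrC -ler_pdivlMr.
have xt0 x del : t < x < t + del -> 0 < x - t < del by rewrite subr_gt0 ltrBlDl.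
rewrite /limit_transform; case: ltP => [tBu|Btu].
  have [||del del0 H] := key (u + t) (B - u - t); try by move: t01 tBu A0 Au uB B1; goal_lra.
  exists del => // x /xt0 xt; have [ym [r r0 ev]] := H _ xt.
  apply: eventually_imp ev => n [[[h1 h2 h3] [h4 h5 h6]] [yr [mr hx]]].
  have [c1 cl] := first_piece_arith h2 h3 mr.
  by rewrite /real_transform c1; exact: close_sub2 (hx _ cl) h6.
case: (leP t (B - A)) => [tBAle|BAt].
  have {}tBA : t < B - A by rewrite lt_neqAle tBA.
  have [||del del0 H] := key (A + t - (B - u)) (B - A - t); try by move: tBA Btu A0 Au uB B1; goal_lra.
  exists del => // x /xt0 xt; have [ym [r r0 ev]] := H _ xt.
  apply: eventually_imp ev => n [[[h1 h2 h3] [h4 h5 h6]] [yr [mr hx]]].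
  have [c1 c2 cl] := second_piece_arith h1 h2 h3 Btu yr mr.
  by rewrite /real_transform c1 c2; exact: close_sub4 h5 h4 (hx _ cl) h6.
case: ltP => [tB|Bt].
  have [||del del0 H] := key (t - (B - A)) (B - t); try by move: tB BAt A0 Au uB B1; goal_lra.
  exists del => // x /xt0 xt; have [ym [r r0 ev]] := H _ xt.
  apply: eventually_imp ev => n [[[h1 h2 h3] [h4 h5 h6]] [yr [mr hx]]].
  have [c1 c2 c3 cl] := third_piece_arith h1 h2 h3 Au BAt yr mr.
  by rewrite /real_transform c1 c2 c3; exact: close_sub3 h5 h4 (hx _ cl).
have [||del del0 H] := key t 1; try by move: t01; goal_lra.
exists del => // x /xt0 xt; have [ym [r r0 ev]] := H _ xt.
apply: eventually_imp ev => n [[[h1 h2 h3] [h4 h5 h6]] [yr [mr hx]]].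
have [c1 c2 c3 cl] := last_piece_arith h1 h2 h3 A0 Au Bt yr.
rewrite /real_transform c1 c2 c3; apply: lt_le_trans (hx _ cl) _.
by rewrite ler_pdivrMr // ler_peMr ?(ltW e0) // ler1n.
Qed.

(** Gives the grid point of level [k] strictly to the right of [t]; at [t = 1] there is none, and
    the time 1 is kept. *)
Definition dyadic_right k (t : R) : nat := if t < 1 then (Num.truncn ((2 ^ k)%:R * t)).+1 else (2 ^ k)%N.

Lemma dyadic_right_lt k t : 0 <= t < 1 -> t < grid k (dyadic_right k t) <= t + ((2 ^ k)%:R)^-1 /\ (dyadic_right k t <= 2 ^ k)%N.
Proof.
move=> /andP[t0 t1]; rewrite /dyadic_right t1.
have N0 := pow2_gt0 (R := R) k.
have y0 : 0 <= (2 ^ k)%:R * t by rewrite mulr_ge0 // ltW.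
have /andP[h1 h2] := truncn_itv y0; set j := Num.truncn _ in h1 h2 *.
have jN : (j.+1 <= 2 ^ k)%N.
  by rewrite -(ltr_nat R); apply: le_lt_trans h1 _; rewrite gtr_pMr.
split => //; rewrite gridE // ltr_pdivlMr // mulrC h2 /=.
rewrite -[j.+1]addn1 natrD mulrDl mul1r lerD2r ler_pdivrMr // mulrC //.
Qed.

Lemma dyadic_right_le k t : 0 <= t <= 1 -> (dyadic_right k t <= 2 ^ k)%N.
Proof.
move=> t01; have [t1|t1] := ltP t 1; last by rewrite /dyadic_right ltNge t1.
by have [] := @dyadic_right_lt k t ltac:(lra).
Qed.

Lemma dyadic_right1 k : grid k (dyadic_right k 1) = 1 :> R.
Proof. by rewrite /dyadic_right ltxx grid_top. Qed.

Hypothesis abv : forall n, [/\ 0 <= a n, a n <= v n, v n < b n & b n <= 1].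

Lemma real_transform_dyadic_limit t e : 0 <= t <= 1 -> t != B - A -> 0 < e ->
  eventually_seq (fun k => eventually_seq (fun n =>
    `|real_transform f (a n) (b n) (v n) (grid k (dyadic_right k t)) - limit_transform t| < e)).
Proof.
move=> t01 tBA e0; have [t1|t1] := ltP t 1.
  have t01' : 0 <= t < 1 by lra.
  have [del del0 H] := real_transform_limit t01' tBA e0.
  apply: eventually_imp (pow2_small del0) => k hk; apply: H.
  by have [h _] := dyadic_right_lt k t01'; lra.
have -> : t = 1 by apply/eqP; rewrite eq_le t1 andbT; lra.
exists 0%N => k _; exists 0%N => n _; rewrite dyadic_right1.
have [a0 av vb b1] := abv n.
have -> : limit_transform 1 = f 1.
  rewrite /limit_transform ifF; last by apply/negbTE; rewrite -leNgt; move: A0 Au uB B1; lra.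
  have tBA' : B - A != 1 by rewrite eq_sym; have <- : t = 1 by apply/eqP; rewrite eq_le t1 andbT; lra.
  rewrite ifF; last first.
    apply/negbTE; rewrite -ltNge lt_neqAle tBA'; move: A0 Au uB B1; lra.
  by rewrite ifF //; apply/negbTE; rewrite -leNgt.
rewrite /real_transform ifF; last by apply/negbTE; rewrite -leNgt; lra.
rewrite ifF; last by apply/negbTE; rewrite -leNgt; lra.
rewrite ifF; last by apply/negbTE; rewrite -leNgt; lra.
by rewrite subrr normr0.
Qed.

End TransformLimit.

(** * Comparing laws through iterated limits *)

Section IteratedLimits.
Context {R : realType} {d : measure_display} {Omega : measurableType d}.
Variable P : probability Omega R.

Definition eventually2 (Q : nat -> nat -> Prop) := eventually_seq (fun k => eventually_seq (Q k)).

Lemma eventually2_contra Q Q' : eventually2 Q -> eventually2 Q' ->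
  (forall k n, Q k n -> Q' k n -> False) -> False.
Proof.
move=> [k1 h1] [k2 h2] H.
have [n1 g1] := h1 (maxn k1 k2) (leq_maxl _ _); have [n2 g2] := h2 (maxn k1 k2) (leq_maxr _ _).
exact: (H _ (maxn n1 n2) (g1 _ (leq_maxl _ _)) (g2 _ (leq_maxr _ _))).
Qed.

Lemma eventually2_imp Q Q' : (forall k n, Q k n -> Q' k n) -> eventually2 Q -> eventually2 Q'.
Proof.
by move=> h; apply: eventually_imp => k; apply: eventually_imp => n; exact: h.
Qed.

Lemma measurable_eventually (Q : nat -> set Omega) : (forall n, measurable (Q n)) ->
  measurable [set w | eventually_seq (fun n => Q n w)].
Proof.
move=> mQ; apply: mset_ex => n0; apply: mset_all => n.
by apply: mset_imp; [exact: mset_cst|exact: mQ].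
Qed.

Lemma measurable_eventually2 (Q : nat -> nat -> set Omega) : (forall k n, measurable (Q k n)) ->
  measurable [set w | eventually2 (fun k n => Q k n w)].
Proof.
move=> mQ.
by apply: (@measurable_eventually (fun k => [set w | eventually_seq (fun n => Q k n w)])) => k;
  exact: measurable_eventually.
Qed.

Lemma pr_le_add A B E : measurable A -> measurable B -> measurable E ->
  A `<=` B `|` E -> pr P A <= pr P B + pr P E.
Proof.
move=> mA mB mE AB; apply: le_trans (prU_le P mB mE).
by apply: pr_le => //; exact: measurableU.
Qed.

(** [k] is chosen and then [n], so that the four events on which an approximation fails have
    probability below [e / 4] each. *)
Lemma pr_le_of_iterated_limit (A B : set Omega) (Akn Bkn : nat -> nat -> set Omega) :
  measurable A -> measurable B ->
  (forall k n, measurable (Akn k n)) -> (forall k n, measurable (Bkn k n)) ->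
  (forall k n, pr P (Akn k n) = pr P (Bkn k n)) ->
  {ae P, forall w, A w -> eventually2 (fun k n => Akn k n w)} ->
  {ae P, forall w, ~ B w -> eventually2 (fun k n => ~ Bkn k n w)} ->
  pr P A <= pr P B.
Proof.
move=> mA mB mAkn mBkn eAB hA hB; apply/ler_addgt0Pl => e e0.
have e40 : 0 < e / 4 by rewrite divr_gt0.
have meA k := measurable_eventually (mAkn k).
have meB k := measurable_eventually (fun n => mset_not (mBkn k n)).
pose E1 k := [set w | A w /\ ~ eventually_seq (fun n => Akn k n w)].
pose E2 k := [set w | ~ B w /\ ~ eventually_seq (fun n => ~ Bkn k n w)].
have mE1 k : measurable (E1 k) by apply: mset_and => //; exact: mset_not.
have mE2 k : measurable (E2 k) by apply: mset_and; [exact: mset_not|exact: (mset_not (meB k))].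
have [|k1 hk1] := @pr_inf_often _ _ _ P _ mE1 _ _ e40.
  apply: filterS hA => w hw; have [Aw|nA] := pselect (A w); last by exists 0%N => k _ [].
  by have [k0 hk0] := hw Aw; exists k0 => k k0k [_ nE]; apply: nE; exact: hk0.
have [|k2 hk2] := @pr_inf_often _ _ _ P _ mE2 _ _ e40.
  apply: filterS hB => w hw; have [Bw|nB] := pselect (B w); first by exists 0%N => k _ [].
  by have [k0 hk0] := hw nB; exists k0 => k k0k [_ nE]; apply: nE; exact: hk0.
pose k := maxn k1 k2.
pose E3 n := [set w | eventually_seq (fun n => Akn k n w) /\ ~ Akn k n w].
pose E4 n := [set w | eventually_seq (fun n => ~ Bkn k n w) /\ Bkn k n w].
have mE3 n : measurable (E3 n) by apply: mset_and; [exact: meA|exact: (mset_not (mAkn k n))].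
have mE4 n : measurable (E4 n) by apply: mset_and; [exact: meB|exact: mBkn].
have [|n1 hn1] := @pr_inf_often _ _ _ P _ mE3 _ _ e40.
  apply: aeW => w; have [h|h] := pselect (eventually_seq (fun n => Akn k n w)).
    by have [n0 hn0] := h; exists n0 => n n0n [_ nE]; apply: nE; exact: hn0.
  by exists 0%N => n _ [].
have [|n2 hn2] := @pr_inf_often _ _ _ P _ mE4 _ _ e40.
  apply: aeW => w; have [h|h] := pselect (eventually_seq (fun n => ~ Bkn k n w)).
    by have [n0 hn0] := h; exists n0 => n n0n [_ nE]; exact: (hn0 n n0n).
  by exists 0%N => n _ [].
pose n := maxn n1 n2.
have h1 := hk1 k (leq_maxl _ _); have h2 := hk2 k (leq_maxr _ _).
have h3 := hn1 n (leq_maxl _ _); have h4 := hn2 n (leq_maxr _ _).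
have i1 : pr P A <= pr P (Akn k n `|` E1 k) + pr P (E3 n).
  apply: pr_le_add => //; first exact: measurableU.
  move=> w Aw; have [a|na] := pselect (Akn k n w); first by left; left.
  by have [ev|nev] := pselect (eventually_seq (fun n => Akn k n w)); [right|left; right].
have i2 := prU_le P (mAkn k n) (mE1 k).
have i3 : pr P (Bkn k n) <= pr P (B `|` E2 k) + pr P (E4 n).
  apply: pr_le_add => //; first exact: measurableU.
  move=> w Bw; have [b|nb] := pselect (B w); first by left; left.
  by have [ev|nev] := pselect (eventually_seq (fun n => ~ Bkn k n w)); [right|left; right].
have i4 := prU_le P mB (mE2 k).
have := eAB k n.
move: h1 h2 h3 h4 i1 i2 i3 i4; move: (pr P (E1 k)) (pr P (E2 k)) (pr P (E3 n)) (pr P (E4 n)).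
move: (pr P A) (pr P B) (pr P (Akn k n)) (pr P (Bkn k n)) (pr P (Akn k n `|` E1 k)) (pr P (B `|` E2 k)).
by clear => *; lra.
Qed.

Section Compare.
Variables (m : nat) (V W : nat -> Omega -> R) (QA QB : (nat -> R) -> nat -> nat -> set Omega).
Hypotheses (mV : forall r, (r < m)%N -> measurable_fun setT (V r))
  (mW : forall r, (r < m)%N -> measurable_fun setT (W r)).
Hypotheses (mQA : forall y k n, measurable (QA y k n)) (mQB : forall y k n, measurable (QB y k n)).
Hypothesis eQ : forall y k n, pr P (QA y k n) = pr P (QB y k n).
Hypothesis hA : {ae P, forall w, forall y,
  (forall r, (r < m)%N -> V r w < y r) -> eventually2 (fun k n => QA y k n w)}.
Hypothesis hB : {ae P, forall w, forall y,
  (exists2 r, (r < m)%N & y r < W r w) -> eventually2 (fun k n => ~ QB y k n w)}.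

(** The thresholds are lowered by [del j0], at small cost for [V], so that a [W r] which is at least
    [y r] is strictly above the lowered threshold, where the discrete events decide. Used in both
    directions, it gives equal distribution functions. *)
Lemma pr_compare y : pr P [set w | forall r, (r < m)%N -> V r w < y r] <=
  pr P [set w | forall r, (r < m)%N -> W r w < y r].
Proof.
have mlt (F : nat -> Omega -> R) (z : nat -> R) :
    (forall r, (r < m)%N -> measurable_fun setT (F r)) ->
    measurable [set w | forall r, (r < m)%N -> F r w < z r].
  move=> mF; apply: mset_all => r; have [rm|mr] := boolP (r < m)%N; last first.
    by rewrite (_ : [set w | _] = setT) //; apply/seteqP; split.
  rewrite (_ : [set w | _] = [set w | F r w < z r]).
    by apply: mset_lt; [exact: mF|exact: measurable_cst].
  by apply/seteqP; split => w /= => [|h _]; [apply|].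
apply/ler_addgt0Pl => e e0.
pose del j : R := ((2 ^ j)%:R)^-1.
pose E j := [set w | (forall r, (r < m)%N -> V r w < y r) /\
   ~ (forall r, (r < m)%N -> V r w < y r - del j)].
have mE j : measurable (E j).
  by apply: mset_and; [exact: mlt|apply: mset_not; exact: (mlt V (fun r => y r - del j))].
have [|j0 hj] := @pr_inf_often _ _ _ P _ mE _ _ e0.
  apply: aeW => w; have [h|h] := pselect (forall r, (r < m)%N -> V r w < y r); last first.
    by exists 0%N => j _ [].
  suff [j0 hj0] : exists j0, forall j, (j0 <= j)%N -> forall r, (r < m)%N -> V r w < y r - del j.
    by exists j0 => j j0j [_]; apply; exact: hj0.
  elim: (m) h => [|m' IH] h; first by exists 0%N.
  have [|j1 hj1] := IH; first by move=> r rm'; apply: h; exact: ltnW.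
  have yV : 0 < y m' - V m' w by rewrite subr_gt0; exact: h.
  have [j2 hj2] := pow2_small yV; exists (maxn j1 j2) => j.
  rewrite geq_max => /andP[j1j j2j] r; rewrite ltnS leq_eqVlt => /orP[/eqP ->|rm']; last exact: hj1.
  by have := hj2 j j2j; rewrite -/(del j); lra.
have hE := hj j0 (leqnn _).
have del0 : 0 < del j0 by rewrite invr_gt0 pow2_gt0.
apply: (@le_trans _ _ (pr P [set w | forall r, (r < m)%N -> V r w < y r - del j0] + pr P (E j0))).
  apply: pr_le_add => //; [exact: mlt|exact: (mlt V (fun r => y r - del j0))|].
  move=> w h; have [h'|h'] := pselect (forall r, (r < m)%N -> V r w < y r - del j0); first by left.
  by right.
rewrite addrC; apply: lerD; first exact: ltW.
apply: (pr_le_of_iterated_limit _ _ (mQA (fun r => y r - del j0)) (mQB (fun r => y r - del j0)) (eQ _)).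
- exact: (mlt V (fun r => y r - del j0)).
- exact: mlt.
- by apply: filterS hA => w hw; exact: hw.
- apply: filterS hB => w hw nW; apply: hw.
  have /existsNP [r /not_implyP [rm /negP]] := nW; rewrite -leNgt => yW.
  by exists r => //; lra.
Qed.

End Compare.

(** Measurability is created here: on [G], being below [y] is a countable union, over [j], of
    iterated limits of discrete events at thresholds lowered by [2 ^ - j]. *)
Lemma measurable_of_tracking (V : Omega -> R) (G : set Omega) (Q : R -> nat -> nat -> set Omega) :
  measurable G -> (forall y k n, measurable (Q y k n)) ->
  (forall w, G w -> forall y, (V w < y -> eventually2 (fun k n => Q y k n w)) /\
                         (y < V w -> eventually2 (fun k n => ~ Q y k n w))) ->
  forall y, measurable [set w | G w /\ V w < y].
Proof.
move=> mG mQ hQ y.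
rewrite (_ : [set w | _] = [set w | G w /\ exists j,
  eventually2 (fun k n => Q (y - ((2 ^ j)%:R)^-1) k n w)]).
  apply: mset_and => //; apply: mset_ex => j.
  by apply: (@measurable_eventually2 (fun k n => Q (y - ((2 ^ j)%:R)^-1) k n)).
apply/seteqP; split => w /= [Gw].
  move=> Vy; split => //; have yV : 0 < y - V w by rewrite subr_gt0.
  have [j hj] := pow2_small yV; exists j; apply: (proj1 (hQ w Gw _)).
  by have := hj j (leqnn _); lra.
move=> [j ev]; split => //; rewrite ltNge; apply/negP => yV.
have j0 : 0 < ((2 ^ j)%:R : R)^-1 by rewrite invr_gt0 pow2_gt0.
have := proj2 (hQ w Gw (y - ((2 ^ j)%:R)^-1)) ltac:(lra).
by move=> /(eventually2_contra ev); apply.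
Qed.

End IteratedLimits.

(** * Good paths *)

Section NicePaths.
Context {R : realType} {d : measure_display} {Omega : measurableType d}.
Variables (P : probability Omega R) (X : R -> Omega -> R) (U : Omega -> R) (C : Omega -> R -> R).
Hypothesis levy : levy_process01 P X.
Hypothesis minorant : forall w, convex_minorant01 (X ^~ w) (C w).

Definition straddles n w g i k := face_at (2 ^ n) (increments X n w) (uindex U n w) g i k.

Definition dyadic_time k n (t : R) := (dyadic_right k t * 2 ^ (n - k))%N.

Lemma dyadic_timeP k n (t : R) : (k <= n)%N -> 0 <= t <= 1 ->
  (dyadic_time k n t <= 2 ^ n)%N /\ grid n (dyadic_time k n t) = grid k (dyadic_right k t) :> R.
Proof. by move=> kn t01; apply: grid_scale => //; exact: dyadic_right_le. Qed.

(** Collects the almost sure input of the limit; what [nice_path] derives from it is deterministic,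
    path by path. *)
Definition nice w := [/\ 0 < U w < 1, ~ three_touch_line (X ^~ w), X 1 w = left_lim (X ^~ w) 1,
  forall n, exists g i k, straddles n w g i k &
  exists M, forall n0, exists n, [/\ (n0 <= n)%N, (M + M <= n)%N & forall g i k,
    straddles n w g i k -> (2 ^ (n - (M + M)) <= i)%N /\ (2 ^ (n - (M + M)) <= k - i)%N]].

Lemma uindex_cvg w e : 0 < U w < 1 -> 0 < e -> eventually_seq (fun n =>
  ((uindex U n w).+1 <= 2 ^ n)%N /\ U w < grid n (uindex U n w) < U w + e).
Proof.
move=> u01 e0; have u1 : 0 < 1 - U w by lra.
have [n1 hn1] := pow2_small e0; have [n2 hn2] := pow2_small u1.
have u01' : 0 <= U w < 1 by lra.
exists (maxn n1 n2) => n; rewrite geq_max => /andP[nn1 nn2].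
have [h hN] := dyadic_right_lt n u01'; have s1 := hn1 n nn1; have s2 := hn2 n nn2.
have lt1 : (grid n (dyadic_right n (U w)) : R) < 1 by lra.
have ltN : (dyadic_right n (U w) < 2 ^ n)%N.
  by rewrite ltnNge; apply/negP => /grid_top eg; move: lt1; rewrite eg ltxx.
have -> : uindex U n w = dyadic_right n (U w).
  rewrite /uindex /dyadic_right ifT; last by case/andP: u01.
  by rewrite modn_small //; move: ltN; rewrite /dyadic_right ifT; last by case/andP: u01.
by split => //; lra.
Qed.

Lemma uindex_succ_cvg w e : 0 < U w < 1 -> 0 < e -> eventually_seq (fun n =>
  `|(uindex U n w).+1%:R / (2 ^ n)%:R - U w| < e).
Proof.
move=> u01 e0; have e20 : 0 < e / 2 by rewrite divr_gt0.
apply: eventually_imp (eventually_and (uindex_cvg u01 e20) (pow2_small e20)) => n [[uN hu] hn].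
rewrite -gridE // gridS //; move: hu hn; rewrite ltr_norml.
by have : 0 < ((2 ^ n)%:R : R)^-1; [rewrite invr_gt0 pow2_gt0|lra].
Qed.

Lemma increments_cvg w t e : 0 <= t <= 1 -> 0 < e -> eventually2 (fun k n =>
  `|psum (increments X n w) (dyadic_time k n t) - X t w| < e).
Proof.
move=> t01 e0; have [_ _ Xc _ _] := levy.
have [t1|t1] := ltP t 1; last first.
  have -> : t = 1 by apply/eqP; rewrite eq_le t1 andbT; case/andP: t01.
  exists 0%N => k _; exists k => n kn; rewrite (psum_increments levy).
  have [|_ ->] := @dyadic_timeP k n 1 kn; first by rewrite ler01 lexx.
  by rewrite dyadic_right1 subrr normr0.
have t01' : 0 <= t < 1 by rewrite t1 andbT; case/andP: t01.
have [del del0 hdel] := cadlag_right (Xc w) t01' e0.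
apply: eventually_imp (pow2_small del0) => k hk; exists k => n kn.
rewrite (psum_increments levy); have [_ ->] := dyadic_timeP kn t01.
by have [h _] := dyadic_right_lt k t01'; apply: hdel; lra.
Qed.

Lemma face_chord (f : R -> R) n g k : face (2 ^ n) (fun j => f (grid n j)) g k ->
  exists al be : R, [/\ forall j, (j <= 2 ^ n)%N -> al + be * grid n j <= f (grid n j),
    al + be * grid n g = f (grid n g) & al + be * grid n (g + k) = f (grid n (g + k)%N)].
Proof.
move=> [k0 gN h]; have k0R : 0 < k%:R :> R by rewrite ltr0n.
have N0 := pow2_gt0 (R := R) n.
pose be := (f (grid n (g + k)%N) - f (grid n g)) * (2 ^ n)%:R / k%:R.
have gE : grid n g = g%:R / (2 ^ n)%:R :> R by rewrite gridE //; lia.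
have dE : grid n (g + k) = (g%:R + k%:R) / (2 ^ n)%:R :> R by rewrite gridE // natrD.
have bk : be * grid n (g + k) = be * grid n g + (f (grid n (g + k)%N) - f (grid n g)).
  rewrite {1 2}/be gE dE; set F := f _ - f _; by field; rewrite !gt_eqF.
exists (f (grid n g) - be * grid n g), be; split; [|by ring|by rewrite bk; ring].
move=> j jN; have [->|jg] := eqVneq j g; first by rewrite subrK.
have [->|jd] := eqVneq j (g + k)%N; first by rewrite bk; lra.
have e : be * grid n j = be * grid n g + (f (grid n (g + k)%N) - f (grid n g)) * (j%:R - g%:R) / k%:R.
  rewrite {1 2}/be gE (gridE jN); set F := f _ - f _; by field; rewrite !gt_eqF.
have H : (f (grid n (g + k)%N) - f (grid n g)) * (j%:R - g%:R) / k%:R <= f (grid n j) - f (grid n g).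
  by rewrite ler_pdivrMr // ltW // h.
by rewrite e; lra.
Qed.

(** The time [B - A] is singled out because the rearranged walks are compared with the transform at
    other times. At that time the transform is the increment of the minorant, itself the limit of
    the increments over the faces. *)
Lemma nice_path w (A := exc_left (X ^~ w) (C w) (U w)) (B := exc_right (X ^~ w) (C w) (U w)) :
  nice w -> [/\ excursion_set (X ^~ w) (C w) (U w),
  forall e, 0 < e -> eventually_seq (fun n => forall g i l, straddles n w g i l ->
    `|l%:R / (2 ^ n)%:R - (B - A)| < e),
  forall e, 0 < e -> eventually_seq (fun n => forall g i l, straddles n w g i l ->
    `|psum (increments X n w) (g + l) - psum (increments X n w) g - (C w B - C w A)| < e),
  shifted_path (X ^~ w) (C w) (U w) (B - A) = C w B - C w A &
  forall t, 0 <= t <= 1 -> t != B - A -> forall e, 0 < e -> eventually2 (fun k n =>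
    forall g i l, straddles n w g i l ->
    `|psum (increments X n w \o exc_perm g i l) (dyadic_time k n t) -
      shifted_path (X ^~ w) (C w) (U w) t| < e)].
Proof.
move=> [u01 no3 X1 exf [M wide]]; have [_ _ Xc _ _] := levy.
have /choice[g /choice[i /choice[l hs]]] := exf.
have uniq n g' i' l' : straddles n w g' i' l' -> [/\ g' = g n, i' = i n & l' = l n].
  by move=> s; exact: (face_at_unique s (hs n)).
pose f := X ^~ w.
have psumf n : psum (increments X n w) = fun j => f (grid n j).
  by apply/funext => j; exact: (psum_increments levy).
pose a n : R := grid n (g n); pose b n : R := grid n (g n + l n); pose v n : R := grid n (g n + i n).
have hs' n : [/\ uindex U n w = (g n + i n)%N, (i n < l n)%N & (g n + l n <= 2 ^ n)%N].
  by have [e il [_ gN _]] := hs n.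
have abv n : [/\ 0 <= a n, a n <= v n, v n < b n & b n <= 1].
  have [_ il gN] := hs' n; rewrite /a /b /v; split.
  - by case/andP: (@grid_itv R n (g n)).
  - by apply: grid_le; exact: leq_addr.
  - by rewrite ltNge grid_inj_le -?ltnNge ?ltn_add2l //; lia.
  - by case/andP: (@grid_itv R n (g n + l n)).
have vu e : 0 < e -> exists n0, forall n, (n0 <= n)%N -> U w <= v n < U w + e.
  move=> e0; have [n0 hn0] := uindex_cvg u01 e0; exists n0 => n /hn0 [_].
  by have [-> _ _] := hs' n; move=> /andP[/ltW h1 h2]; apply/andP.
have chord n : exists al be, [/\ forall j, (j <= 2 ^ n)%N -> al + be * grid n j <= f (grid n j),
    al + be * a n = f (a n) & al + be * b n = f (b n)].
  have [_ _ fc] := hs n; rewrite psumf in fc.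
  by have [al [be [h1 h2 h3]]] := face_chord fc; exists al, be.
have wd : exists2 del, 0 < del & forall n0, exists n, [/\ (n0 <= n)%N, a n + del <= v n & v n + del <= b n].
  exists ((2 ^ (M + M))%:R)^-1; first by rewrite invr_gt0 pow2_gt0.
  move=> n0; have [n [n0n MMn hw]] := wide n0; exists n.
  have [hi hl] := hw _ _ _ (hs n); have [_ il gN] := hs' n.
  have N0 := pow2_gt0 (R := R) n.
  have -> : ((2 ^ (M + M))%:R)^-1 = (2 ^ (n - (M + M)))%:R / (2 ^ n)%:R :> R.
    have e : (2 ^ n = 2 ^ (n - (M + M)) * 2 ^ (M + M))%N by rewrite -expnD subnK.
    by rewrite e natrM -{1}[X in X / _]mulr1 -mulf_div divff ?mul1r // gt_eqF ?pow2_gt0.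
  rewrite /a /v /b !gridE; try lia.
  rewrite -!mulrDl !ler_pM2r ?invr_gt0 // -!natrD !ler_nat; split => //; lia.
have [A' [B' [[A0 Au uB B1] Ou eA eB lim]]] :=
  excursion_limit (Xc w) (minorant w) u01 no3 X1 abv vu chord wd.
have eAA : A = A' by []. have eBB : B = B' by [].
clear eA eB; subst A' B'.
have bal n : b n - a n = (l n)%:R / (2 ^ n)%:R.
  have [_ il gN] := hs' n; rewrite /a /b !gridE //; last by lia.
  by rewrite -mulrBl natrD addrAC subrr add0r.
split => //.
- move=> e e0; have e20 : 0 < e / 2 by rewrite divr_gt0.
  apply: eventually_imp (lim _ e20) => n [h1 h2 _ _] g' i' l' /uniq [_ _ ->].
  by rewrite -bal; move: h1 h2; rewrite !ltr_norml; lra.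
- move=> e e0; have e20 : 0 < e / 2 by rewrite divr_gt0.
  apply: eventually_imp (lim _ e20) => n [_ _ h1 h2] g' i' l' /uniq [-> _ ->].
  by rewrite psumf; move: h1 h2; rewrite /f /a /b /= !ltr_norml; lra.
- rewrite /shifted_path -/A -/B ifF; last by apply/negbTE; rewrite -leNgt; lra.
  rewrite lexx; have -> : A + (B - A) - (B - U w) = U w by ring.
  by ring.
- move=> t t01 tBA e e0.
  have := real_transform_dyadic_limit (Xc w) A0 Au uB B1 lim vu abv t01 tBA e0.
  move=> [k0 hk0]; exists k0 => k k0k; have [n0 hn0] := hk0 k k0k.
  exists (maxn n0 k) => n; rewrite geq_max => /andP[n0n kn] g' i' l' /uniq [-> -> ->].
  have [_ il gN] := hs' n; have [jN eg] := dyadic_timeP kn t01.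
  by rewrite psum_exc_perm // psumf walk_transform_grid // eg; exact: hn0.
Qed.

End NicePaths.

(** * Cylinders in the space of marked paths *)

Section PathCylinders.
Context {R : realType}.

(** [None] stands for the real coordinate and [Some t] for the time [t], so that one list of
    coordinates covers both. *)
Definition path_eval (p : R * (R -> R)) (o : option R) : R := if o is Some t then p.2 t else p.1.

Definition valid_times (c : nat -> option R) := forall r t, c r = Some t -> 0 <= t <= 1.

Definition path_cylinders : set (set (R * (R -> R))) := [set A | exists m c y, valid_times c /\
  A = [set p | forall r, (r < m)%N -> path_eval p (c r) < y r]].

Lemma path_cylinders_setI : setI_closed path_cylinders.
Proof.
move=> _ _ [m1 [c1 [y1 [v1 ->]]]] [m2 [c2 [y2 [v2 ->]]]].
pose glue T (x1 x2 : nat -> T) r := if (r < m1)%N then x1 r else x2 (r - m1)%N.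
exists (m1 + m2)%N, (glue _ c1 c2), (glue _ y1 y2); split.
  by move=> r t; rewrite /glue; case: ifP => _; [exact: v1|exact: v2].
apply/seteqP; split => p /= => [[h1 h2] r rm|h].
  by rewrite /glue; case: ltnP => rm1; [exact: h1|apply: h2; lia].
split => r rm.
  by have := h r ltac:(lia); rewrite /glue rm.
have := h (m1 + r)%N ltac:(lia); rewrite /glue ltnNge leq_addr /= addKn.
exact.
Qed.

Definition cylinder_paths := g_sigma_algebraType path_cylinders.

Lemma measurable_path_eval o : (forall t, o = Some t -> 0 <= t <= 1) ->
  measurable_fun setT (fun p : cylinder_paths => path_eval p o).
Proof.
move=> ot; apply: (measurability _ (RGenInftyO.measurableE R)) => _ [_ [x ->] <-].
rewrite setTI; apply: sub_sigma_algebra; exists 1%N, (fun=> o), (fun=> x).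
split; first by move=> _.
by apply/seteqP; split => p /=; rewrite in_itv /= => h; [move=> _ _|exact: (h 0%N)].
Qed.

Lemma path_measurable_cylinders (A : set (R * (R -> R))) : path_measurable R A ->
  @measurable _ cylinder_paths A.
Proof.
move: A; apply: smallest_sub; first exact: smallest_sigma_algebra.
move=> A [[B [mB ->]]|[t [B [t01 [mB ->]]]]].
  by have := @measurable_path_eval None (fun _ e => ltac:(discriminate e)) measurableT B mB; rewrite setTI.
have ot t' : Some t = Some t' -> 0 <= t' <= 1 by case=> <-.
by have := measurable_path_eval ot measurableT mB; rewrite setTI.
Qed.

Lemma measurable_to_paths d (T : measurableType d) (F : T -> R * (R -> R)) :
  (forall o, (forall t, o = Some t -> 0 <= t <= 1) -> measurable_fun setT (fun w => path_eval (F w) o)) ->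
  measurable_fun setT (F : T -> cylinder_paths).
Proof.
move=> mF; apply: (measurability _ (erefl : @measurable _ cylinder_paths = <<s path_cylinders >>)).
move=> _ [A [m [c [y [vc ->]]]] <-]; rewrite setTI.
apply: (@mset_all _ _ _ (fun r w => (r < m)%N -> path_eval (F w) (c r) < y r)) => r.
apply: mset_imp; first exact: mset_cst.
by apply: mset_lt; [apply: mF => t; exact: vc|exact: measurable_cst].
Qed.

Lemma measurable_fun_sublevel d (T : measurableType d) (F : T -> R) :
  (forall y, measurable [set w | F w < y]) -> measurable_fun setT F.
Proof.
move=> mF; apply: (measurability _ (RGenInftyO.measurableE R)) => _ [_ [x ->] <-].
by rewrite setTI; have := mF x; congr (measurable _).
Qed.

End PathCylinders.

(** * Measurability of the transformed pair *)

Section ExcursionTransformLaw.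
Context {R : realType} {d : measure_display} {Omega : measurableType d}.
Variables (P : probability Omega R) (X : R -> Omega -> R) (U : Omega -> R) (C : Omega -> R -> R).
Hypothesis levy : levy_process01 P X.
Hypothesis cd : CD P X.
Hypothesis unif : uniform01 P U.
Hypothesis indU : indep_of_process P U X.
Hypothesis minorant : forall w, convex_minorant01 (X ^~ w) (C w).

Let mU : measurable_fun setT U.
Proof. by case: unif. Qed.

Let mX t : 0 <= t <= 1 -> measurable_fun setT (X t).
Proof. by case: levy => h _ _ _ _; exact: h. Qed.

Lemma uniform_itv_ae : {ae P, forall w, 0 < U w < 1}.
Proof.
have mI : measurable (~` (U @^-1` `]0, 1[%classic)).
  by apply: measurableC; apply: (measurable_preimage mU); exact: measurable_itv.
apply: negligibleS (_ : P.-negligible (~` (U @^-1` `]0, 1[%classic))).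
  by move=> w /= h; rewrite in_itv.
apply: (pr0_negligible mI); rewrite preimage_setC /pr; have [_ ->] := unif.
  by rewrite setICl measure0.
by apply: measurableC; exact: measurable_itv.
Qed.

Lemma nice_ae : {ae P, forall w, nice X U w}.
Proof.
have h1 := no_three_touch_ae levy cd; have h2 := left_continuous_at1_ae levy.
have h3 := straddling_face_ae levy cd unif indU; have h4 := wide_face_ae levy cd unif indU.
apply: filterS (filterI uniform_itv_ae (filterI (filterI h1 h2) (filterI h3 h4))).
by move=> w [? [[? ?] [? ?]]]; split.
Qed.

Let mface n (Q : nat -> nat -> nat -> set (rseq R)) : (forall g i k, measurable (Q g i k)) ->
  measurable [set w | exists g i k, straddles X U n w g i k /\ Q g i k (increments X n w \o exc_perm g i k)].
Proof. exact: (measurable_face_n levy cd unif). Qed.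

Lemma straddles_tracking w (phi : nat -> nat -> nat -> nat -> nat -> R) (z : R) : nice X U w ->
  (forall e, 0 < e -> eventually2 (fun k n => forall g i l, straddles X U n w g i l ->
     `|phi k n g i l - z| < e)) ->
  forall y, (z < y -> eventually2 (fun k n => exists g i l, straddles X U n w g i l /\ phi k n g i l < y)) /\
    (y < z -> eventually2 (fun k n => ~ exists g i l, straddles X U n w g i l /\ phi k n g i l < y)).
Proof.
move=> [_ _ _ exf _] lim y; split => hy.
  have e0 : 0 < y - z by rewrite subr_gt0.
  apply: eventually2_imp (lim _ e0) => k n h; have [g [i [l s]]] := exf n.
  by exists g, i, l; split => //; have := h _ _ _ s; rewrite ltr_norml; lra.
have e0 : 0 < z - y by rewrite subr_gt0.
apply: eventually2_imp (lim _ e0) => k n h [g [i [l [s]]]].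
by have := h _ _ _ s; rewrite ltr_norml; lra.
Qed.

Variable G : set Omega.
Hypotheses (mG : measurable G) (nG : forall w, G w -> nice X U w) (pG : {ae P, forall w, G w}).

Let len w := exc_right (X ^~ w) (C w) (U w) - exc_left (X ^~ w) (C w) (U w).
Let XU w := shifted_path (X ^~ w) (C w) (U w).

(** The constant value off [G] gives a measurable version: the minorant is given path by path, and
    the discrete walks control the transform on [G] alone. *)
Definition transformed w : R * (R -> R) := if `[< G w >] then (len w, XU w) else (0, fun=> 0).

Let transformedE w : G w -> transformed w = (len w, XU w).
Proof. by move=> Gw; rewrite /transformed asboolT. Qed.

Lemma measurable_len_lt y : measurable [set w | G w /\ len w < y].
Proof.
apply: (measurable_of_tracking (Q := fun y k n => [set w | exists g i l, straddles X U n w g i l /\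
   l%:R / (2 ^ n)%:R < y])) => //.
- move=> y' k n; exact: (@mface n (fun g i l => [set z | l%:R / (2 ^ n)%:R < y']) (fun _ _ _ => mset_cst _)).
- move=> w Gw; apply: (straddles_tracking (phi := fun k n g i l => l%:R / (2 ^ n)%:R) (nG Gw)) => e e0.
  have [_ h _ _ _] := nice_path levy minorant (nG Gw).
  by exists 0%N => k _; exact: h.
Qed.

(** For a time [t], [G] is split by whether the length equals [t]. Where it does, the value is the
    increment of the minorant, tracked by face increments; elsewhere the rearranged walks track
    it. *)
Lemma measurable_transformed o : (forall t, o = Some t -> 0 <= t <= 1) ->
  measurable_fun setT (fun w => path_eval (transformed w) o).
Proof.
move=> ot; apply: measurable_fun_sublevel => y.
have mlen : measurable_fun setT (fun w => if `[< G w >] then len w else 0).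
  apply: measurable_fun_sublevel => z.
  rewrite (_ : [set w | _] = [set w | (G w /\ len w < z) \/ (~ G w /\ 0 < z)]).
    apply: mset_or; first exact: measurable_len_lt.
    by apply: mset_and; [exact: mset_not|exact: mset_cst].
  apply/seteqP; split => w /=; have [Gw|nGw] := pselect (G w).
  - by rewrite asboolT //; left.
  - by rewrite asboolF //; right.
  - by rewrite asboolT // => -[[]|[]].
  - by rewrite asboolF // => -[[]|[]].
case: o ot => [t|] ot; last first.
  have := mset_lt mlen (measurable_cst y); congr measurable; apply/seteqP; split => w /=;
    by rewrite /transformed; case: asboolP.
have t01 := ot t erefl.
pose E := [set w | (if `[< G w >] then len w else 0) = t].
have mE : measurable E by exact: (mset_eq mlen (measurable_cst t)).
pose G1 := [set w | G w /\ E w]; pose G2 := [set w | G w /\ ~ E w].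
have mG1 : measurable G1 by exact: mset_and.
have mG2 : measurable G2 by apply: mset_and => //; exact: mset_not.
have m1 : measurable [set w | G1 w /\ XU w t < y].
  apply: (measurable_of_tracking (Q := fun y k n => [set w | exists g i l, straddles X U n w g i l /\
     psum (increments X n w) (g + l) - psum (increments X n w) g < y])) => //.
    (* [mface] speaks of the rearranged steps, so the face increment is written through the inverse
       permutation, which undoes the rearrangement when [i < l]. *)
    move=> y' k n; pose Q g i l : set (rseq R) := [set z : rseq R | psum (z \o exc_perm_inv g i l) (g + l) -
       psum (z \o exc_perm_inv g i l) g < y' /\ (i < l)%N].
    have mQ g i l : measurable (Q g i l).
      apply: mset_and; last exact: mset_cst.
      have mz : measurable [set z : rseq R | psum z (g + l) - psum z g < y'].
        by apply: mset_lt; [apply: measurable_funB; exact: measurable_psum|exact: measurable_cst].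
      exact: (measurable_comp_seq (exc_perm_inv g i l) mz).
    have := mface n mQ; congr measurable; apply/seteqP; split => w /= [g [i [l [s h]]]]; exists g, i, l;
    have [_ il _] := s; split => //; move: h; rewrite /Q /= (_ : (_ \o _) \o _ = increments X n w);
      try (by apply/funext => j /=; rewrite exc_perm_invK); by [case|].
  move=> w [Gw Ew]; rewrite /E /= asboolT // in Ew.
  have [_ _ h e _] := nice_path levy minorant (nG Gw).
  have -> : XU w t = C w (exc_right (X ^~ w) (C w) (U w)) - C w (exc_left (X ^~ w) (C w) (U w)).
    by rewrite -Ew.
  apply: (straddles_tracking (phi := fun k n g i l => psum (increments X n w) (g + l) -
    psum (increments X n w) g) (nG Gw)) => e' e'0.
  by exists 0%N => k _; exact: h.
have m2 : measurable [set w | G2 w /\ XU w t < y].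
  apply: (measurable_of_tracking (Q := fun y k n => [set w | exists g i l, straddles X U n w g i l /\
     psum (increments X n w \o exc_perm g i l) (dyadic_time k n t) < y])) => //.
    move=> y' k n; apply: (@mface n (fun g i l => [set z | psum z (dyadic_time k n t) < y'])) => g i l.
    by apply: mset_lt; [exact: measurable_psum|exact: measurable_cst].
  move=> w [Gw nE]; rewrite /E /= asboolT // in nE.
  have [_ _ _ _ h] := nice_path levy minorant (nG Gw).
  apply: (straddles_tracking (phi := fun k n g i l =>
    psum (increments X n w \o exc_perm g i l) (dyadic_time k n t)) (nG Gw)).
  by apply: h => //; apply/eqP => e; apply: nE; rewrite e.
rewrite (_ : [set w | _] = [set w | ((G1 w /\ XU w t < y) \/ (G2 w /\ XU w t < y)) \/ (~ G w /\ 0 < y)]).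
  apply: mset_or; first exact: mset_or.
  by apply: mset_and; [exact: mset_not|exact: mset_cst].
apply/seteqP; split => w /=; have [Gw|nGw] := pselect (G w).
- rewrite transformedE //= => h; left.
  by have [e|ne] := pselect (E w); [left|right].
- by rewrite /transformed asboolF //=; right.
- by rewrite transformedE //= => -[[[]|[]]|[]].
- by rewrite /transformed asboolF //= => -[[[[]]|[[]]]|[]].
Qed.

End ExcursionTransformLaw.

Lemma eventually2_forall_lt m (Q : nat -> nat -> nat -> Prop) :
  (forall r, (r < m)%N -> eventually2 (Q r)) -> eventually2 (fun k n => forall r, (r < m)%N -> Q r k n).
Proof.
elim: m => [|m IH] h; first by exists 0%N => k _; exists 0%N.
have hm : eventually2 (Q m) by exact: h.
have hIH : eventually2 (fun k n => forall r, (r < m)%N -> Q r k n) by apply: IH => r rm; apply: h; exact: ltnW.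
apply: eventually_imp (eventually_and hIH hm) => k [h1 h2].
apply: eventually_imp (eventually_and h1 h2) => n [g1 g2] r.
by rewrite ltnS leq_eqVlt => /orP[/eqP ->|/g1].
Qed.

(** * Equality of the laws *)

Section ExcursionTransformLawEquality.
Context {R : realType} {d : measure_display} {Omega : measurableType d}.
Variables (P : probability Omega R) (X : R -> Omega -> R) (U : Omega -> R) (C : Omega -> R -> R).
Hypothesis levy : levy_process01 P X.
Hypothesis cd : CD P X.
Hypothesis unif : uniform01 P U.
Hypothesis indU : indep_of_process P U X.
Hypothesis minorant : forall w, convex_minorant01 (X ^~ w) (C w).
Variable G : set Omega.
Hypotheses (mG : measurable G) (nG : forall w, G w -> nice X U w) (pG : {ae P, forall w, G w}).

Let Y := transformed X U C G.
Let Z w : R * (R -> R) := (U w, X ^~ w).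

Let mY o : (forall t, o = Some t -> 0 <= t <= 1) -> measurable_fun setT (fun w => path_eval (Y w) o).
Proof. exact: (measurable_transformed levy cd unif minorant mG nG). Qed.

Let mZ o : (forall t, o = Some t -> 0 <= t <= 1) -> measurable_fun setT (fun w => path_eval (Z w) o).
Proof.
case: o => [t|] ot; last by case: unif.
by case: levy => mX _ _ _ _; exact: mX (ot t erefl).
Qed.

(* Approximates path_eval o on a walk of 2^n steps with marked length l. *)
Let stat (o : option R) k n l (z : rseq R) : R :=
  if o is Some t then psum z (dyadic_time k n t) else l%:R / (2 ^ n)%:R.

Let mstat o k n l : measurable_fun setT (stat o k n l).
Proof. by case: o => [t|]; [exact: measurable_psum|exact: measurable_cst]. Qed.

Let stat_transformed w o : G w -> (forall t, o = Some t -> 0 <= t <= 1 /\ (Y w).1 != t) ->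
  forall e, 0 < e -> eventually2 (fun k n => forall g i l, straddles X U n w g i l ->
    `|stat o k n l (increments X n w \o exc_perm g i l) - path_eval (Y w) o| < e).
Proof.
move=> Gw; have [_ h1 _ _ h2] := nice_path levy minorant (nG Gw).
rewrite /Y /transformed asboolT //= => ot e e0; case: o ot => [t|] ot /=.
  by have [t01 nt] := ot t erefl; apply: h2 => //; rewrite eq_sym.
by exists 0%N => k _; exact: h1.
Qed.

Let stat_identity w o : G w -> (forall t, o = Some t -> 0 <= t <= 1) ->
  forall e, 0 < e -> eventually2 (fun k n =>
    `|stat o k n (uindex U n w).+1 (increments X n w) - path_eval (Z w) o| < e).
Proof.
move=> /nG [u01 _ _ _ _] ot e e0; case: o ot => [t|] ot /=.
  exact: (increments_cvg levy _ (ot t erefl) e0).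
by exists 0%N => k _; exact: uindex_succ_cvg.
Qed.

(** Two applications of [pr_compare], with the roles of the transformed and the original pair
    exchanged; the identity at each discrete level is [face_n_law]. *)
Let pr_cylinder_eq m c y : valid_times c ->
  (forall r t, c r = Some t -> {ae P, forall w, (Y w).1 != t}) ->
  pr P [set w | forall r, (r < m)%N -> path_eval (Y w) (c r) < y r] =
  pr P [set w | forall r, (r < m)%N -> path_eval (Z w) (c r) < y r].
Proof.
move=> vc cne.
pose Q y k n l : set (rseq R) := [set z | forall r, (r < m)%N -> stat (c r) k n l z < y r].
pose QA y k n := [set w | exists g i l, straddles X U n w g i l /\
  Q y k n l (increments X n w \o exc_perm g i l)].
pose QB y k n := [set w | Q y k n (uindex U n w).+1 (increments X n w)].
have mQ y' k n l : measurable (Q y' k n l).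
  apply: mset_all => r; apply: (@mset_imp _ _ (fun=> (r < m)%N : Prop)); first exact: mset_cst.
  by apply: mset_lt; [exact: mstat|exact: measurable_cst].
have mQA y' k n : measurable (QA y' k n).
  exact: (measurable_face_n levy cd unif _ (fun _ _ l => mQ y' k n l)).
have mQB y' k n : measurable (QB y' k n).
  rewrite (_ : QB _ _ _ = [set w | exists l, uindex U n w = l /\ Q y' k n l.+1 (increments X n w)]).
    apply: mset_ex => l; apply: mset_and; first exact: (measurable_uindex unif).
    exact: (measurable_preimage (iid_measurable (iid_increments levy cd n)) (mQ y' k n l.+1)).
  apply/seteqP; split => w /=; last by move=> [l [<-]].
  by exists (uindex U n w).
have eQ y' k n : pr P (QA y' k n) = pr P (QB y' k n).
  exact: (face_n_law levy cd unif indU _ (mQ y' k n)).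
have gen : {ae P, forall w, G w /\ forall r t, c r = Some t -> 0 <= t <= 1 /\ (Y w).1 != t}.
  apply: filterI => //; apply: ae_foralln => r; case e : (c r) => [t|]; last exact: aeW.
  by apply: filterS (cne _ _ e) => w ? _ [<-]; split => //; exact: vc e.
have mYr r : (r < m)%N -> measurable_fun setT (fun w => path_eval (Y w) (c r)) by move=> _; apply: mY => t; exact: vc.
have mZr r : (r < m)%N -> measurable_fun setT (fun w => path_eval (Z w) (c r)) by move=> _; apply: mZ => t; exact: vc.
have limA : {ae P, forall w, forall y,
    ((forall r, (r < m)%N -> path_eval (Y w) (c r) < y r) -> eventually2 (fun k n => QA y k n w)) /\
    ((exists2 r, (r < m)%N & y r < path_eval (Y w) (c r)) -> eventually2 (fun k n => ~ QA y k n w))}.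
  apply: filterS gen => w [Gw cw] y'; split => [lt|[r rm gt]].
    have : eventually2 (fun k n => forall r, (r < m)%N -> forall g i l, straddles X U n w g i l ->
        `|stat (c r) k n l (increments X n w \o exc_perm g i l) - path_eval (Y w) (c r)| < y' r - path_eval (Y w) (c r)).
      by apply: eventually2_forall_lt => r rm; apply: stat_transformed (cw r) _ _ => //; rewrite subr_gt0 lt.
    apply: eventually2_imp => k n h; have [_ _ _ /(_ n) [g [i [l s]]] _] := nG Gw.
    by exists g, i, l; split => // r rm; have := h r rm _ _ _ s; rewrite ltr_norml; lra.
  have e0 : 0 < path_eval (Y w) (c r) - y' r by rewrite subr_gt0.
  apply: eventually2_imp (stat_transformed Gw (cw r) e0) => k n h [g [i [l [s q]]]].
  by have := h _ _ _ s; have := q r rm; rewrite ltr_norml; lra.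
have limB : {ae P, forall w, forall y,
    ((forall r, (r < m)%N -> path_eval (Z w) (c r) < y r) -> eventually2 (fun k n => QB y k n w)) /\
    ((exists2 r, (r < m)%N & y r < path_eval (Z w) (c r)) -> eventually2 (fun k n => ~ QB y k n w))}.
  apply: filterS pG => w Gw y'; split => [lt|[r rm gt]].
    have : eventually2 (fun k n => forall r, (r < m)%N ->
        `|stat (c r) k n (uindex U n w).+1 (increments X n w) - path_eval (Z w) (c r)| < y' r - path_eval (Z w) (c r)).
      by apply: eventually2_forall_lt => r rm; apply: stat_identity (vc r) _ _ => //; rewrite subr_gt0 lt.
    apply: eventually2_imp => k n h r rm.
    by have := h r rm; rewrite ltr_norml; lra.
  have e0 : 0 < path_eval (Z w) (c r) - y' r by rewrite subr_gt0.
  apply: eventually2_imp (stat_identity Gw (vc r) e0) => k n h q.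
  by have := h; have := q r rm; rewrite ltr_norml; lra.
apply/eqP; rewrite eq_le; apply/andP; split.
  apply: (pr_compare mYr mZr mQA mQB eQ).
    by apply: filterS limA => w h y'; have [] := h y'.
  by apply: filterS limB => w h y'; have [] := h y'.
apply: (pr_compare mZr mYr mQB mQA (fun y k n => esym (eQ y k n))).
  by apply: filterS limB => w h y'; have [] := h y'.
by apply: filterS limA => w h y'; have [] := h y'.
Qed.

Let pr_U_slice t e : 0 < e -> pr P [set w | U w < t + e] <= pr P [set w | U w < t] + e.
Proof.
move=> e0; have [mU hU] := unif.
have ml y : measurable [set w | U w < y] by exact: (mset_lt mU (measurable_cst y)).
have mI : measurable (U @^-1` `[t, (t + e)[) by apply: (measurable_preimage mU); exact: measurable_itv.
apply: le_trans (_ : pr P ([set w | U w < t] `|` U @^-1` `[t, (t + e)[) <= _).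
  apply: pr_le => //; first exact: measurableU.
  by move=> w /= h; rewrite in_itv /= h andbT; case: (ltP (U w) t); [left|right].
apply: le_trans (prU_le P (ml t) mI) _; rewrite lerD2l -lee_fin -prE // hU; last exact: measurable_itv.
have le : (lebesgue_measure (`[t, (t + e)%R[ `&` `]0%R, 1%R[) <= lebesgue_measure `[t, (t + e)%R[%classic :> \bar R)%E.
  by apply: le_measure; rewrite ?inE; [apply: measurableI; exact: measurable_itv|exact: measurable_itv|exact: subIsetl].
by apply: le_trans le _; rewrite lebesgue_measure_itv /= lte_fin ltrDl e0 -EFinB lee_fin addrAC subrr add0r.
Qed.

Let len_ne t : {ae P, forall w, (Y w).1 != t}.
Proof.
have mY1 : measurable_fun setT (fun w => (Y w).1) by exact: (@mY None).
have law y : pr P [set w | (Y w).1 < y] = pr P [set w | U w < y].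
  (* The single coordinate [None] makes the side condition on times vacuous, so there is no
     circularity. *)
  have := @pr_cylinder_eq 1 (fun=> None) (fun=> y) ltac:(by []) ltac:(by []).
  by congr (pr P _ = pr P _); apply/seteqP; split => w /= h //; [exact: (h 0%N)|exact: (h 0%N)].
have mE : measurable [set w | (Y w).1 = t] by exact: (mset_eq mY1 (measurable_cst t)).
suff : pr P [set w | (Y w).1 = t] = 0.
  by move=> e; apply: negligibleS (pr0_negligible mE e) => w /= /negP; rewrite negbK => /eqP.
have ml y : measurable [set w | (Y w).1 < y] by exact: (mset_lt mY1 (measurable_cst y)).
apply/eqP; rewrite eq_le pr_ge0 andbT; apply/ler_addgt0Pl => e e0; rewrite addr0.
(* An atom at [t] would be a jump of the distribution function, which is that of [U]. *)
have : pr P ([set w | (Y w).1 = t] `|` [set w | (Y w).1 < t]) <= pr P [set w | (Y w).1 < t + e].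
  apply: pr_le => //; first exact: measurableU.
  by move=> w /= [->|]; lra.
rewrite prU //; last by apply/seteqP; split => // w /= [->]; rewrite ltxx.
rewrite !law => h; have := le_trans h (pr_U_slice t e0).
by rewrite addrC lerD2l.
Qed.

Lemma transformed_law A : path_measurable R A -> P (Y @^-1` A) = P (Z @^-1` A).
Proof.
move=> /path_measurable_cylinders mA.
have mY' : measurable_fun setT (Y : Omega -> @cylinder_paths R) by exact: measurable_to_paths.
have mZ' : measurable_fun setT (Z : Omega -> @cylinder_paths R) by exact: measurable_to_paths.
have pre (F : Omega -> @cylinder_paths R) : measurable_fun setT F -> measurable (F @^-1` A).
  by move=> mF; have := mF measurableT A mA; rewrite setTI.
rewrite (prE P (pre _ mY')) (prE P (pre _ mZ')); congr (_%:E).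
have := @pi_law R _ _ _ _ _ (@cylinder_paths R) P P path_cylinders Y Z setT setT 1 1
  erefl path_cylinders_setI mY' mZ' measurableT measurableT erefl _ A mA.
rewrite !setIT !mul1r; apply => B [m [c [y [vc ->]]]]; rewrite !setIT !mul1r.
by apply: pr_cylinder_eq => // r t _; exact: len_ne.
Qed.

End ExcursionTransformLawEquality.

Theorem theorem3 (R : realType) (dsp : measure_display) (Omega : measurableType dsp)
    (P : probability Omega R) (X : R -> Omega -> R) (U : Omega -> R)
    (C : Omega -> R -> R) :
  levy_process01 P X -> CD P X ->
  uniform01 P U -> indep_of_process P U X ->
  (forall w, convex_minorant01 (X ^~ w) (C w)) ->
  let O := fun w => excursion_set (X ^~ w) (C w) in
  let g := fun w => exc_left (X ^~ w) (C w) (U w) in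
  let d := fun w => exc_right (X ^~ w) (C w) (U w) in
  let XU := fun w => shifted_path (X ^~ w) (C w) (U w) in
  {ae P, forall w, O w (U w)} /\
  exists Y : Omega -> R * (R -> R),
    [/\ forall A, path_measurable R A -> measurable (Y @^-1` A),
        {ae P, forall w, Y w = (d w - g w, XU w)} &
        forall A, path_measurable R A ->
          P (Y @^-1` A) = P ((fun w => (U w, X ^~ w)) @^-1` A)].
Proof.
move=> levy cd unif indU minorant O g d XU.
(* The paths that are not nice are merely contained in a measurable null set [N], so [G] is its
   complement. *)
have [N [mN N0 hN]] := nice_ae levy cd unif indU; pose G := ~` N.
have mG : measurable G by exact: measurableC.
have nG w : G w -> nice X U w by move=> nNw; apply: contrapT => /hN.
have pG : {ae P, forall w, G w} by exists N; split => // w /= /contrapT.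
split; first by apply: filterS pG => w /nG nw; have [] := nice_path levy minorant nw.
exists (transformed X U C G); split.
- move=> A /path_measurable_cylinders mA.
  have mY : measurable_fun setT (transformed X U C G : Omega -> @cylinder_paths R).
    by apply: measurable_to_paths => o; exact: (measurable_transformed levy cd unif minorant mG nG).
  by have := mY measurableT A mA; rewrite setTI.
- by apply: filterS pG => w Gw; rewrite /transformed asboolT.
- exact: (transformed_law levy cd unif indU minorant mG nG pG).
Qed.
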